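(* Let $\lambda_1,\dots,\lambda_6\in\mathbb{R}$ satisfy $$\lambda_1+\lambda_3=0,\qquad 2\lambda_1+\lambda_4=0,\qquad \lambda_2=\lambda_6=0 .$$ Let $s>\tfrac32$ and $u_0\in H^s(\mathbb{R})$. Then the solution $u(x,t)$ of the Cauchy problem $$u_t+\lambda_1u^2+\lambda_2uu_x+G\ast(\lambda_3u^2+\lambda_4u_x^2)+\partial_x\big(G\ast(\lambda_5u^2+\lambda_6u_x^2)\big)=0,\quad x\in\mathbb{R},\ t>0,\qquad u(x,0)=u_0(x),$$ exists globally in time.
   Context: $G(x)=\tfrac12e^{-|x|}$ is the Helmholtz kernel on $\mathbb{R}$ and $\ast$ is convolution in $x$. ''The solution'' is the unique maximal solution $u\in C([0,T);H^s(\mathbb{R}))\cap C^1([0,T);H^{s-1}(\mathbb{R}))$ (the Cauchy problem is locally well posed in $H^s(\mathbb{R})$ for $s>\tfrac32$); it exists globally if its maximal existence time is $T=\infty$. *)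

(* Defs.v *)
From HB Require Import structures.
From mathcomp Require Import all_boot all_order all_algebra.
From mathcomp Require Import all_classical all_reals all_analysis.
Set Implicit Arguments.
Unset Strict Implicit.
Unset Printing Implicit Defensive.
Import Order.TTheory GRing.Theory Num.Theory.
Import numFieldNormedType.Exports.
Local Open Scope classical_set_scope.
Local Open Scope ring_scope.

(* MathComp-Analysis.  Elements of L^2(R) and of H^s(R) are represented by
   functions R -> R, and everything below depends on such a function only up to
   almost everywhere equality. *)

(* The L^2 Fourier transform  fhat(xi) = \int f(x) e^{-i x xi} dx  is the limit
   in L^2 of the transforms of the truncations of f to [-n, n].  Complex-valued
   functions are given by the pair of their real and imaginary parts. *)
Definition trunc_fourier {R : realType} (f : R -> R) (n : nat) :
    (R -> R) * (R -> R) :=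
  (fun xi => \int[lebesgue_measure]_(x in `[- n%:R, n%:R]) (f x * cos (x * xi)),
   fun xi => - \int[lebesgue_measure]_(x in `[- n%:R, n%:R]) (f x * sin (x * xi))).

Definition is_fourier {R : realType} (f : R -> R) (F : (R -> R) * (R -> R)) :
    Prop :=
  [/\ F.1 \in Lfun lebesgue_measure 2%:E, F.2 \in Lfun lebesgue_measure 2%:E,
      ('N[lebesgue_measure]_2%:E
         [EFin \o ((trunc_fourier f n).1 \- F.1)%R])%E @[n --> \oo] --> 0%E &
      ('N[lebesgue_measure]_2%:E
         [EFin \o ((trunc_fourier f n).2 \- F.2)%R])%E @[n --> \oo] --> 0%E].

(* Such a transform exists for every f in L^2 (Plancherel) and is unique up to
   almost everywhere equality. *)
Definition fourier {R : realType} (f : R -> R) : (R -> R) * (R -> R) :=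
  get (is_fourier f).

(* ( \int (1 + xi^2)^s |fhat(xi)|^2 dxi )^(1/2);  meaningful for f in L^2 *)
Definition sobolev_norm {R : realType} (s : R) (f : R -> R) : \bar R :=
  ((\int[lebesgue_measure]_xi
     ((1 + xi ^+ 2) `^ s *
      ((fourier f).1 xi ^+ 2 + (fourier f).2 xi ^+ 2))%:E) `^ 2^-1)%E.

(* H^s(R) for s >= 0, where it is a subspace of L^2(R) *)
Definition sobolev {R : realType} (s : R) : set (R -> R) :=
  [set f | f \in Lfun lebesgue_measure 2%:E /\ (sobolev_norm s f < +oo)%E].

Definition test_function {R : realType} (phi : R -> R) : Prop :=
  (forall n x, derivable (phi^`(n))%classic x 1) /\
  (exists M : R, forall x, M < `|x| -> phi x = 0).

Definition is_weak_derivative {R : realType} (f g : R -> R) : Prop :=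
  [/\ locally_integrable setT f, locally_integrable setT g &
      forall phi, test_function phi ->
        \int[lebesgue_measure]_x (f x * (phi^`())%classic x) =
        - \int[lebesgue_measure]_x (g x * phi x)].

(* Unique up to almost everywhere equality when it exists. *)
Definition weak_derivative {R : realType} (f : R -> R) : R -> R :=
  get (is_weak_derivative f).

Definition convolution {R : realType} (f g : R -> R) : R -> R :=
  fun x => \int[lebesgue_measure]_y (f (x - y) * g y).

Definition helmholtz {R : realType} : R -> R := fun x => 2^-1 * expR (- `|x|).

Definition time_interval {R : realType} (T : \bar R) : set R :=
  [set t | 0 <= t /\ (t%:E < T)%E].

Definition continuous_into_sobolev {R : realType} (s : R) (T : \bar R)
    (u : R -> R -> R) : Prop :=
  forall t, time_interval T t -> sobolev s (u t) /\
    sobolev_norm s (u r \- u t) @[r --> within (time_interval T) (nbhs t)]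
      --> 0%E.

(* [ut] is the (one-sided at 0) derivative of [u] in the norm of H^s. *)
Definition derivative_in_sobolev {R : realType} (s : R) (T : \bar R)
    (u ut : R -> R -> R) : Prop :=
  forall t, time_interval T t ->
    sobolev_norm s (fun x => (r - t)^-1 * (u r x - u t x) - ut t x)
      @[r --> within (time_interval T) (t^')] --> 0%E.

Definition is_solution {R : realType} (l1 l2 l3 l4 l5 l6 s : R) (u0 : R -> R)
    (T : \bar R) (u : R -> R -> R) : Prop :=
  [/\ continuous_into_sobolev s T u,
      {ae lebesgue_measure, forall x, u 0 x = u0 x} &
      exists ut : R -> R -> R,
      [/\ continuous_into_sobolev (s - 1) T ut,
          derivative_in_sobolev (s - 1) T u ut &
          forall t, 0 < t -> (t%:E < T)%E ->
          let ux := weak_derivative (u t) in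
          {ae lebesgue_measure, forall x,
            ut t x + l1 * u t x ^+ 2 + l2 * (u t x * ux x)
            + convolution helmholtz
                (fun y => l3 * u t y ^+ 2 + l4 * ux y ^+ 2) x
            + weak_derivative (convolution helmholtz
                (fun y => l5 * u t y ^+ 2 + l6 * ux y ^+ 2)) x = 0}]].

(* The unique maximal solution: every solution is a restriction of it. *)
Definition is_maximal_solution {R : realType} (l1 l2 l3 l4 l5 l6 s : R)
    (u0 : R -> R) (T : \bar R) (u : R -> R -> R) : Prop :=
  [/\ (0 < T)%E, is_solution l1 l2 l3 l4 l5 l6 s u0 T u &
      forall (T' : \bar R) (v : R -> R -> R),
        is_solution l1 l2 l3 l4 l5 l6 s u0 T' v ->
        (T' <= T)%E /\
        forall t, time_interval T' t ->
          {ae lebesgue_measure, forall x, v t x = u t x}].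

(* Main.v *)
From HB Require Import structures.
Require Import Defs.
From mathcomp Require Import all_boot all_order all_algebra.
From mathcomp Require Import all_classical all_reals all_analysis.
From mathcomp Require Import measurable_realfun ring lra.
Set Implicit Arguments.
Unset Strict Implicit.
Unset Printing Implicit Defensive.
Import Order.TTheory GRing.Theory Num.Theory.
Import numFieldNormedType.Exports.
Local Open Scope classical_set_scope.
Local Open Scope ring_scope.

(* The equation is written for the Fourier transform of the solution, as an
   ordinary differential equation U' = N(U) in a weighted L^2 space.  Under the
   hypotheses on the coefficients, N loses no derivative, is tame,
     |N(U)|_s <= C |U|_s |U|_1   (s > 3/2),
   and conserves the H^1 norm: with u the inverse transform of U, the products
   involved are  int u u_x^2,  which cancels, and  int u^2 u_x = 0.  Along a
   solution |U|_1 is therefore constant and the tame estimate is linear in |U|_s,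
   which excludes blow-up.  To get the global solution in one stroke, N is replaced
   by N (1 + M^2) / (1 + |U|_1^2), M = |U_0|_1, which grows linearly and is locally
   Lipschitz, so that Euler's polygons converge on [0, +oo); the norm |U|_1 is
   conserved by this flow too, and the extra factor equals 1 along the solution.
   Uniqueness is Gronwall's lemma in H^(1/2): the difference of two solutions is
   differentiable only in H^(s-1), and s - 1 > 1/2. *)

(** * Lebesgue integrals and square integrable functions *)

(** Write m = u - u_xx and apply 1 - d^2/dx^2 to the equation: under the hypotheses it reads m_t =
    l1 (u^2)_xx + 2 l1 u_x^2 - l5 (u^2)_x. Paired with u, the first term gives -2 l1 int u u_x^2, so
    the values of l3 and l4 are those for which the second term cancels it; a term in l6 would
    contribute int u_x^3. The transport term l2 u u_x is the one that would lose a derivative.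
    Tameness comes from the shape of Young's inequality. On the transform side a product is a
    convolution: one factor carries the weight in L^2, the other is measured in L^1, which H^1
    controls since 1 > 1/2. For u_x^2 the kernel returns two derivatives, so the roles are
    exchanged: the weighted factor is taken in L^1 and the other one in L^2, at the price of |u_x|_0
    <= |u|_1 only. Euler's polygons do not conserve |U|_1. Conservation is proved for their limit,
    along which |U|_1^2 changes by O(h^2) over a time h; the damping bounds the polygons before this
    is known. *)

Lemma eq_ler d (T : porderType d) (x y : T) : x = y -> (x <= y)%O.
Proof. by move=> ->. Qed.

Definition L1 {R : realType} (f : R -> R) : Prop :=
  (@lebesgue_measure R).-integrable setT (EFin \o f).
Notation I f := (Rintegral (@lebesgue_measure _) setT f).

Section real_integral.
Context {R : realType}.
Notation mu := (@lebesgue_measure R).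
Implicit Types f g : R -> R.

Lemma ae_imply (P Q : R -> Prop) : {ae mu, forall x, P x} ->
  (forall x, P x -> Q x) -> {ae mu, forall x, Q x}.
Proof.
move=> H PQ; move: H.
have FF := ae_filter_ringOfSetsType mu; exact: (filterS PQ).
Qed.

Lemma ae_imply2 (P Q S : R -> Prop) : {ae mu, forall x, P x} ->
  {ae mu, forall x, Q x} ->
  (forall x, P x -> Q x -> S x) -> {ae mu, forall x, S x}.
Proof.
move=> HP HQ PQ; move: HP HQ.
have FF := ae_filter_ringOfSetsType mu; exact: (filterS2 _ PQ).
Qed.

Lemma ae_all (P : R -> Prop) : (forall x, P x) -> {ae mu, forall x, P x}.
Proof.
by move=> HP; have FF := ae_filter_ringOfSetsType mu; exact: filterE.
Qed.

Lemma L1_meas f : L1 f -> measurable_fun setT f.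
Proof. by move=> /integrableP[/measurable_EFinP]. Qed.

Lemma L1D f g : L1 f -> L1 g -> L1 (fun x => f x + g x).
Proof. by move=> Lf Lg; have := integrableD measurableT Lf Lg. Qed.

Lemma L1N f : L1 f -> L1 (fun x => - f x).
Proof. by move=> Lf; have := integrableN Lf. Qed.

Lemma L1B f g : L1 f -> L1 g -> L1 (fun x => f x - g x).
Proof. by move=> Lf Lg; apply: (L1D Lf); exact: L1N. Qed.

Lemma L1Zl (k : R) f : L1 f -> L1 (fun x => k * f x).
Proof. by move=> Lf; have := integrableZl measurableT k Lf. Qed.

Lemma L1Zr (k : R) f : L1 f -> L1 (fun x => f x * k).
Proof. by move=> /(L1Zl k); under eq_fun do rewrite mulrC. Qed.

Lemma L1_le g f : measurable_fun setT f -> (forall x, `|f x| <= g x) ->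
  L1 g -> L1 f.
Proof.
move=> mf fg; apply: le_integrable => //; first exact/measurable_EFinP.
move=> x _ /=; rewrite lee_fin.
by apply: (le_trans (fg x)); rewrite ler_norm.
Qed.

Lemma L1_norm f : L1 f -> L1 (fun x => `|f x|).
Proof. by move=> Lf; have := integrable_norm Lf. Qed.

Lemma L1_lty f : measurable_fun setT f ->
  (\int[mu]_x `|f x|%:E < +oo)%E -> L1 f.
Proof. by move=> mf h; apply/integrableP; split => //; exact/measurable_EFinP. Qed.

Lemma ID f g : L1 f -> L1 g -> I (fun x => f x + g x) = I f + I g.
Proof. by move=> Lf Lg; rewrite RintegralD. Qed.

Lemma IB f g : L1 f -> L1 g -> I (fun x => f x - g x) = I f - I g.
Proof. by move=> Lf Lg; rewrite RintegralB. Qed.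

Lemma IZl (k : R) f : L1 f -> I (fun x => k * f x) = k * I f.
Proof. by move=> Lf; rewrite RintegralZl. Qed.

Lemma IZr (k : R) f : L1 f -> I (fun x => f x * k) = I f * k.
Proof. by move=> Lf; rewrite RintegralZr. Qed.

Lemma IN f : L1 f -> I (fun x => - f x) = - I f.
Proof.
move=> Lf; rewrite -mulN1r -IZl//; congr Rintegral.
by apply/funext => x; rewrite mulN1r.
Qed.

Lemma I_le f g : L1 f -> L1 g -> (forall x, f x <= g x) -> I f <= I g.
Proof. by move=> Lf Lg fg; apply: le_Rintegral. Qed.

Lemma I_ge0 f : (forall x, 0 <= f x) -> 0 <= I f.
Proof. by move=> f0; apply: Rintegral_ge0. Qed.

Lemma I_norm f : L1 f -> `|I f| <= I (fun x => `|f x|).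
Proof. by move=> Lf; apply: le_normr_Rintegral. Qed.

Lemma EFin_I f : L1 f -> (I f)%:E = (\int[mu]_x (f x)%:E)%E.
Proof. by move=> Lf; rewrite /Rintegral fineK//; exact: integrable_fin_num. Qed.

Lemma I_ae f g : measurable_fun setT f -> measurable_fun setT g ->
  {ae mu, forall x, f x = g x} -> I f = I g.
Proof.
move=> mf mg fg; rewrite /Rintegral; congr fine.
apply: ae_eq_integral => //; try exact/measurable_EFinP.
by apply: (ae_imply fg) => x /= -> _.
Qed.

Lemma L1_ae f g : measurable_fun setT g -> L1 f ->
  {ae mu, forall x, f x = g x} -> L1 g.
Proof.
move=> mg Lf fg; apply: L1_lty => //.
case/integrableP: (Lf) => mf h; rewrite (_ : (\int[mu]_x _)%E = (\int[mu]_x `|(EFin \o f) x|)%E)//.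
apply: ae_eq_integral => //=.
- by apply/measurable_EFinP; exact: measurableT_comp.
- by apply/measurable_EFinP; apply: measurableT_comp => //; exact: L1_meas.
- by apply: (ae_imply fg) => x /= -> _.
Qed.

Lemma I_eq0 f : L1 f -> (forall x, 0 <= f x) -> I f = 0 ->
  {ae mu, forall x, f x = 0}.
Proof.
move=> Lf f0 If0.
have : (\int[mu]_x `|(EFin \o f) x| = 0)%E.
  rewrite -[RHS]/(0%:E) -If0 EFin_I//; apply: eq_integral => x _ /=.
  by rewrite ger0_norm.
have mf : measurable_fun setT (EFin \o f) by by apply/measurable_EFinP; exact: L1_meas.
move/(ae_eq_integral_abs mu measurableT mf).
by apply: filterS => x /= /(_ Logic.I)[].
Qed.

(** Uniqueness of Lebesgue measure: the pushforward under the reflection gives every half-open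
    interval its length. Translations are later obtained as composites of two reflections. *)
Lemma lebesgue_measure_reflect (c : R) (A : set R) : measurable A ->
  mu A = mu ((fun x => c - x) @^-1` A).
Proof.
have mphi : measurable_fun [set: measurableTypeR R]
  ((fun x => c - x) : measurableTypeR R -> measurableTypeR R).
  exact: measurable_funB.
pose phi : {mfun measurableTypeR R >-> measurableTypeR R} :=
  HB.pack ((fun x => c - x) : measurableTypeR R -> measurableTypeR R)
   (isMeasurableFun.Build _ _ _ _ _ mphi).
move=> mA; apply: (@lebesgue_measure_unique R (pushforward mu phi)) => //= _ [[a b]] _ <-.
rewrite /pushforward (_ : _ @^-1` _ = `[c - b, c - a[%classic); last first.
  apply/seteqP; split=> x; rewrite /= !in_itv/=; lra.
rewrite !lebesgue_measure_itv/= !lte_fin.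
rewrite (_ : (c - b < c - a) = (a < b)); last by apply/idP/idP; lra.
by case: ifP => // _; rewrite -!EFinB; congr EFin; lra.
Qed.

Lemma integral_reflect_ge0 (c : R) (f : R -> \bar R) : measurable_fun setT f ->
  (forall x, 0 <= f x)%E ->
  (\int[mu]_x (f (c - x)%R) = \int[mu]_x (f x))%E.
Proof.
move=> mf f0.
have mphi : measurable_fun [set: measurableTypeR R]
  ((fun x => c - x) : measurableTypeR R -> measurableTypeR R).
  exact: measurable_funB.
pose phi : {mfun measurableTypeR R >-> measurableTypeR R} :=
  HB.pack ((fun x => c - x) : measurableTypeR R -> measurableTypeR R)
   (isMeasurableFun.Build _ _ _ _ _ mphi).
have := @ge0_integral_pushforward _ _ _ _ R phi mphi mu setT f measurableT mf (fun x _ => f0 x).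
rewrite preimage_setT => <-.
by apply: eq_measure_integral => A mA _; exact/esym/lebesgue_measure_reflect.
Qed.

Lemma measurable_reflect d (T : measurableType d) (c : R) (f : R -> T) :
  measurable_fun setT f -> measurable_fun setT (fun x : R => f (c - x)).
Proof. by move=> mf; apply: (measurableT_comp mf); exact: measurable_funB. Qed.

Lemma L1_reflect (c : R) f : L1 f -> L1 (fun x => f (c - x)).
Proof.
move=> Lf; have mf := L1_meas Lf; apply: L1_lty; first exact: measurable_reflect.
rewrite (integral_reflect_ge0 c (f := fun x => `|f x|%:E)) => //.
  by case/integrableP: Lf.
by apply/measurable_EFinP; exact: measurableT_comp.
Qed.

Lemma I_reflect (c : R) f : L1 f -> I (fun x => f (c - x)) = I f.
Proof.
move=> Lf; rewrite /Rintegral; congr fine.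
have mfE : measurable_fun setT (EFin \o f) by apply/measurable_EFinP; exact: L1_meas.
rewrite integralE [RHS]integralE; congr (_ - _)%E.
  rewrite -(integral_reflect_ge0 c (measurable_funepos mfE) (funepos_ge0 _)).
  by apply: eq_integral => x _; rewrite !funeposE.
rewrite -(integral_reflect_ge0 c (measurable_funeneg mfE) (funeneg_ge0 _)).
  by apply: eq_integral => x _; rewrite !funenegE.
Qed.

Lemma L1_opp f : L1 f -> L1 (fun x => f (- x)).
Proof. by move=> /(L1_reflect 0); under eq_fun do rewrite sub0r. Qed.

Lemma I_opp f : L1 f -> I (fun x => f (- x)) = I f.
Proof.
by move=> Lf; rewrite -(I_reflect 0 Lf); congr Rintegral; apply/funext => x; rewrite sub0r.
Qed.

Lemma L1_shift (c : R) f : L1 f -> L1 (fun x => f (x + c)).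
Proof. by move=> /L1_opp/(L1_reflect (- c)); under eq_fun do rewrite opprB opprK. Qed.

Lemma I_shift (c : R) f : L1 f -> I (fun x => f (x + c)) = I f.
Proof.
move=> Lf; rewrite -(I_opp Lf) -(I_reflect (- c) (L1_opp Lf)).
by congr Rintegral; apply/funext => x; rewrite opprB opprK.
Qed.

Definition L1xy (F : R -> R -> R) : Prop :=
  (mu \x mu)%E.-integrable setT (fun p => (F p.1 p.2)%:E).

Lemma L1xy_lty (F : R -> R -> R) : measurable_fun setT (fun p : R * R => F p.1 p.2) ->
  (\int[mu]_x \int[mu]_y `|F x y|%:E < +oo)%E -> L1xy F.
Proof.
move=> mF h; apply/integrable12ltyP => //; exact/measurable_EFinP.
Qed.

Lemma I_swap (F : R -> R -> R) : L1xy F ->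
  (forall x, L1 (F x)) -> (forall y, L1 (F ^~ y)) ->
  I (fun x => I (F x)) = I (fun y => I (F ^~ y)).
Proof.
move=> LF L1x L1y; rewrite /Rintegral; congr fine.
have := Fubini LF => /=.
under eq_integral do rewrite -EFin_I//.
by under [in X in _ = X -> _]eq_integral do rewrite -EFin_I//.
Qed.

Lemma L1xy_le (G F : R -> R -> R) : measurable_fun setT (fun p : R * R => F p.1 p.2) ->
  (forall x y, `|F x y| <= G x y) -> L1xy G -> L1xy F.
Proof.
move=> mF FG; apply: le_integrable => //; first exact/measurable_EFinP.
by move=> p _ /=; rewrite lee_fin (le_trans (FG _ _))// ler_norm.
Qed.

Lemma L1xy_prod (f g : R -> R) : L1 f -> L1 g -> L1xy (fun x y => f x * g y).
Proof.
move=> Lf Lg; have [mf mg] := (L1_meas Lf, L1_meas Lg).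
apply: L1xy_lty.
  apply: measurable_funM; first exact: (measurableT_comp mf measurable_fst).
  exact: (measurableT_comp mg measurable_snd).
under eq_integral => x _.
  under eq_integral do rewrite normrM EFinM.
  rewrite ge0_integralZl//; last by apply/measurable_EFinP; exact: measurableT_comp.
  over.
rewrite -EFin_I; last exact: L1_norm.
rewrite ge0_integralZr//.
- by rewrite -EFin_I; [exact: ltry|exact: L1_norm].
- by apply/measurable_EFinP; exact: measurableT_comp.
- by rewrite lee_fin; exact: I_ge0.
Qed.

Lemma L1xy_swap (F : R -> R -> R) : L1xy F -> L1xy (fun x y => F y x).
Proof.
move=> LF.
have mF : measurable_fun setT (fun p : R * R => F p.1 p.2).
  by case/integrableP: LF => /measurable_EFinP.
apply: L1xy_lty; first exact: (measurableT_comp mF (@measurable_swap _ _ _ _)).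
have mE : measurable_fun setT (fun p : R * R => (F p.1 p.2)%:E) by exact/measurable_EFinP.
exact: (@integrable21ltyP _ _ _ _ R mu mu _ mE).1 LF.
Qed.

(** For fixed x the reflection y -> x - y preserves the inner integral of |F|, so Tonelli's theorem
    carries integrability over. Convolutions enter Fubini's theorem through this lemma. *)
Lemma L1xy_shear (F : R -> R -> R) : L1xy F -> L1xy (fun x y => F x (x - y)).
Proof.
move=> LF.
have mF : measurable_fun setT (fun p : R * R => F p.1 p.2).
  by case/integrableP: LF => /measurable_EFinP.
apply: L1xy_lty.
  apply: (@measurableT_comp _ _ _ _ _ _ (fun p : R * R => F p.1 p.2) _ (fun p : R * R => (p.1, p.1 - p.2)) mF).
  apply/measurable_fun_pair => //=; exact: measurable_funB.
under eq_integral => x _.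
  rewrite (integral_reflect_ge0 x (f := fun y => `|F x y|%:E)) => //; last first.
    apply/measurable_EFinP; apply: measurableT_comp => //.
    exact: (measurableT_comp mF (measurable_pair1 x)).
  over.
have mE : measurable_fun setT (fun p : R * R => (F p.1 p.2)%:E) by exact/measurable_EFinP.
exact: (@integrable12ltyP _ _ _ _ R mu mu _ mE).1 LF.
Qed.

Lemma measurable_I (F : R -> R -> R) :
  measurable_fun setT (fun p : R * R => F p.1 p.2) ->
  measurable_fun setT (fun x => I (F x)).
Proof.
move=> mF; rewrite /Rintegral.
apply: (measurableT_comp (f := fine)) => //.
have mE : measurable_fun setT (fun p : R * R => (F p.1 p.2)%:E) by exact/measurable_EFinP.
rewrite (_ : (fun x => _) = (fun x : R => \int[mu]_y (fun y : R => (F x y)%:E)^\+ y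
  - \int[mu]_y (fun y : R => (F x y)%:E)^\- y)%E); last first.
  by apply/funext => x; rewrite -integralE.
apply: emeasurable_funB.
  apply: eq_measurable_fun (measurable_fun_fubini_tonelli_F (m2 := mu) _ (measurable_funepos mE) (funepos_ge0 _)) => x _.
  by apply: eq_integral => y _; rewrite !funeposE.
apply: eq_measurable_fun (measurable_fun_fubini_tonelli_F (m2 := mu) _ (measurable_funeneg mE) (funeneg_ge0 _)) => x _.
  by apply: eq_integral => y _; rewrite !funenegE.
Qed.

End real_integral.

Definition L2 {R : realType} (f : R -> R) : Prop :=
  measurable_fun setT f /\ L1 (fun x => f x ^+ 2).

Definition nrm {R : realType} (f : R -> R) : R := Num.sqrt (I (fun x => f x ^+ 2)).

Section L2_theory.
Context {R : realType}.
Notation mu := (@lebesgue_measure R).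
Implicit Types f g : R -> R.

Lemma I_dominated (f_ : nat -> R -> R) f g :
  (forall n, measurable_fun setT (f_ n)) -> measurable_fun setT f ->
  {ae mu, forall x, f_ ^~ x @ \oo --> f x} -> L1 g ->
  (forall n x, `|f_ n x| <= g x) -> (fun n => I (f_ n)) @ \oo --> I f.
Proof.
move=> mf_ mf cf Lg fg.
have [] := @dominated_convergence _ _ R mu setT measurableT (fun n x => (f_ n x)%:E) (EFin \o f) (EFin \o g).
- by move=> n; apply/measurable_EFinP; exact: mf_.
- exact/measurable_EFinP.
- by apply: (ae_imply cf) => x cfx _; apply: cvg_EFin => //; apply: nearW.
- by [].
- by apply: ae_all => x n _; rewrite /= lee_fin.
move=> Lf _ h; rewrite /Rintegral; apply: fine_cvg; rewrite fineK//.
exact: integrable_fin_num Lf.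
Qed.

(** Fatou's lemma for a limit that exists only almost everywhere. It yields integrability of the
    limit where no dominating function is at hand. *)
Lemma L1_fatou (f_ : nat -> R -> R) f (C : R) :
  (forall n, L1 (f_ n)) -> (forall n x, 0 <= f_ n x) -> measurable_fun setT f ->
  {ae mu, forall x, f_ ^~ x @ \oo --> f x} -> (forall n, I (f_ n) <= C) ->
  L1 f /\ I f <= C.
Proof.
move=> Lf_ f_0 mf cf fC.
have key : (\int[mu]_x `|f x|%:E <= C%:E)%E.
  apply: (@le_trans _ _ (\int[mu]_x limn_einf (fun n => (f_ n x)%:E))%E).
    apply: ae_ge0_le_integral => //.
    - by apply/measurable_EFinP; exact: measurableT_comp.
    - move=> x _; rewrite limn_einf_lim; apply: lime_ge; first exact: is_cvg_einfs.
      apply: nearW => n; apply: le_ereal_inf_tmp => _ [m _ <-].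
      by rewrite lee_fin.
    - rewrite /limn_einf; apply: measurableT_comp => //.
      apply: measurable_fun_limn_esup => n; apply: measurableT_comp => //.
      by apply/measurable_EFinP; exact: L1_meas.
    - apply: (ae_imply cf) => x cfx _.
      have cE : (fun n => (f_ n x)%:E) @ \oo --> (f x)%:E.
        by apply: cvg_EFin => //; apply: nearW.
      rewrite (cvg_limn_einf_sup cE).1// lee_fin ger0_norm//.
      rewrite -(cvg_lim (@Rhausdorff R) cfx).
      by apply: limr_ge; [apply/cvg_ex; exists (f x)|apply: nearW].
  apply: le_trans (fatou _ _ _ _) _ => //.
    by move=> n; apply/measurable_EFinP; exact: L1_meas.
    by move=> n x _; rewrite lee_fin.
  rewrite limn_einf_lim; apply: lime_le; first exact: is_cvg_einfs.
  apply: nearW => n; apply: (@le_trans _ _ (\int[mu]_x (f_ n x)%:E)%E).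
    by apply: ereal_inf_lbound; exists n => //=.
  by rewrite -EFin_I// lee_fin.
have Lf : L1 f by apply: L1_lty => //; apply: le_lt_trans key _; exact: ltry.
split => //; rewrite -lee_fin EFin_I//; apply: le_trans key.
apply: le_integral => //; last by move=> x _; rewrite /= lee_fin ler_norm.
exact: L1_norm.
Qed.
Lemma L1_sqr f : L2 f -> L1 (fun x => f x ^+ 2). Proof. by case. Qed.
Lemma L2_meas f : L2 f -> measurable_fun setT f. Proof. by case. Qed.

Lemma L2_le g f : measurable_fun setT f -> (forall x, `|f x| <= `|g x|) ->
  L2 g -> L2 f.
Proof.
move=> mf fg [mg Lg]; split => //.
apply: L1_le Lg; first exact: measurable_funX.
by move=> x; rewrite normrX -[leRHS]real_normK ?num_real// ler_sqr ?nnegrE.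
Qed.

Lemma L1M f g : L2 f -> L2 g -> L1 (fun x => f x * g x).
Proof.
move=> [mf Lf] [mg Lg]; apply: L1_le (L1D Lf Lg); first exact: measurable_funM.
move=> x; rewrite ler_norml; apply/andP; split; nra.
Qed.

Lemma L2_norm f : L2 f -> L2 (fun x => `|f x|).
Proof.
move=> Lf; apply: L2_le (Lf) => [|x]; last by rewrite normr_id.
by apply: measurableT_comp => //; exact: L2_meas.
Qed.

Lemma L2D f g : L2 f -> L2 g -> L2 (fun x => f x + g x).
Proof.
move=> Lf Lg; split; first by apply: measurable_funD; [case: Lf|case: Lg].
rewrite (_ : (fun x => _) = (fun x => f x ^+ 2 + 2 * (f x * g x) + g x ^+ 2)); last first.
  by apply/funext => x; ring.
by apply: L1D; [apply: L1D; [exact: L1_sqr|apply: L1Zl; exact: L1M]|exact: L1_sqr].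
Qed.

Lemma L2Zl (k : R) f : L2 f -> L2 (fun x => k * f x).
Proof.
move=> [mf Lf]; split; first exact: measurable_funM.
by under eq_fun do rewrite exprMn; exact: L1Zl.
Qed.

Lemma L2N f : L2 f -> L2 (fun x => - f x).
Proof. by move=> /(L2Zl (-1)); under eq_fun do rewrite mulN1r. Qed.

Lemma L2B f g : L2 f -> L2 g -> L2 (fun x => f x - g x).
Proof. by move=> Lf /L2N Lg; exact: L2D. Qed.

Lemma L2_0 : L2 (fun _ : R => 0 : R).
Proof.
split => //; under eq_fun do rewrite expr0n/=.
exact: (@integrable0 _ _ R mu setT).
Qed.

Lemma L2_reflect (c : R) f : L2 f -> L2 (fun x => f (c - x)).
Proof. by move=> [mf Lf]; split; [exact: measurable_reflect|exact: (L1_reflect c Lf)]. Qed.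

Lemma L2_opp f : L2 f -> L2 (fun x => f (- x)).
Proof. by move=> /(L2_reflect 0); under eq_fun do rewrite sub0r. Qed.

Lemma nrm_ge0 f : 0 <= nrm f. Proof. exact: sqrtr_ge0. Qed.

Lemma sqr_nrm f : nrm f ^+ 2 = I (fun x => f x ^+ 2).
Proof. by rewrite sqr_sqrtr//; apply: I_ge0 => x; exact: sqr_ge0. Qed.

Lemma nrm_opp f : L2 f -> nrm (fun x => f (- x)) = nrm f.
Proof. by move=> [mf Lf]; rewrite /nrm (I_opp Lf). Qed.

Lemma nrm_reflect (c : R) f : L2 f -> nrm (fun x => f (c - x)) = nrm f.
Proof. by move=> [mf Lf]; rewrite /nrm (I_reflect c Lf). Qed.

Lemma nrm_le f g : L2 f -> L2 g -> (forall x, `|f x| <= `|g x|) -> nrm f <= nrm g.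
Proof.
move=> [_ Lf] [_ Lg] fg; rewrite ler_wsqrtr//; apply: I_le => // x.
by rewrite -real_normK ?num_real// -[leRHS]real_normK ?num_real// ler_sqr ?nnegrE.
Qed.

Lemma nrm_norm f : nrm (fun x => `|f x|) = nrm f.
Proof. by rewrite /nrm; congr (Num.sqrt (Rintegral _ _ _)); apply/funext => x; rewrite real_normK ?num_real. Qed.

Lemma nrmZ (k : R) f : L2 f -> nrm (fun x => k * f x) = `|k| * nrm f.
Proof.
move=> [mf Lf]; rewrite /nrm -sqrtr_sqr -sqrtrM ?sqr_ge0// -IZl//.
by congr (Num.sqrt (Rintegral _ _ _)); apply/funext => x; rewrite exprMn.
Qed.

Lemma nrmN f : nrm (fun x => - f x) = nrm f.
Proof. by rewrite -[LHS]nrm_norm -[RHS]nrm_norm; under eq_fun do rewrite normrN. Qed.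

Lemma sqr_nrmD f g : L2 f -> L2 g ->
  nrm (fun x => f x + g x) ^+ 2 = nrm f ^+ 2 + 2 * I (fun x => f x * g x) + nrm g ^+ 2.
Proof.
move=> Lf Lg; rewrite !sqr_nrm -IZl; last exact: L1M.
rewrite -ID; [|exact: L1_sqr|apply: L1Zl; exact: L1M].
rewrite -ID; [|apply: L1D; [exact: L1_sqr|apply: L1Zl; exact: L1M]|exact: L1_sqr].
by congr (Rintegral _ _ _); apply/funext => x; ring.
Qed.

Lemma cauchy_schwarz f g : L2 f -> L2 g -> `|I (fun x => f x * g x)| <= nrm f * nrm g.
Proof.
move=> Lf Lg.
set p := I _.
have key t : 0 <= nrm f ^+ 2 + 2 * (t * p) + t ^+ 2 * nrm g ^+ 2.
  have := sqr_ge0 (nrm (fun x => f x + t * g x)).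
  rewrite sqr_nrmD//; last exact: L2Zl.
  rewrite nrmZ// exprMn real_normK ?num_real//.
  rewrite (_ : I (fun x => f x * (t * g x)) = t * p)//.
  rewrite /p -IZl; last exact: L1M.
  by congr (Rintegral _ _ _); apply/funext => x; ring.
have [f0 g0] := (nrm_ge0 f, nrm_ge0 g).
have [g00|gN0] := eqVneq (nrm g) 0.
  rewrite g00 mulr0 normr_le0; apply/eqP.
  apply/eqP; apply: contraT => p0.
  (* With [nrm g = 0] the quadratic is affine in t; at this t it equals [- nrm f ^+ 2 - 2 < 0]. *)
  have := key (- (nrm f ^+ 2 + 1) / p).
  rewrite g00 mulfVK// expr0n/= mulr0; nra.
(* The minimizer of the quadratic in t. *)
have := key (- p / nrm g ^+ 2).
rewrite -(@ler_sqr _ `|p|) ?nnegrE ?mulr_ge0// real_normK ?num_real// => h.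
have gp : 0 < nrm g ^+ 2 by rewrite exprn_gt0// lt_def gN0.
rewrite exprMn -ler_pdivrMr//.
have -> : p ^+ 2 / nrm g ^+ 2 = - (2 * (- p / nrm g ^+ 2 * p) + (- p / nrm g ^+ 2) ^+ 2 * nrm g ^+ 2).
  by field.
lra.
Qed.

Lemma I_normM_le f g : L2 f -> L2 g -> I (fun x => `|f x| * `|g x|) <= nrm f * nrm g.
Proof.
move=> Lf Lg; rewrite -[nrm f]nrm_norm -[nrm g]nrm_norm.
apply: le_trans (ler_norm _) _; apply: cauchy_schwarz; exact: L2_norm.
Qed.

Lemma nrmD_le f g : L2 f -> L2 g -> nrm (fun x => f x + g x) <= nrm f + nrm g.
Proof.
move=> Lf Lg; rewrite -ler_sqr ?nnegrE ?addr_ge0 ?nrm_ge0// sqr_nrmD//.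
have := cauchy_schwarz Lf Lg; rewrite ler_norml => /andP[_ h].
rewrite sqrrD; lra.
Qed.

Lemma nrmB_le f g : L2 f -> L2 g -> nrm (fun x => f x - g x) <= nrm f + nrm g.
Proof. by move=> Lf Lg; rewrite -(nrmN g); apply: nrmD_le => //; exact: L2N. Qed.

Lemma nrmB f g : nrm (fun x => f x - g x) = nrm (fun x => g x - f x).
Proof. by rewrite -nrmN; congr nrm; apply/funext => x; rewrite opprB. Qed.

Lemma nrm_triangle g f h : L2 f -> L2 g -> L2 h ->
  nrm (fun x => f x - h x) <= nrm (fun x => f x - g x) + nrm (fun x => g x - h x).
Proof.
move=> Lf Lg Lh.
rewrite (_ : (fun x => f x - h x) = (fun x => (f x - g x) + (g x - h x))); last first.
  by apply/funext => x; ring.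
by apply: nrmD_le; exact: L2B.
Qed.

Lemma nrm_dist f g : L2 f -> L2 g -> `|nrm f - nrm g| <= nrm (fun x => f x - g x).
Proof.
move=> Lf Lg; rewrite ler_norml; apply/andP; split.
  have := nrmD_le (L2B Lg Lf) Lf; under eq_fun do rewrite subrK.
  rewrite nrmB; lra.
have := nrmD_le (L2B Lf Lg) Lg; under eq_fun do rewrite subrK.
lra.
Qed.

Lemma nrm_eq0 f : L2 f -> nrm f = 0 -> {ae mu, forall x, f x = 0}.
Proof.
move=> [mf Lf] f0.
have h := I_eq0 Lf (fun x => sqr_ge0 (f x)).
apply: ae_imply (h _) _; first by rewrite -sqr_nrm f0 expr0n.
by move=> x /eqP; rewrite sqrf_eq0 => /eqP.
Qed.

Lemma nrm_ae0 f : measurable_fun setT f -> {ae mu, forall x, f x = 0} -> nrm f = 0.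
Proof.
move=> mf f0; rewrite /nrm (@I_ae _ _ (fun=> 0)).
- by rewrite /Rintegral integral0/= sqrtr0.
- exact: measurable_funX.
- exact: measurable_cst.
- by apply: ae_imply f0 _ => x ->; rewrite expr0n.
Qed.

Lemma L2_ae f g : measurable_fun setT g -> L2 f -> {ae mu, forall x, f x = g x} -> L2 g.
Proof.
move=> mg [mf Lf] fg; split => //; apply: L1_ae Lf _; first exact: measurable_funX.
by apply: ae_imply fg _ => x ->.
Qed.

Lemma nrm_ae f g : measurable_fun setT f -> measurable_fun setT g ->
  {ae mu, forall x, f x = g x} -> nrm f = nrm g.
Proof.
move=> mf mg fg; rewrite /nrm (@I_ae _ _ (fun x => g x ^+ 2))//; try exact: measurable_funX.
by apply: ae_imply fg _ => x ->.
Qed.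

Lemma nrm_telescope (f_ : nat -> R -> R) (C : R) (n k : nat) : (forall n, L2 (f_ n)) ->
  (forall n, nrm (fun x => f_ n.+1 x - f_ n x) <= C / 2 ^+ n) ->
  nrm (fun x => f_ (n + k)%N x - f_ n x) <= 2 * C / 2 ^+ n * (1 - 1 / 2 ^+ k).
Proof.
move=> Lf fC; elim: k => [|k IH].
  rewrite addn0 expr0 divr1 subrr mulr0 nrm_ae0//; last by apply: ae_all => x; rewrite subrr.
  by apply: measurable_funB; exact: L2_meas.
have := nrm_triangle (Lf (n + k.+1)%N) (Lf (n + k)%N) (Lf n).
move/le_trans; apply; rewrite addnS; apply: (le_trans (lerD (fC _) IH)).
rewrite exprD exprS.
have h (m : nat) : 0 < (2 : R) ^+ m by rewrite exprn_gt0.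
apply: eq_ler; field.
by rewrite !gt_eqF.
Qed.

(** The Riesz-Fischer argument: the partial sums [g N] of the absolute increments have bounded L^2
    norms, so by monotone convergence their supremum is square integrable, hence finite almost
    everywhere. There the telescoping series converges absolutely. *)
Lemma L2_cvg_ae (f_ : nat -> R -> R) (C : R) : (forall n, L2 (f_ n)) ->
  (forall n, nrm (fun x => f_ n.+1 x - f_ n x) <= C / 2 ^+ n) ->
  {ae mu, forall x, cvgn (f_ ^~ x)}.
Proof.
move=> Lf fC.
have C0 : 0 <= C by have := fC 0%N; rewrite expr0 divr1; exact: le_trans (nrm_ge0 _).
pose g N x : R := \sum_(0 <= k < N) `|f_ k.+1 x - f_ k x|.
have Lg N : L2 (g N) /\ nrm (g N) <= 2 * C * (1 - 1 / 2 ^+ N).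
  elim: N => [|N [L IH]].
    rewrite /g (_ : (fun x => _) = (fun=> 0)); last by apply/funext => x; rewrite big_geq.
    split; first exact: L2_0.
    rewrite expr0 divr1 subrr mulr0 nrm_ae0//; exact: ae_all.
  have gE : g N.+1 = (fun x => g N x + `|f_ N.+1 x - f_ N x|).
    by apply/funext => x; rewrite /g big_nat_recr.
  have LN : L2 (fun x => `|f_ N.+1 x - f_ N x|) by apply: L2_norm; exact: L2B.
  rewrite gE; split; first exact: L2D.
  apply: (le_trans (nrmD_le L LN)); rewrite nrm_norm.
  apply: (le_trans (lerD IH (fC _))); rewrite exprS.
  have h (m : nat) : 0 < (2 : R) ^+ m by rewrite exprn_gt0.
  apply: eq_ler; field.
  by rewrite !gt_eqF.
have g0 N x : 0 <= g N x by apply: sumr_ge0.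
have gnd x : nondecreasing_seq (g ^~ x).
  by apply/nondecreasing_seqP => n; rewrite /g big_nat_recr//= lerDl.
pose h N x := (g N x ^+ 2)%:E.
have mh N : measurable_fun setT (h N).
  by apply/measurable_EFinP; apply: measurable_funX; exact: L2_meas (Lg N).1.
have h0 N x : (0 <= h N x)%E by rewrite lee_fin sqr_ge0.
have hnd x : nondecreasing_seq (h ^~ x).
  by move=> m n mn; rewrite lee_fin ler_sqr ?nnegrE//; exact: gnd.
have hC : (\int[mu]_x limn (h ^~ x) <= ((2 * C) ^+ 2)%:E)%E.
  rewrite monotone_convergence//.
  apply: lime_le.
    apply: ereal_nondecreasing_is_cvgn => m n mn.
    by apply: ge0_le_integral; try exact: mh; try (by move=> x _; exact: h0); try (by move=> x _; exact: hnd); exact: measurableT.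
  apply: nearW => n; rewrite /h -EFin_I ?lee_fin; last exact: L1_sqr (Lg n).1.
  rewrite -sqr_nrm ler_sqr ?nnegrE ?nrm_ge0//; last by rewrite mulr_ge0.
  apply: (le_trans (Lg n).2).
  rewrite ler_piMr ?mulr_ge0// gerBl divr_ge0// exprn_ge0//.
have mlim : measurable_fun setT (fun x => limn (h ^~ x)).
  apply: (emeasurable_fun_cvg h) => // x _.
  exact: (ereal_nondecreasing_is_cvgn (hnd x)).
have Llim : mu.-integrable setT (fun x => limn (h ^~ x)).
  apply/integrableP; split => //; apply: le_lt_trans (ltry ((2 * C) ^+ 2)).
  under eq_integral => x _.
    rewrite gee0_abs; last first.
      apply: lime_ge; first exact: (ereal_nondecreasing_is_cvgn (hnd x)).
      by apply: nearW => n; exact: h0.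
    over.
  exact: hC.
apply: ae_imply (integrable_ae measurableT Llim) _ => x /(_ Logic.I) fin.
have ub : has_ubound (range (g ^~ x)).
  (* Only the squares [g n x ^+ 2] are bounded by the limit; [y <= 1 + y ^+ 2] gives a bound for
     [g n x]. *)
  exists (1 + fine (limn (h ^~ x))) => _ [n _ <-].
  have : (h n x <= limn (h ^~ x))%E.
    apply: lime_ge; first exact: (ereal_nondecreasing_is_cvgn (hnd x)).
    by exists n => // m /= nm; exact: hnd.
  rewrite -[leRHS]fineK// lee_fin => le1.
  have := g0 n x; nra.
have cg : cvgn (g ^~ x) by exact: (nondecreasing_is_cvgn (gnd x) ub).
have : cvgn (series (telescope (f_ ^~ x))) by apply: normed_cvg; exact: cg.
move=> cs.
have -> : f_ ^~ x = (fun n => f_ 0%N x + series (telescope (f_ ^~ x)) n).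
  by apply/funext => n; exact: (eq_sum_telescope (f_ ^~ x)).
by apply: is_cvgD => //; exact: is_cvg_cst.
Qed.

Lemma L2_complete (f_ : nat -> R -> R) (C : R) : (forall n, L2 (f_ n)) ->
  (forall n, nrm (fun x => f_ n.+1 x - f_ n x) <= C / 2 ^+ n) ->
  exists f, L2 f /\ forall n, nrm (fun x => f_ n x - f x) <= 2 * C / 2 ^+ n.
Proof.
move=> Lf fC.
have C0 : 0 <= C by have := fC 0%N; rewrite expr0 divr1; exact: le_trans (nrm_ge0 _).
(* The upper limit is measurable everywhere and agrees with the limit wherever the sequence
   converges. *)
pose f x := fine (limn_esup (fun n => (f_ n x)%:E)).
have mf : measurable_fun setT f.
  apply: (measurableT_comp (f := fine)) => //.
  by apply: measurable_fun_limn_esup => n; apply/measurable_EFinP; exact: L2_meas.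
have cf : {ae mu, forall x, f_ ^~ x @ \oo --> f x}.
  apply: ae_imply (L2_cvg_ae Lf fC) _ => x /cvg_ex[l cl].
  suff -> : f x = l by exact: cl.
  have cE : (fun n => (f_ n x)%:E) @ \oo --> l%:E.
    by apply: cvg_EFin => //; apply: nearW.
  by rewrite /f (cvg_limn_einf_sup cE).2.
(* Fatou's lemma in m, with n fixed, applied to [f_ n - f_ (n + m)]. *)
have key n : L1 (fun x => (f_ n x - f x) ^+ 2) /\ I (fun x => (f_ n x - f x) ^+ 2) <= (2 * C / 2 ^+ n) ^+ 2.
  apply: (L1_fatou (f_ := fun m x => (f_ n x - f_ (n + m)%N x) ^+ 2) (f := fun x => (f_ n x - f x) ^+ 2)).
  - by move=> m; apply: L1_sqr; exact: L2B.
  - by move=> m x; exact: sqr_ge0.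
  - by apply: measurable_funX; apply: measurable_funB => //; exact: L2_meas.
  - apply: ae_imply cf _ => x cx.
    have cx' : (fun m => f_ (n + m)%N x) @ \oo --> f x.
      under eq_fun do rewrite addnC.
      by move: cx; rewrite -(cvg_shiftn n).
    by apply: cvgM; apply: cvgB => //; exact: cvg_cst.
  - move=> m; rewrite -sqr_nrm ler_sqr ?nnegrE ?nrm_ge0//.
      rewrite nrmB; apply: (le_trans (nrm_telescope n m Lf fC)).
      by rewrite ler_piMr ?divr_ge0 ?mulr_ge0 ?exprn_ge0// gerBl divr_ge0// exprn_ge0.
    by rewrite divr_ge0 ?mulr_ge0 ?exprn_ge0.
have Lff n : L2 (fun x => f_ n x - f x).
  split; last exact: (key n).1.
  by apply: measurable_funB => //; exact: L2_meas.
exists f; split.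
  have := L2B (Lf 0%N) (Lff 0%N).
  by under eq_fun do rewrite opprB addrC subrK.
move=> n; rewrite -ler_sqr ?nnegrE ?nrm_ge0//; first by rewrite sqr_nrm; exact: (key n).2.
by rewrite divr_ge0 ?mulr_ge0 ?exprn_ge0.
Qed.

End L2_theory.

(** * Continuity of translations *)

Section translation.
Context {R : realType}.
Notation mu := (@lebesgue_measure R).
Implicit Types f g : R -> R.

Definition box (N x : R) : R := \1_`[- N, N] x.

Lemma boxE N x : box N x = (`|x| <= N)%R%:R.
Proof. by rewrite /box indicE mem_setE in_itv/= ler_norml. Qed.

Lemma box_ge0 N x : 0 <= box N x. Proof. by rewrite boxE ler0n. Qed.
Lemma box_le1 N x : box N x <= 1. Proof. by rewrite boxE; case: (leP `|x| N). Qed.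

Lemma measurable_box N : measurable_fun setT (box N).
Proof. by apply: measurable_indic; exact: measurable_itv. Qed.

Lemma L1_box N : L1 (box N).
Proof.
apply/integrableP; split; first by apply/measurable_EFinP; exact: measurable_box.
under eq_integral do rewrite /= ger0_norm ?box_ge0//.
have mI : @measurable _ (measurableTypeR R) `[- N, N]%classic by exact: measurable_itv.
have -> : (\int[mu]_x (box N x)%:E)%E = mu `[- N, N]%classic by rewrite /box integral_indic// setIT.
rewrite lebesgue_measure_itv/=.
by case: ifP => _; rewrite ?ltry// -EFinB ltry.
Qed.

Lemma box_cvg1 x : (fun n : nat => box n%:R x) @ \oo --> (1 : R).
Proof.
apply: cvg_near_cst; near=> n; rewrite boxE.
suff -> : `|x| <= n%:R by [].
by near: n; exact: nbhs_infty_ger.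
Unshelve. all: by end_near. Qed.

Lemma L2_box N f : L2 f -> L2 (fun x => f x * box N x).
Proof.
move=> Lf; apply: L2_le (Lf).
  by apply: measurable_funM; [exact: L2_meas|exact: measurable_box].
by move=> x; rewrite normrM (ger0_norm (box_ge0 _ _)) ler_piMr// box_le1.
Qed.

Lemma L1_L2_box N f : L2 f -> L1 (fun x => f x * box N x).
Proof.
move=> Lf; have Lb : L2 (box N).
  split; first exact: measurable_box.
  rewrite (_ : (fun x => _) = box N); first exact: L1_box.
  by apply/funext => x; rewrite boxE; case: (leP `|x| N) => _; rewrite ?expr0n ?expr1n.
exact: L1M.
Qed.

Lemma nrm_cvg0 (f_ : nat -> R -> R) g : (forall n, measurable_fun setT (f_ n)) ->
  (forall n x, `|f_ n x| <= `|g x|) -> L2 g ->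
  {ae mu, forall x, f_ ^~ x @ \oo --> 0} ->
  (fun n => nrm (f_ n)) @ \oo --> 0.
Proof.
move=> mf fg Lg cf.
have key : (fun n => I (fun x => f_ n x ^+ 2)) @ \oo --> I (fun _ : R => 0 : R).
  apply: (@I_dominated R (fun n x => f_ n x ^+ 2) (fun _ => 0) (fun x => g x ^+ 2)).
  - by move=> n; exact: measurable_funX.
  - exact: measurable_cst.
  - apply: ae_imply cf _ => x cx; rewrite -[0](mulr0 (0:R)); exact: cvgM.
  - exact: L1_sqr.
  - move=> n x; rewrite normrX -[leRHS]real_normK ?num_real// ler_sqr ?nnegrE//.
have -> : (fun n => nrm (f_ n)) = Num.sqrt \o (fun n => I (fun x => f_ n x ^+ 2)) by [].
rewrite (_ : 0 = Num.sqrt (I (fun _ : R => 0 : R))); last first.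
  by rewrite /Rintegral integral0/= sqrtr0.
by apply: continuous_cvg => //; exact: sqrt_continuous.
Qed.

Lemma nrm_box_cvg f : L2 f -> (fun n => nrm (fun x => f x * box n%:R x - f x)) @ \oo --> 0.
Proof.
move=> Lf; apply: (@nrm_cvg0 _ f) => //.
- move=> n; apply: measurable_funB; last exact: L2_meas.
  by apply: L2_meas; exact: L2_box.
- move=> n x; rewrite -[X in _ - X]mulr1 -mulrBr normrM ler_piMr//.
  by rewrite distrC ger0_norm ?subr_ge0 ?box_le1// lerBlDr lerDl box_ge0.
- apply: ae_all => x; rewrite -[0](subrr (f x)); apply: cvgB; last exact: cvg_cst.
  rewrite -[X in _ --> X](mulr1 (f x)); apply: cvgM; first exact: cvg_cst.
  exact: box_cvg1.
Qed.

(** Truncation both in space and in value: the bound on the values later turns an L^1 modulus of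
    continuity into an L^2 one. *)
Lemma L2_truncation f (e : R) : L2 f -> 0 < e ->
  exists g (M : R), [/\ L2 g, 0 <= M, (forall x, `|g x| <= M),
    (forall x, M < `|x| -> g x = 0) & nrm (fun x => f x - g x) <= e].
Proof.
move=> Lf e0.
pose g (n : nat) x := f x * box n%:R x * box n%:R (f x).
have mg n : measurable_fun setT (g n).
  apply: measurable_funM; first by apply: L2_meas; exact: L2_box.
  by apply: measurableT_comp; [exact: measurable_box|exact: L2_meas].
have gf n x : `|g n x| <= `|f x|.
  rewrite /g !boxE; case: (leP `|x| n%:R) => _; case: (leP `|f x| n%:R) => _; rewrite ?(mulr0,mulr1,mul0r) ?normr0//.
have c : (fun n => nrm (fun x => f x - g n x)) @ \oo --> 0.
  apply: (@nrm_cvg0 _ f) => //.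
  - by move=> n; apply: measurable_funB => //; exact: L2_meas.
  - move=> n x; rewrite /g !boxE; case: (leP `|x| n%:R) => _; case: (leP `|f x| n%:R) => _;
      by rewrite ?(mulr0,mulr1,mul0r) ?subrr ?subr0 ?normr0.
  - apply: ae_all => x; rewrite -[0](subrr (f x)); apply: cvgB; first exact: cvg_cst.
    rewrite -(mulr1 (f x)) -(mulr1 (f x * 1)).
    by apply: cvgM; [apply: cvgM; [exact: cvg_cst|exact: box_cvg1]|exact: box_cvg1].
have [n _ /(_ n)] : \forall n \near \oo, nrm (fun x => f x - g n x) < e.
  have /cvgr_lt := c; exact.
move=> /(_ (leqnn n))/= ne.
exists (g n), n%:R; split => //.
- exact: L2_le (mg n) (gf n) Lf.
- move=> x; rewrite /g !boxE; case: (leP `|x| n%:R) => _; case: (leP `|f x| n%:R) => //;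
    by rewrite ?(mulr0,mulr1,mul0r) ?normr0.
- by move=> x; rewrite /g boxE leNgt => -> /=; rewrite mulr0 mul0r.
- exact: ltW.
Qed.

Lemma I_patch (E : set R) (F : R -> R) : @measurable _ (measurableTypeR R) E ->
  mu.-integrable E (EFin \o F) -> L1 (fun x => \1_E x * F x) /\
  (\int[mu]_(x in E) (F x)%:E = (I (fun x => \1_E x * F x))%:E)%E.
Proof.
move=> mE LF.
have h : (EFin \o F) \_ E = (fun x => (\1_E x * F x)%:E).
  apply/funext => x; rewrite patchE indicE; case: (x \in E); by rewrite /= ?mul1r ?mul0r.
have L : L1 (fun x => \1_E x * F x).
  by have := (@integrable_mkcond _ (measurableTypeR R) R mu E (EFin \o F) mE).1 LF; rewrite h.
by split => //; rewrite EFin_I// integral_mkcond/= h.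
Qed.

Lemma L1_bounded_support g (M : R) : measurable_fun setT g ->
  (forall x, `|g x| <= M) -> (forall x, M < `|x| -> g x = 0) -> L1 g.
Proof.
move=> mg gM g0; apply: (@L1_le _ (fun x => M * box M x)) => // [x|].
  rewrite boxE; case: (leP `|x| M) => [|h]; first by rewrite mulr1.
  by rewrite mulr0 g0 ?normr0.
by apply: L1Zl; exact: L1_box.
Qed.

(** Continuous functions are dense in L^1 of a bounded interval, and for a continuous h the integral
    of |h(x - y) - h(x)| over a bounded interval tends to 0 by dominated convergence. The rest is an
    argument with three times e / 3. *)
Lemma L1_translation g (M : R) : measurable_fun setT g -> 0 <= M ->
  (forall x, `|g x| <= M) -> (forall x, M < `|x| -> g x = 0) ->
  (fun y => I (fun x => `|g (x - y) - g x|)) @ (0 : R) --> (0 : R).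
Proof.
move=> mg M0 gM g0.
(* The margin 2 leaves room for shifts |y| <= 1: if |x| <= N - 1 then x - y stays in [-N, N], and
   otherwise g vanishes at both x and x - y. *)
pose N := M + 2.
pose E : set R := `[- N, N]%classic.
have mE : @measurable _ (measurableTypeR R) E by exact: measurable_itv.
have muE : (mu E < +oo)%E.
  by rewrite lebesgue_measure_itv/=; case: ifP => _; rewrite ?ltry// -EFinB ltry.
have Lg := L1_bounded_support mg gM g0.
have LgE : mu.-integrable E (EFin \o g).
  exact: integrableS Lg.
have [h_ [ch Lh hcvg]] := approximation_continuous_integrable mE muE LgE.
apply/cvgrPdist_le => /= e e0.
have [n hn] : exists n, I (fun x => box N x * `|g x - h_ n x|) <= e / 3.
  have Ln n := I_patch mE (integrable_norm (integrableB mE LgE (Lh n))).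
  have /fine_cvgP[_ /cvgrPdist_le/(_ (e / 3))] := hcvg.
  rewrite divr_gt0// => /(_ isT)[n _ /(_ n (leqnn n))] /=.
  rewrite sub0r normrN => H; exists n.
  apply: le_trans (ler_norm _) _; apply: le_trans H; apply: eq_ler.
  by congr (`| _ |); rewrite -[RHS]/(fine _) (Ln n).2.
pose h := h_ n; have {}ch : continuous h := ch n.
have mh : measurable_fun setT h by exact: continuous_measurable_fun.
have [K K0 hK] : exists2 K : R, 0 <= K & forall x, `|x| <= N + 1 -> `|h x| <= K.
  have NN : - (N + 1) <= N + 1 by rewrite /N; lra.
  have ca : {within `[- (N + 1), N + 1], continuous (fun x => `|h x|)}.
    apply: continuous_subspaceT => x; apply: continuous_comp; [exact: ch|exact: norm_continuous].
  have [c _ hc] := EVT_max NN ca.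
  by exists `|h c| => // x xN; apply: hc; rewrite in_itv/= -ler_norml.
have LgB : L1 (fun x => box N x * `|g x - h x|).
  apply: (@L1_le _ (fun x => (M + K) * box N x)); last by apply: L1Zl; exact: L1_box.
    apply: measurable_funM; first exact: measurable_box.
    by apply: measurableT_comp => //; exact: measurable_funB.
  move=> x; rewrite boxE; case: (leP `|x| N) => xN; last by rewrite mul0r mulr0 normr0.
  rewrite mul1r mulr1 normr_id (le_trans (ler_normB _ _))// lerD// hK//; lra.
pose S y := I (fun x => box (N - 1) x * `|h (x - y) - h x|).
have LS y : `|y| <= 1 -> L1 (fun x => box (N - 1) x * `|h (x - y) - h x|).
  move=> y1; apply: (@L1_le _ (fun x => (K + K) * box N x)); last by apply: L1Zl; exact: L1_box.
    apply: measurable_funM; first exact: measurable_box.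
    apply: measurableT_comp => //; apply: measurable_funB => //.
    by apply: measurableT_comp => //; exact: measurable_funB.
  move=> x; rewrite !boxE; case: (leP `|x| (N - 1)) => xN; last by rewrite mul0r normr0; case: (leP `|x| N) => _; rewrite ?mulr1 ?mulr0// addr_ge0.
  rewrite (_ : `|x| <= N); last by lra.
  rewrite mul1r mulr1 normr_id (le_trans (ler_normB _ _))// lerD// hK//; last by lra.
  by have := ler_normB x y; lra.
have cS : S @ (0 : R) --> (0 : R).
  have S0 : I (fun _ : R => 0 : R) = 0 by rewrite /Rintegral integral0.
  (* Dominated convergence is about sequences, hence the sequential form of the limit; dropping the
     first k0 terms makes |y_ k| < 1 hold throughout. *)
  apply/(@cvg_nbhsP _ R^o) => y_ cy; rewrite -S0.
  have yy : \forall k \near \oo, `|y_ k| < 1 by have /cvgr0_norm_lt := cy; apply.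
  case: yy => k0 _ yk0.
  rewrite -(cvg_shiftn k0) /=.
  apply: (@I_dominated R (fun k x => box (N - 1) x * `|h (x - y_ (k + k0)%N) - h x|) (fun _ => 0) (fun x => (K + K) * box N x)).
  - move=> k; apply: L1_meas; apply: LS; apply: ltW; apply: yk0 => /=; exact: leq_addl.
  - exact: measurable_cst.
  - apply: ae_all => x; rewrite -(mulr0 (box (N - 1) x)); apply: cvgM; first exact: cvg_cst.
    rewrite -(@normr0 _ R) -[in X in _ --> X](subrr (h x)).
    apply: cvg_norm; apply: cvgB; last exact: cvg_cst.
    apply: continuous_cvg; first exact: ch.
    rewrite -[X in _ --> X]subr0; apply: cvgB; first exact: cvg_cst.
    by rewrite (cvg_shiftn k0 y_).
  - by apply: L1Zl; exact: L1_box.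
  - move=> k x; rewrite !boxE; case: (leP `|x| (N - 1)) => xN; last by rewrite mul0r normr0; case: (leP `|x| N) => _; rewrite ?mulr1 ?mulr0// addr_ge0.
    have yk1 : `|y_ (k + k0)%N| < 1 by apply: yk0 => /=; exact: leq_addl.
    rewrite (_ : `|x| <= N); last by lra.
    rewrite mul1r mulr1 normr_id (le_trans (ler_normB _ _))// lerD// hK//; last by lra.
    by have := ler_normB x (y_ (k + k0)%N); lra.
have : \forall y \near (0 : R), `|S y| <= e / 3.
  have /cvgrPdist_le/(_ (e / 3)) := cS; rewrite divr_gt0// => /(_ isT).
  by apply: filterS => y; rewrite sub0r normrN.
have : \forall y \near (0 : R), `|y| <= 1.
  exact: nbhs0_le.
apply: filterS2 => y y1 Sy; rewrite sub0r normrN ger0_norm; last by apply: I_ge0.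
have Lgy : L1 (fun x => box N (x - y) * `|g (x - y) - h (x - y)|).
  by have := L1_shift (- y) LgB.
have -> : e = e / 3 + e / 3 + e / 3 by lra.
apply: (@le_trans _ _ (I (fun x => box N (x - y) * `|g (x - y) - h (x - y)| +
   box (N - 1) x * `|h (x - y) - h x| + box N x * `|g x - h x|))).
  apply: I_le.
  - apply: L1_norm; apply: L1B => //; exact: (L1_shift (- y) Lg).
  - by apply: L1D => //; apply: L1D => //; exact: LS.
  move=> x; have NE : N = M + 2 by [].
  have a1 : 0 <= box N (x - y) * `|g (x - y) - h (x - y)| by rewrite mulr_ge0// box_ge0.
  have a2 : 0 <= box (N - 1) x * `|h (x - y) - h x| by rewrite mulr_ge0// box_ge0.
  have a3 : 0 <= box N x * `|g x - h x| by rewrite mulr_ge0// box_ge0.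
  case: (leP `|x| (N - 1)) => xN; last first.
    have z1 : g x = 0 by apply: g0; lra.
    have z2 : g (x - y) = 0 by apply: g0; have := lerB_dist x y; lra.
    by rewrite [X in X - _]z2 [X in _ - X]z1 subrr normr0; lra.
  rewrite (boxE N x) (boxE (N - 1)) (boxE N (x - y)) xN.
  rewrite (_ : `|x| <= N); last by lra.
  rewrite (_ : `|x - y| <= N); last by have := ler_normB x y; lra.
  rewrite !mul1r; have := ler_distD (h (x - y)) (g (x - y)) (g x).
  have := ler_distD (h x) (h (x - y)) (g x); rewrite (distrC (h x)); lra.
rewrite !ID//; [|exact: LS|by apply: L1D => //; exact: LS].
rewrite !lerD//.
  by rewrite (I_shift (- y) LgB).
by apply: le_trans Sy; exact: ler_norm.
Qed.

(** By Cauchy-Schwarz it is enough that translations are continuous in L^2. For a truncation g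
    bounded by M, |g(x) - g(x - y)|^2 <= 2 M |g(x) - g(x - y)|, which reduces this to the L^1
    case. *)
Lemma autocorrelation_cvg f : L2 f ->
  (fun y => I (fun x => f x * f (x - y))) @ (0 : R) --> I (fun x => f x ^+ 2).
Proof.
move=> Lf; apply/cvgrPdist_le => /= e e0.
pose F := nrm f + 1; have F0 : 0 < F by rewrite /F ltr_wpDl// nrm_ge0.
pose d := e / (4 * F); have d0 : 0 < d by rewrite divr_gt0// mulr_gt0.
have [g [M [Lg M0 gM g0 fg]]] := L2_truncation Lf d0.
have Lg1 := L1_bounded_support (L2_meas Lg) gM g0.
have cg := L1_translation (L2_meas Lg) M0 gM g0.
have Lsh (k : R -> R) y : L2 k -> L2 (fun x => k (x - y)).
  move=> [mk Lk]; split; last exact: (L1_shift (- y) Lk).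
  by apply: (measurableT_comp mk); exact: measurable_funB.
(* Chosen so that [(2 * M + 1) * eta] is the square of [e / (2 * F)]; with d = e / (4 F) the three
   errors then add up to e / F. *)
pose eta := (e / (2 * F)) ^+ 2 / (2 * M + 1).
have eta0 : 0 < eta by rewrite divr_gt0 ?exprn_gt0 ?divr_gt0 ?mulr_gt0//; lra.
have : \forall y \near (0 : R), I (fun x => `|g (x - y) - g x|) <= eta.
  have /cvgrPdist_le/(_ eta eta0) := cg.
  by apply: filterS => y; rewrite sub0r normrN ger0_norm//; apply: I_ge0.
apply: filterS => y gy.
have Lfy := Lsh _ y Lf; have Lgy := Lsh _ y Lg.
have -> : I (fun x => f x ^+ 2) - I (fun x => f x * f (x - y)) = I (fun x => f x * (f x - f (x - y))).
  by rewrite -IB; [congr Rintegral; apply/funext => x; ring|exact: L1_sqr|exact: L1M].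
apply: le_trans (cauchy_schwarz Lf (L2B Lf Lfy)) _.
have n1 : nrm (fun x => g x - g (x - y)) <= e / (2 * F).
  rewrite -ler_sqr ?nnegrE ?nrm_ge0//; last by rewrite divr_ge0 ?mulr_ge0// ltW.
  have Lgg := L2B Lg Lgy.
  rewrite sqr_nrm; apply: (@le_trans _ _ (I (fun x => (2 * M) * `|g (x - y) - g x|))).
    apply: I_le; [exact: L1_sqr| |].
      apply: L1Zl; apply: L1_norm.
      by apply: L1B => //; exact: (L1_shift (- y) Lg1).
    move=> x; rewrite -real_normK ?num_real// expr2 (distrC (g x)) ler_wpM2r//.
    by apply: le_trans (ler_normB _ _) _; have := gM x; have := gM (x - y); lra.
  rewrite IZl; last first.
    by apply: L1_norm; apply: L1B => //; exact: (L1_shift (- y) Lg1).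
  apply: (@le_trans _ _ ((2 * M + 1) * eta)).
    apply: ler_pM => //; [by rewrite mulr_ge0|by apply: I_ge0|lra].
  rewrite /eta mulrC divfK//; lra.
have n2 : nrm (fun x => f x - f (x - y)) <= d + e / (2 * F) + d.
  have := nrm_triangle Lf Lg Lfy; move/le_trans; apply.
  rewrite -addrA lerD//.
  have := nrm_triangle Lg Lgy Lfy; move/le_trans; apply.
  rewrite lerD// nrmB.
  have Lfg := L2B Lf Lg.
  suff -> : nrm (fun x => f (x - y) - g (x - y)) = nrm (fun x => f x - g x) by [].
  by rewrite /nrm (I_shift (- y) (L1_sqr Lfg)).
have -> : e = F * (d + e / (2 * F) + d) by rewrite /d; field; rewrite gt_eqF.
by apply: ler_pM => //; rewrite ?nrm_ge0// /F lerDl.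
Qed.

End translation.

(** * The Hartley transform and Plancherel's identity *)

Section hartley.
Context {R : realType}.
Notation mu := (@lebesgue_measure R).
Implicit Types f g : R -> R.

(* The Hartley transform encodes the Fourier transform A - iB of a real function
   by the single real function A + B; its square is multiplication by 2 pi. *)
Definition cas (t : R) : R := cos t + sin t.
Definition ht f (x : R) : R := I (fun y => f y * cas (x * y)).

Lemma is_derive_cvg (F : R -> R) (x l : R) : is_derive x 1 F l -> {for x, continuous F}.
Proof.
move=> dF; apply: differentiable_continuous; apply/derivable1_diffP.
exact: (@ex_derive _ _ _ _ _ _ _ dF).
Qed.

Lemma norm_sin_le1 (t : R) : `|sin t| <= 1.
Proof. by rewrite ler_norml sin_geN1 sin_le1. Qed.

Lemma norm_cos_le1 (t : R) : `|cos t| <= 1.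
Proof. by rewrite ler_norml cos_geN1 cos_le1. Qed.

Lemma cas_le2 t : `|cas t| <= 2.
Proof.
apply: le_trans (ler_normD _ _) _.
by have := norm_sin_le1 t; have := norm_cos_le1 t; lra.
Qed.

Lemma continuous_cas : continuous cas.
Proof. by move=> x; apply: continuousD; [exact: continuous_cos|exact: continuous_sin]. Qed.

Lemma measurable_cas : measurable_fun setT cas.
Proof. exact: continuous_measurable_fun continuous_cas. Qed.

Lemma measurable_cas2 : measurable_fun setT (fun p : R * R => cas (p.1 * p.2)).
Proof.
by apply: measurableT_comp; [exact: measurable_cas|exact: measurable_funM].
Qed.

Lemma measurable_casr (x : R) : measurable_fun setT (fun y => cas (x * y)).
Proof. by apply: measurableT_comp; [exact: measurable_cas|exact: measurable_funM]. Qed.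

Lemma L1M_bounded (C : R) f g : L1 f -> measurable_fun setT g -> (forall x, `|g x| <= C) ->
  L1 (fun x => f x * g x).
Proof.
move=> Lf mg gC; apply: (@L1_le _ (fun x => `|f x| * C)).
- by apply: measurable_funM => //; exact: L1_meas.
- by move=> x; rewrite normrM ler_wpM2l.
- by apply: L1Zr; exact: L1_norm.
Qed.

Lemma L1_cas f x : L1 f -> L1 (fun y => f y * cas (x * y)).
Proof. by move=> Lf; apply: (@L1M_bounded 2) => //; [exact: measurable_casr|move=> y; exact: cas_le2]. Qed.

Lemma measurable_ht f : measurable_fun setT f -> measurable_fun setT (ht f).
Proof.
move=> mf; apply: (@measurable_I R (fun x y => f y * cas (x * y))).
by apply: measurable_funM; [exact: (measurableT_comp mf measurable_snd)|exact: measurable_cas2].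
Qed.

Lemma ht_le f x : L1 f -> `|ht f x| <= 2 * I (fun x => `|f x|).
Proof.
move=> Lf; apply: le_trans (I_norm (L1_cas x Lf)) _.
rewrite mulrC -IZr; last exact: L1_norm.
apply: I_le; [exact: L1_norm (L1_cas x Lf)|by apply: L1Zr; exact: L1_norm|].
by move=> y; rewrite normrM ler_wpM2l// cas_le2.
Qed.

Lemma htD f g x : L1 f -> L1 g -> ht (fun y => f y + g y) x = ht f x + ht g x.
Proof.
move=> Lf Lg; rewrite /ht -ID; [|exact: L1_cas..].
by congr Rintegral; apply/funext => y; rewrite mulrDl.
Qed.

Lemma htZ k f x : L1 f -> ht (fun y => k * f y) x = k * ht f x.
Proof.
move=> Lf; rewrite /ht -IZl; last exact: L1_cas.
by congr Rintegral; apply/funext => y; rewrite mulrA.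
Qed.

Lemma htB f g x : L1 f -> L1 g -> ht (fun y => f y - g y) x = ht f x - ht g x.
Proof.
move=> Lf Lg; rewrite /ht -IB; [|exact: L1_cas..].
by congr Rintegral; apply/funext => y; rewrite mulrBl.
Qed.

Lemma L1_mul_ht f g : L1 f -> L1 g -> L1 (fun x => f x * ht g x).
Proof.
move=> Lf Lg; apply: (L1M_bounded Lf (C := 2 * I (fun x => `|g x|))).
  exact: measurable_ht (L1_meas Lg).
by move=> x; exact: ht_le.
Qed.

Lemma ht_selfadjoint f g : L1 f -> L1 g ->
  I (fun x => ht f x * g x) = I (fun x => f x * ht g x).
Proof.
move=> Lf Lg.
have [mf mg] := (L1_meas Lf, L1_meas Lg).
pose F (x y : R) := g x * f y * cas (x * y).
have LF : L1xy F.
  apply: (@L1xy_le R (fun x y => (2 * `|g x|) * `|f y|)).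
  - apply: measurable_funM; last exact: measurable_cas2.
    apply: measurable_funM; first exact: (measurableT_comp mg measurable_fst).
    exact: (measurableT_comp mf measurable_snd).
  - move=> x y; rewrite /F !normrM; have c := cas_le2 (x * y).
    have p : 0 <= `|g x| * `|f y| by rewrite mulr_ge0.
    by rewrite -mulrA [leRHS]mulrC; nra.
  - by apply: L1xy_prod; [apply: L1Zl|]; exact: L1_norm.
transitivity (I (fun x => I (F x))).
  congr Rintegral; apply/funext => x; rewrite mulrC /ht -IZl; last exact: L1_cas.
  by congr Rintegral; apply/funext => y; rewrite /F mulrA.
have L1F x : L1 (F x).
  by rewrite /F; under eq_fun do rewrite -mulrA; apply: L1Zl; exact: L1_cas.
have L2F y : L1 (F ^~ y).
  rewrite /F; have := L1Zl (f y) (L1_cas y Lg).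
  by under eq_fun do rewrite mulrA (mulrC y) (mulrC (f y)).
rewrite (I_swap LF L1F L2F).
congr Rintegral; apply/funext => y; rewrite /ht -IZl; last exact: L1_cas.
by congr Rintegral; apply/funext => x; rewrite /F mulrA (mulrC y) (mulrC (f y)).
Qed.

Lemma L1_even_half f (l : R) : continuous f -> (forall x, 0 <= f x) -> (forall x, f (- x) = f x) ->
  (\int[mu]_(x in `[0%R, +oo[) (f x)%:E = l%:E)%E -> L1 f /\ I f = 2 * l.
Proof.
move=> cf f0 fe fl.
have h : (\int[mu]_x (f x)%:E = (2 * l)%:E)%E.
  rewrite ge0_symfun_integralT//; last by move=> x /=; rewrite fe.
  by rewrite -set_itvcy fl EFinM.
have Lf : L1 f.
  apply: L1_lty; first exact: continuous_measurable_fun.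
  by under eq_integral do rewrite ger0_norm//; rewrite h ltry.
by split => //; apply: EFin_inj; rewrite EFin_I.
Qed.

(** The regularizing factor of Abel summation: it makes the inverse transform of a bounded function
    converge, and tends to 1 as e tends to 0. *)
Definition poisson (e x : R) : R := expR (- (e * `|x|)).

Lemma continuous_poisson e : continuous (poisson e).
Proof.
move=> x; apply: continuous_comp; last exact: continuous_expR.
apply: continuousN; apply: continuousM; first exact: cst_continuous.
exact: norm_continuous.
Qed.

(** [1 + cos] in place of [cos] keeps the integrand nonnegative, as the fundamental theorem of
    calculus on a half-line asks. The constant part is subtracted afterwards, from the case a =
    0. *)
Lemma poisson_cos_half (e a : R) : 0 < e ->
  (\int[mu]_(x in `[0%R, +oo[) (poisson e x * (1 + cos (a * x)))%:E =
   (e^-1 + e / (e ^+ 2 + a ^+ 2))%:E)%E.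
Proof.
move=> e0.
have q0 : 0 < e ^+ 2 + a ^+ 2 by rewrite ltr_pwDl ?exprn_gt0 ?sqr_ge0.
(* The antiderivative that tends to 0 at infinity, so that the integral is [- F 0]. *)
pose F (x : R) := expR (- (e * x)) * (- e^-1 + (a * sin (a * x) - e * cos (a * x)) / (e ^+ 2 + a ^+ 2)).
pose f (x : R) := expR (- (e * x)) * (1 + cos (a * x)).
have dF (x : R) : is_derive x 1 F (f x).
  rewrite /F; apply: is_derive_eq.
  rewrite /GRing.scale /=; rewrite /f; field.
  by rewrite !gt_eqF.
transitivity (\int[mu]_(x in `[0%R, +oo[) (f x)%:E)%E.
  apply: eq_integral => x; rewrite inE/= in_itv/= andbT => x0.
  by rewrite /poisson /f ger0_norm.
rewrite (@ge0_continuous_FTC2y R f F 0 0).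
- rewrite /F mulr0 oppr0 expR0 mul1r mulr0 sin0 cos0 mulr0 sub0r mulr1 -EFinB.
  by congr EFin; rewrite sub0r opprD opprK mulNr opprK.
- move=> x _; rewrite mulr_ge0 ?expR_ge0//; have := cos_geN1 (a * x); lra.
- apply: continuous_subspaceT => x.
  apply: differentiable_continuous; apply/derivable1_diffP; exact: ex_derive.
- have c0 : expR (- (e * x)) @[x --> +oo] --> (0:R).
    exact: (cvg_comp _ _ (gt0_cvgMry e0 cvg_id) (@cvgr_expR R)).
  pose C := e^-1 + (`|a| + e) / (e ^+ 2 + a ^+ 2).
  apply: (@squeeze_cvgr _ _ _ _ (fun x => - C * expR (- (e * x))) (fun x => C * expR (- (e * x)))).
  + apply: nearW => x; rewrite mulNr -ler_norml /F normrM ger0_norm ?expR_ge0// mulrC.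
    rewrite ler_wpM2r ?expR_ge0//.
    apply: le_trans (ler_normD _ _) _; apply: lerD; first by rewrite normrN ger0_norm// invr_ge0 ltW.
    rewrite normrM normfV (gtr0_norm q0) ler_pM2r ?invr_gt0//.
    apply: le_trans (ler_normB _ _) _; rewrite !normrM (gtr0_norm e0).
    apply: lerD; first by rewrite ler_piMr// norm_sin_le1.
    by rewrite ler_piMr ?norm_cos_le1// ltW.
  + rewrite -(mulr0 (- C)); apply: cvgM => //; exact: cvg_cst.
  + rewrite -(mulr0 C); apply: cvgM => //; exact: cvg_cst.
- by move=> x _; exact: (@ex_derive _ _ _ _ _ _ _ (dF x)).
- exact: cvg_at_right_filter (is_derive_cvg (dF 0)).
- by move=> x _; rewrite derive1E; exact: (@derive_val _ _ _ _ _ _ _ (dF x)).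
Qed.

Lemma poisson_ge0 e x : 0 <= poisson e x. Proof. exact: expR_ge0. Qed.

Lemma poissonN e x : poisson e (- x) = poisson e x.
Proof. by rewrite /poisson normrN. Qed.

Lemma poisson_le1 e x : 0 <= e -> poisson e x <= 1.
Proof. by move=> e0; rewrite /poisson -expR0 ler_expR oppr_le0 mulr_ge0. Qed.

Lemma I_poisson_1cos (e a : R) : 0 < e -> L1 (fun x => poisson e x * (1 + cos (a * x))) /\
  I (fun x => poisson e x * (1 + cos (a * x))) = 2 * (e^-1 + e / (e ^+ 2 + a ^+ 2)).
Proof.
move=> e0; apply: L1_even_half; last exact: poisson_cos_half.
- move=> x; apply: cvgM; first exact: continuous_poisson.
  apply: cvgD; first exact: cvg_cst.
  apply: continuous_comp; last exact: continuous_cos.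
  by apply: cvgM => //; exact: cvg_cst.
- by move=> x; rewrite mulr_ge0 ?poisson_ge0//; have := cos_geN1 (a * x); lra.
- by move=> x; rewrite poissonN mulrN cosN.
Qed.

Lemma L1_poisson (e : R) : 0 < e -> L1 (poisson e).
Proof.
move=> e0; have [L _] := I_poisson_1cos 0 e0.
have := L1Zl 2^-1 L; congr L1; apply/funext => x.
by rewrite mul0r cos0; field.
Qed.

Lemma I_poisson (e : R) : 0 < e -> I (poisson e) = 2 / e.
Proof.
move=> e0; have [L IL] := I_poisson_1cos 0 e0.
have -> : 2 / e = 2^-1 * (2 * (e^-1 + e / (e ^+ 2 + 0 ^+ 2))) by field; rewrite gt_eqF.
rewrite -IL -IZl//; congr Rintegral; apply/funext => x.
by rewrite mul0r cos0; field.
Qed.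

Lemma measurable_trigM (h : R -> R) (a : R) : continuous h -> measurable_fun setT (fun x => h (a * x)).
Proof.
move=> ch; apply: (measurableT_comp (f := h)); first exact: continuous_measurable_fun.
exact: measurable_funM.
Qed.

Lemma L1_poisson_cos (e a : R) : 0 < e -> L1 (fun x => poisson e x * cos (a * x)).
Proof.
move=> e0; apply: (L1M_bounded (L1_poisson e0) (C := 1)).
  by apply: measurable_trigM; exact: continuous_cos.
by move=> x; exact: norm_cos_le1.
Qed.

Lemma L1_poisson_sin (e a : R) : 0 < e -> L1 (fun x => poisson e x * sin (a * x)).
Proof.
move=> e0; apply: (L1M_bounded (L1_poisson e0) (C := 1)).
  by apply: measurable_trigM; exact: continuous_sin.
by move=> x; exact: norm_sin_le1.
Qed.

Lemma I_poisson_cos (e a : R) : 0 < e ->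
  I (fun x => poisson e x * cos (a * x)) = 2 * e / (e ^+ 2 + a ^+ 2).
Proof.
move=> e0; have [L IL] := I_poisson_1cos a e0.
transitivity (I (fun x => poisson e x * (1 + cos (a * x)) - poisson e x)).
  by congr Rintegral; apply/funext => x; ring.
rewrite IB//; last exact: L1_poisson.
rewrite IL I_poisson//; ring.
Qed.

Lemma I_poisson_sin (e a : R) : 0 < e -> I (fun x => poisson e x * sin (a * x)) = 0.
Proof.
move=> e0; have L := L1_poisson_sin a e0.
have := I_opp L.
under eq_Rintegral do rewrite poissonN mulrN sinN mulrN.
rewrite IN// => h; lra.
Qed.

(** The Fourier transform of [poisson e], that is, 2 pi times the Cauchy density of scale e: an
    approximate identity as e tends to 0. *)
Definition pk (e y : R) : R := 2 * e / (e ^+ 2 + y ^+ 2).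

Lemma cas_cas (x y z : R) : cas (x * y) * cas (z * y) = cos ((x - z) * y) + sin ((x + z) * y).
Proof.
have -> : (x - z) * y = x * y - z * y by ring.
have -> : (x + z) * y = x * y + z * y by ring.
by rewrite /cas cosB sinD; ring.
Qed.

(** A product of two [cas] is a cosine of the difference plus a sine of the sum. The sine integrates
    to 0 against an even weight, so that a convolution kernel remains. *)
Lemma ht_poisson (e x z : R) : 0 < e ->
  ht (fun y => poisson e y * cas (x * y)) z = pk e (x - z).
Proof.
move=> e0; rewrite /ht.
transitivity (I (fun y => poisson e y * cos ((x - z) * y) + poisson e y * sin ((x + z) * y))).
  by congr Rintegral; apply/funext => y; rewrite -mulrA cas_cas mulrDr.
rewrite ID; [|exact: L1_poisson_cos|exact: L1_poisson_sin].
by rewrite I_poisson_cos// I_poisson_sin// addr0.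
Qed.

Lemma pk_den (e y : R) : 0 < e -> 0 < e ^+ 2 + y ^+ 2.
Proof. by move=> e0; rewrite ltr_pwDl ?exprn_gt0 ?sqr_ge0. Qed.

Lemma pk_ge0 (e y : R) : 0 < e -> 0 <= pk e y.
Proof. by move=> e0; rewrite divr_ge0 ?mulr_ge0 ?ltW ?pk_den. Qed.

Lemma pkN e y : pk e (- y) = pk e y. Proof. by rewrite /pk sqrrN. Qed.

Lemma pk_le (e y : R) : 0 < e -> pk e y <= 2 / e.
Proof.
move=> e0; rewrite /pk ler_pdivrMr ?pk_den//.
rewrite (_ : 2 / e * _ = 2 * e + 2 * y ^+ 2 / e); last by field; rewrite gt_eqF.
rewrite lerDl; apply: divr_ge0; last exact: ltW.
by apply: mulr_ge0 => //; exact: sqr_ge0.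
Qed.

Lemma continuous_pk (e : R) : 0 < e -> continuous (pk e).
Proof.
move=> e0 x; apply: cvgM; first exact: cvg_cst.
apply: cvgV; first by rewrite gt_eqF// pk_den.
by apply: cvgD; [exact: cvg_cst|exact: exprn_continuous].
Qed.

Lemma I_pk (e : R) : 0 < e -> L1 (pk e) /\ I (pk e) = 2 * pi.
Proof.
move=> e0; apply: L1_even_half.
- exact: continuous_pk.
- by move=> x; exact: pk_ge0.
- exact: pkN.
have dF (x : R) : is_derive x 1 (fun x => 2 * atan (e^-1 * x)) (pk e x).
  have datan (y : R) : is_derive y 1 (@atan R) ((1 + y ^+ 2)^-1) by exact: is_derive1_atan.
  apply: is_derive_eq; rewrite /GRing.scale /= /pk; field.
  by rewrite !gt_eqF//= ?pk_den// ltr_pwDl// sqr_ge0.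
rewrite (@ge0_continuous_FTC2y R (pk e) (fun x => 2 * atan (e^-1 * x)) 0 pi).
- by rewrite mulr0 atan0 mulr0 -EFinB subr0.
- by move=> x _; exact: pk_ge0.
- by apply: continuous_subspaceT; exact: continuous_pk.
- rewrite (_ : pi = 2 * (pi / 2)); last by field.
  apply: cvgM; first exact: cvg_cst.
  apply: (cvg_comp _ _ _ (@cvgy_atan R)).
  by apply: gt0_cvgMry => //; rewrite invr_gt0.
- by move=> x _; exact: (@ex_derive _ _ _ _ _ _ _ (dF x)).
- exact: cvg_at_right_filter (is_derive_cvg (dF 0)).
- by move=> x _; rewrite derive1E; exact: (@derive_val _ _ _ _ _ _ _ (dF x)).
Qed.

Definition autocorr f (y : R) : R := I (fun x => f x * f (x - y)).

Lemma L2_shift (c : R) f : L2 f -> L2 (fun x => f (x - c)).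
Proof.
move=> [mf Lf]; split; last exact: (L1_shift (- c) Lf).
by apply: (measurableT_comp mf); exact: measurable_funB.
Qed.

Lemma nrm_shift (c : R) f : L2 f -> nrm (fun x => f (x - c)) = nrm f.
Proof. by move=> [mf Lf]; rewrite /nrm (I_shift (- c) Lf). Qed.

Lemma autocorr_le f y : L2 f -> `|autocorr f y| <= nrm f ^+ 2.
Proof.
move=> Lf; apply: le_trans (cauchy_schwarz Lf (L2_shift y Lf)) _.
by rewrite nrm_shift// expr2.
Qed.

Lemma measurable_autocorr f : measurable_fun setT f -> measurable_fun setT (autocorr f).
Proof.
move=> mf; apply: (@measurable_I R (fun y x => f x * f (x - y))).
apply: measurable_funM; first exact: (measurableT_comp mf measurable_snd).
by apply: (measurableT_comp mf); exact: measurable_funB.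
Qed.

Lemma L1_pk_autocorr f (e : R) : L2 f -> 0 < e -> L1 (fun y => pk e y * autocorr f y).
Proof.
move=> Lf e0; apply: (L1M_bounded (I_pk e0).1 (C := nrm f ^+ 2)).
  by apply: measurable_autocorr; exact: L2_meas.
by move=> y; exact: autocorr_le.
Qed.

Lemma measurable_poisson e : measurable_fun setT (poisson e).
Proof. exact: continuous_measurable_fun (@continuous_poisson e). Qed.

(** Self-adjointness moves one transform onto the regularized other one, where it turns the Poisson
    factor into convolution of f with [pk e]. The substitution z = x - y and Fubini's theorem then
    bring out the autocorrelation. *)
Lemma poisson_pairing f (e : R) : L1 f -> L2 f -> 0 < e ->
  L1 (fun y => poisson e y * ht f y ^+ 2) /\
  I (fun y => poisson e y * ht f y ^+ 2) = I (fun y => pk e y * autocorr f y).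
Proof.
move=> Lf L2f e0.
have mf := L1_meas Lf.
have Lg : L1 (fun y => poisson e y * ht f y) by apply: L1_mul_ht => //; exact: L1_poisson.
have Lp x : L1 (fun y => poisson e y * cas (x * y)) by apply: L1_cas; exact: L1_poisson.
split.
  under eq_fun do rewrite expr2 mulrA.
  exact: L1_mul_ht.
have htg x : ht (fun y => poisson e y * ht f y) x = I (fun z => f z * pk e (x - z)).
  have -> : ht (fun y => poisson e y * ht f y) x = I (fun y => poisson e y * ht f y * cas (x * y)) by [].
  transitivity (I (fun y => ht f y * (poisson e y * cas (x * y)))).
    by congr Rintegral; apply/funext => y; ring.
  rewrite ht_selfadjoint//; congr Rintegral; apply/funext => z.
  by rewrite ht_poisson.
transitivity (I (fun y => ht f y * (poisson e y * ht f y))).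
  by congr Rintegral; apply/funext => y; ring.
rewrite ht_selfadjoint//.
have Lk x : L1 (fun z => f z * pk e (x - z)).
  apply: (L1M_bounded Lf (C := 2 / e)).
    by apply: measurable_reflect; exact: L1_meas (I_pk e0).1.
  by move=> z; rewrite ger0_norm ?pk_ge0// pk_le.
transitivity (I (fun x => I (fun y => f x * f (x - y) * pk e y))).
  congr Rintegral; apply/funext => x; rewrite htg -IZl//.
  have := I_reflect x (L1Zl (f x) (Lk x)) => <-.
  by congr Rintegral; apply/funext => y; rewrite subKr mulrA.
pose F (x y : R) := f x * f (x - y) * pk e y.
have mpk : measurable_fun setT (pk e) by exact: L1_meas (I_pk e0).1.
have LF : L1xy F.
  apply: (@L1xy_le R (fun x y => (2 / e * `|f x|) * `|f (x - y)|)).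
  - apply: measurable_funM; last exact: (measurableT_comp mpk measurable_snd).
    apply: measurable_funM; first exact: (measurableT_comp mf measurable_fst).
    by apply: (measurableT_comp mf); exact: measurable_funB.
  - move=> x y; rewrite /F (normrM _ (pk e y)) (normrM (f x)).
    rewrite -[leRHS]mulrA [leRHS]mulrC ler_wpM2l ?mulr_ge0//.
    by rewrite ger0_norm ?pk_ge0// pk_le.
  - apply: (@L1xy_shear R (fun x y => 2 / e * `|f x| * `|f y|)).
    by apply: L1xy_prod; [apply: L1Zl; exact: L1_norm|exact: L1_norm].
rewrite (I_swap LF).
- congr Rintegral; apply/funext => y; rewrite /F /autocorr -IZl.
    by congr Rintegral; apply/funext => x; rewrite mulrC.
  exact: L1M (L2_shift y L2f).
- move=> x; have := L1_reflect x (L1Zl (f x) (Lk x)).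
  by rewrite /F; congr L1; apply/funext => y; rewrite subKr mulrA.
- by move=> y; apply: L1Zr; exact: L1M (L2_shift y L2f).
Qed.

(** [pk e] is an approximate identity of mass 2 pi, and the autocorrelation is bounded and
    continuous at 0 with value [nrm f ^+ 2] there. *)
Lemma poisson_approximation f : L2 f ->
  (fun n => I (fun y => pk n.+1%:R^-1 y * autocorr f y)) @ \oo --> 2 * pi * nrm f ^+ 2.
Proof.
move=> Lf.
have cf := autocorrelation_cvg Lf; rewrite -sqr_nrm in cf.
have en0 n : 0 < (n.+1%:R^-1 : R) by rewrite invr_gt0.
apply/cvgrPdist_le => /= e e0.
have p0 : 0 < (pi : R) := pi_gt0 R.
have e1 : 0 < e / (4 * pi) by rewrite divr_gt0 ?mulr_gt0.
have /cvgrPdist_le/(_ _ e1) := cf => /nbhs_ballP[d /= d0 hd].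
pose h n (y : R) := pk n.+1%:R^-1 y * (`|y| >= d)%R%:R.
pose q : set (measurableTypeR R) := `]-oo, d[%classic.
have mind : measurable_fun setT (fun y : R => (`|y| >= d)%R%:R : R).
  rewrite (_ : (fun _ => _) = (fun y => 1 - \1_q `|y|)).
    apply: measurable_funB => //.
    apply: (@measurableT_comp _ _ _ _ _ _ (\1_q : R -> R)) => //.
    by apply: measurable_indic; exact: measurable_itv.
  apply/funext => y; rewrite indicE mem_setE in_itv/= ltNge.
  by case: (leP d `|y|) => _; rewrite /= ?subr0 ?subrr.
have mh n : measurable_fun setT (h n).
  by apply: measurable_funM => //; exact: L1_meas (I_pk _).1.
have hpk n y : 0 <= h n y <= pk n.+1%:R^-1 y.
  rewrite /h; have := pk_ge0 y (en0 n); case: (leP d `|y|) => _ k0; rewrite ?mulr1 ?mulr0; lra.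
have Lh n : L1 (h n).
  apply: (@L1_le _ (pk n.+1%:R^-1)) (I_pk (en0 n)).1 => // y.
  by have /andP[a b] := hpk n y; rewrite ger0_norm.
have ch : (fun n => I (h n)) @ \oo --> (0 : R).
  have S0 : I (fun _ : R => 0 : R) = 0 by rewrite /Rintegral integral0.
  rewrite -S0.
  (* The tails of all the kernels lie below a multiple of [pk 1]: for |y| >= d they are at most 2 /
     y^2, and 1 / y^2 <= (1 + d^-2) / (1 + y^2). *)
  apply: (@I_dominated R h (fun _ => 0) (fun y => (1 + d ^- 2) * pk 1 y)) => //.
  - apply: ae_all => y; rewrite /h; case: (leP d `|y|) => dy; last first.
      by under eq_fun do rewrite mulr0; exact: cvg_cst.
    under eq_fun do rewrite mulr1.
    have y0 : 0 < y ^+ 2.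
      by rewrite -real_normK ?num_real// exprn_gt0//; exact: lt_le_trans dy.
    have cn : (fun n => n.+1%:R^-1 : R) @ \oo --> (0 : R) by exact: cvg_harmonic.
    rewrite (_ : 0 = 2 * 0 / (0 ^+ 2 + y ^+ 2)); last by rewrite mulr0 mul0r.
    apply: cvgM; first by apply: cvgM => //; exact: cvg_cst.
    apply: cvgV; first by rewrite expr0n add0r gt_eqF.
    by apply: cvgD; [apply: cvgM|exact: cvg_cst].
  - by apply: L1Zl; exact: (I_pk _).1.
  - move=> n y; rewrite ger0_norm; last by have /andP[] := hpk n y.
    have d2 : 0 < d ^- 2 by rewrite invr_gt0 exprn_gt0.
    have k1 := pk_ge0 y (@ltr01 R).
    rewrite /h; case: (leP d `|y|) => dy; last by rewrite mulr0 mulr_ge0//; lra.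
    rewrite mulr1 /pk expr1n.
    have y2 : d ^+ 2 <= y ^+ 2.
      by rewrite -[y ^+ 2]real_normK ?num_real// ler_sqr ?nnegrE// ltW.
    have y0 : 0 < y ^+ 2 by apply: lt_le_trans y2; rewrite exprn_gt0.
    have t1 : (n.+1%:R^-1 : R) <= 1 by rewrite invf_le1// ler1n.
    apply: (@le_trans _ _ (2 / y ^+ 2)).
      apply: ler_pM.
      - by apply: mulr_ge0 => //; exact: ltW.
      - by rewrite invr_ge0; apply: ltW; exact: pk_den.
      - by rewrite -[leRHS]mulr1 ler_wpM2l.
      - by rewrite lef_pV2 ?posrE ?pk_den// lerDr sqr_ge0.
    rewrite mulr1 mulrCA; apply: ler_wpM2l => //.
    rewrite -[X in _ <= X]/(_ / _) ler_pdivlMr; last by rewrite ltr_pwDl// ltW.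
    rewrite mulrDr mulr1 mulVf ?gt_eqF// addrC lerD2l.
    by rewrite lef_pV2 ?posrE// exprn_gt0.
have e2 : 0 < e / (4 * (nrm f ^+ 2 + 1)).
  by rewrite divr_gt0// mulr_gt0// ltr_wpDl// sqr_ge0.
have /cvgrPdist_le/(_ _ e2) := ch; apply: filterS => n hn.
have Lpa := L1_pk_autocorr Lf (en0 n).
have Lp := (I_pk (en0 n)).1.
rewrite -(I_pk (en0 n)).2 -IZr// -IB//; last exact: L1Zr.
apply: le_trans (I_norm _) _; first by apply: L1B => //; exact: L1Zr.
apply: (@le_trans _ _ (I (fun y => pk n.+1%:R^-1 y * (e / (4 * pi)) + h n y * (2 * nrm f ^+ 2)))).
  apply: I_le.
  - by apply: L1_norm; apply: L1B => //; exact: L1Zr.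
  - by apply: L1D; exact: L1Zr.
  move=> y; rewrite -mulrBr normrM (ger0_norm (pk_ge0 _ (en0 n))).
  rewrite /h; case: (leP d `|y|) => dy.
    rewrite mulr1 -mulrDr ler_wpM2l ?pk_ge0//.
    apply: le_trans (ler_normB _ _) _.
    have := autocorr_le y Lf; rewrite (ger0_norm (sqr_ge0 (nrm f))); lra.
  rewrite mulr0 mul0r addr0 ler_wpM2l ?pk_ge0//.
  by apply: hd => /=; rewrite /ball/= sub0r normrN.
rewrite ID; [|exact: L1Zr..].
rewrite !IZr// (I_pk (en0 n)).2.
move: hn; rewrite sub0r normrN ger0_norm; last first.
  by apply: I_ge0 => y; have /andP[] := hpk n y.
move=> hn.
have N1 : 0 < nrm f ^+ 2 + 1 by rewrite ltr_wpDl// sqr_ge0.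
have E : 2 * pi * (e / (4 * pi)) + e / (4 * (nrm f ^+ 2 + 1)) * (2 * (nrm f ^+ 2 + 1)) = e.
  have aux (p K : R) : 0 < p -> 0 < K -> 2 * p * (e / (4 * p)) + e / (4 * K) * (2 * K) = e.
    by move=> p00 K0; field; rewrite (gt_eqF p00) (gt_eqF K0).
  exact: aux.
rewrite -[leRHS]E lerD2l; apply: ler_pM => //.
- by apply: I_ge0 => y; have /andP[] := hpk n y.
- by rewrite mulr_ge0// sqr_ge0.
- lra.
Qed.

(** The regularized integrals of [ht f ^+ 2] are at most [2 * pi * nrm f ^+ 2], so Fatou's lemma
    first puts [ht f] in L^2. Its square then dominates the regularized integrands, and comparing
    the two limits gives equality. *)
Lemma plancherel f : L1 f -> L2 f ->
  L2 (ht f) /\ nrm (ht f) ^+ 2 = 2 * pi * nrm f ^+ 2.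
Proof.
move=> Lf L2f.
have en0 n : 0 < (n.+1%:R^-1 : R) by rewrite invr_gt0.
pose g n (y : R) := poisson n.+1%:R^-1 y * ht f y ^+ 2.
have mht : measurable_fun setT (ht f) by apply: measurable_ht; exact: L1_meas.
have cg x : g ^~ x @ \oo --> ht f x ^+ 2.
  rewrite -[X in _ --> X]mul1r; apply: cvgM; last exact: cvg_cst.
  rewrite /poisson -[X in _ --> X]expR0; apply: continuous_cvg; first exact: continuous_expR.
  rewrite -oppr0 -(mul0r `|x|); apply: cvgN; apply: cvgM; last exact: cvg_cst.
  exact: cvg_harmonic.
have [L IL] : L1 (fun x => ht f x ^+ 2) /\ I (fun x => ht f x ^+ 2) <= 2 * pi * nrm f ^+ 2.
  apply: (@L1_fatou R g).
  - by move=> n; exact: (poisson_pairing Lf L2f (en0 n)).1.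
  - by move=> n x; rewrite mulr_ge0 ?poisson_ge0 ?sqr_ge0.
  - exact: measurable_funX.
  - by apply: ae_all => x; exact: cg.
  - move=> n; rewrite (poisson_pairing Lf L2f (en0 n)).2 -(I_pk (en0 n)).2 -IZr; last exact: (I_pk _).1.
    apply: I_le; [exact: L1_pk_autocorr|by apply: L1Zr; exact: (I_pk _).1|].
    move=> y; rewrite ler_wpM2l ?pk_ge0//.
    by apply: le_trans (ler_norm _) _; exact: autocorr_le.
split; first by split.
rewrite sqr_nrm.
have c1 : (fun n => I (g n)) @ \oo --> I (fun x => ht f x ^+ 2).
  apply: (@I_dominated R g _ (fun x => ht f x ^+ 2)) => //.
  - by move=> n; apply: measurable_funM; [exact: measurable_poisson|exact: measurable_funX].
  - exact: measurable_funX.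
  - by apply: ae_all => x; exact: cg.
  - move=> n x; rewrite ger0_norm; last by apply: mulr_ge0; [exact: poisson_ge0|exact: sqr_ge0].
    by rewrite ler_piMl ?sqr_ge0// poisson_le1// ltW.
have c2 := poisson_approximation L2f.
have E : (fun n => I (g n)) = (fun n => I (fun y => pk n.+1%:R^-1 y * autocorr f y)).
  by apply/funext => n; exact: (poisson_pairing Lf L2f (en0 n)).2.
rewrite E in c1.
by rewrite -(cvg_lim (@Rhausdorff R) c1); exact: cvg_lim c2.
Qed.

End hartley.

(** * Test functions and weak derivatives *)

Section bump.
Context {R : realType}.
Notation mu := (@lebesgue_measure R).
Implicit Types (f g v phi : R -> R) (z q : {poly R}) (c x : R) (k : nat).

(* For z > 0: q z^(-k) exp (- c / z).  The family is stable under derivation,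
   whence smoothness. *)
Definition bump z c q k x : R :=
  if 0 < z.[x] then q.[x] * (z.[x]^-1 ^+ k * expR (- (c * z.[x]^-1))) else 0.

Lemma pow_expRN (c w : R) k : 0 < c -> 0 < w -> w ^+ k * expR (- (c * w)) <= k`!%:R / c ^+ k.
Proof.
move=> c0 w0; rewrite expRN ler_pdivrMr ?expR_gt0// mulrAC ler_pdivlMr ?exprn_gt0//.
have k0 : 0 < k`!%:R :> R by rewrite ltr0n fact_gt0.
rewrite mulrC -ler_pdivrMl// mulrC -exprMn.
case: k k0 => [|k] k0; first by rewrite expr0 invr1 mulr1 -expR0 ler_expR mulr_ge0 ?ltW.
rewrite mulrC (mulrC w).
by apply: le_trans (@expR_ge1Dxn R (c * w) k (ltW (mulr_gt0 c0 w0))); rewrite lerDr.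
Qed.

Lemma bump_le z c q k x : 0 < c -> `|bump z c q k x| <= `|q.[x]| * (k`!%:R / c ^+ k).
Proof.
move=> c0; rewrite /bump; case: ifP => z0.
  rewrite normrM ler_wpM2l// ger0_norm; first by apply: pow_expRN; rewrite ?invr_gt0.
  by rewrite mulr_ge0 ?expR_ge0// exprn_ge0// invr_ge0 ltW.
by rewrite normr0 mulr_ge0// divr_ge0 ?ler0n// exprn_ge0// ltW.
Qed.

Lemma bump_sqr z c q k x : bump z c q k x = z.[x] * (z.[x] * bump z c q k.+2 x).
Proof.
rewrite /bump; case: ifP => [z0|]; last by rewrite !mulr0.
have zn : z.[x] != 0 by rewrite gt_eqF.
rewrite !exprS; move: (_ ^+ k) (expR _) => a b; field.
exact: zn.
Qed.

Lemma bump_algebra (q q' y y' a c e : R) k : y != 0 ->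
  q * (y^-1 ^+ k * (e * - (c * (- y ^- 2 * y'))) + e * (k%:R * y^-1 ^+ k.-1 * (- y ^- 2 * y'))) + y^-1 ^+ k * e * q' =
  (q' * y ^+ 2 - k%:R * (q * y' * y) + c * (q * y')) * (y^-1 ^+ k.+2 * e).
Proof.
by move=> y0; case: k => [|k]; rewrite /= ?expr0 !exprS; [|move: (_ ^+ k) => b]; field.
Qed.

Lemma is_derive_bump_gt0 z c q k x : 0 < z.[x] ->
  is_derive x 1 (fun y => q.[y] * (z.[y]^-1 ^+ k * expR (- (c * z.[y]^-1))))
   (bump z c (q^`() * z ^+ 2 - k%:R *: (q * z^`() * z) + c *: (q * z^`())) k.+2 x).
Proof.
move=> z0; have zn : z.[x] != 0 by rewrite gt_eqF.
have dz := @is_derive_poly R z x; have dq := @is_derive_poly R q x.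
have dw : is_derive x 1 (fun y => z.[y]^-1) _ := is_deriveV zn dz.
have dwk := is_deriveX k dw.
have dcw := is_deriveN (is_deriveZ c dw).
have de := is_derive1_comp (is_derive_expR _) dcw.
have d := is_deriveM dq (is_deriveM dwk de).
have E : (fun y => q.[y] * (z.[y]^-1 ^+ k * expR (- (c * z.[y]^-1)))) =
  horner q * ((fun y => z.[y]^-1) ^+ k * (expR \o - (c \*: (fun y => z.[y]^-1)))).
  by apply/funext => y; rewrite fctE/= fctE/= exprfctE.
have pw : ((fun y => z.[y]^-1) ^+ k) x = z.[x]^-1 ^+ k by rewrite exprfctE.
rewrite E; apply: (is_derive_eq d).
by rewrite /bump z0 hornerD hornerD hornerN !hornerZ [(_ * z ^+ 2).[x]]hornerM horner_exp !hornerM -bump_algebra// -pw.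
Qed.

(** The delicate points are the zeros of z. By [bump_sqr] the difference quotient there is z(x + h)
    / h, which tends to the derivative of z, times z(x + h) times a bump of order k + 2, which is
    bounded near x because the exponential beats every power; so the product tends to 0. *)
Lemma is_derive_bump z c q k x : 0 < c ->
  is_derive x 1 (bump z c q k)
   (bump z c (q^`() * z ^+ 2 - k%:R *: (q * z^`() * z) + c *: (q * z^`())) k.+2 x).
Proof.
move=> c0.
have cz := @continuous_horner R z x.
have [z0|z0|z0] := ltgtP z.[x] 0.
- rewrite {2}/bump ltNge (ltW z0)/=.
  have d0 : is_derive x (1 : R) (cst (0 : R)) 0 by exact: is_derive_cst.
  apply: (near_eq_is_derive _ d0).
  near=> y; rewrite /bump ltNge ltW//=; near: y.
  exact: cvgr_lt cz _ z0.
- apply: (near_eq_is_derive _ (is_derive_bump_gt0 c q k z0)).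
  near=> y; rewrite /bump.
  suff -> : 0 < z.[y] by [].
  near: y.
  exact: cvgr_gt cz _ z0.
- rewrite {2}/bump z0 ltxx.
  have dz := @is_derive_poly R z x.
  have cq := @continuous_horner R q x.
  suff C : h^-1 *: (bump z c q k (h *: 1 + x) - bump z c q k x) @[h --> 0^'] --> (0 : R).
    by split; [apply/cvg_ex; exists 0|exact: cvg_lim C].
  have bx : bump z c q k x = 0 by rewrite /bump z0 ltxx.
  have [+ _] := dz; rewrite /derivable => /cvg_ex[l zl].
  have sh : (h *: 1 + x) @[h --> 0^'] --> x.
    rewrite -[X in _ --> X]add0r; apply: cvgD; last exact: cvg_cst.
    rewrite -[X in _ --> X](mul0r 1); apply: cvgMl; exact: nbhs_dnbhs.
  have zs := cvg_comp _ _ sh cz; have qs := cvg_comp _ _ sh cq.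
  have b0 : z.[h *: 1 + x] * bump z c q k.+2 (h *: 1 + x) @[h --> 0^'] --> (0 : R).
    apply: norm_cvg0.
    have [C hC] : exists C, C = k.+2`!%:R / c ^+ k.+2 by eexists.
    have up : `|z.[h *: 1 + x]| * (`|q.[h *: 1 + x]| * C) @[h --> 0^'] --> `|z.[x]| * (`|q.[x]| * C).
      exact: cvgM (cvg_norm zs) (cvgM (cvg_norm qs) (cvg_cst C)).
    rewrite z0 normr0 mul0r in up.
    have zero : (0 : R) @[_ --> (0 : R)^'] --> (0 : R) by exact: cvg_cst.
    apply: (squeeze_cvgr _ zero up).
    near=> h.
    by rewrite normr_ge0/= normrM ler_wpM2l//= hC; exact: bump_le.
  have E : (fun h => h^-1 *: (bump z c q k (h *: 1 + x) - bump z c q k x)) =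
    (fun h => h^-1 *: ((horner z \o shift x) (h *: 1) - z.[x]) *
       (z.[h *: 1 + x] * bump z c q k.+2 (h *: 1 + x))).
    by apply/funext => h; rewrite bx z0 [bump z c q k _]bump_sqr !subr0; exact: mulrA.
  have cc : h^-1 *: (bump z c q k (h *: 1 + x) - bump z c q k x) @[h --> 0^'] --> l * 0.
    by rewrite E; exact: cvgM zl b0.
  by rewrite mulr0 in cc.
Unshelve. all: by end_near.
Qed.

Lemma derive1n_bump z c q k n : 0 < c ->
  exists q' k', (bump z c q k)^`(n)%classic = bump z c q' k'.
Proof.
move=> c0; elim: n => [|n [q' [k' IH]]]; first by exists q, k.
rewrite derive1nS IH; do 2 eexists.
apply/funext => x; rewrite derive1E.
exact: (@derive_val _ _ _ _ _ _ _ (is_derive_bump z q' k' x c0)).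
Qed.

(** exp (- c / ((x - a)(b - x))) on ]a, b[. As c tends to 0 it tends from below to the indicator of
    the interval, so test functions reach indicators by letting one parameter vary. *)
Definition bump01 (a b c : R) := bump (('X - a%:P) * (b%:P - 'X)) c 1 0.

Lemma itv_prod (a b x : R) : a < b -> (0 < (x - a) * (b - x)) = (a < x < b).
Proof.
move=> ab; apply/idP/idP; last by move=> /andP[ax xb]; rewrite mulr_gt0 ?subr_gt0.
by move=> h; apply/andP; split; nra.
Qed.

Lemma bump01E a b c x : a < b -> bump01 a b c x =
  if (a < x < b) then expR (- (c * ((x - a) * (b - x))^-1)) else 0.
Proof.
move=> ab; rewrite /bump01 /bump hornerM !hornerD !hornerN !hornerX !hornerC hornerE.
by rewrite itv_prod// expr0 !mul1r.
Qed.

Lemma test_bump01 a b c : a < b -> 0 < c -> test_function (bump01 a b c).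
Proof.
move=> ab c0; split.
  move=> n x; have [q' [k' E]] := derive1n_bump (('X - a%:P) * (b%:P - 'X)) 1 0 n c0.
  rewrite /bump01 E.
  exact: (@ex_derive _ _ _ _ _ _ _ (is_derive_bump _ q' k' x c0)).
exists (`|a| + `|b|) => x; rewrite bump01E// => hx; case: ifP => // /andP[ax xb].
suff: `|x| <= `|a| + `|b| by rewrite leNgt hx.
rewrite ler_norml; have := ler_norm b; have := ler_norm (- a); rewrite normrN.
have := normr_ge0 a; have := normr_ge0 b; move=> h1 h2 h3 h4; apply/andP; split; lra.
Qed.

Lemma bump01_bounds a b c x : a < b -> 0 < c -> 0 <= bump01 a b c x <= ((a < x < b)%R)%:R.
Proof.
move=> ab c0; rewrite bump01E//; case: ifP => [h|_]; last by rewrite lexx.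
rewrite expR_ge0/= -[leRHS]expR0 ler_expR oppr_le0 mulr_ge0 ?(ltW c0)// invr_ge0.
by rewrite ltW// itv_prod.
Qed.

Lemma bump01_cvg a b x : a < b ->
  bump01 a b n.+1%:R^-1 x @[n --> \oo] --> ((a < x < b)%R%:R : R).
Proof.
move=> ab; rewrite (_ : (fun n => _) = (fun n => if a < x < b then expR (- (n.+1%:R^-1 * ((x - a) * (b - x))^-1)) else 0)); last first.
  by apply/funext => n; rewrite bump01E.
case: (a < x < b); last exact: cvg_cst.
rewrite /= -[X in _ --> X]expR0; apply: continuous_cvg; first exact: continuous_expR.
rewrite -[X in _ --> X]oppr0; apply: cvgN; rewrite -[X in _ --> X](mul0r ((x - a) * (b - x))^-1).
by apply: cvgMl; exact: cvg_harmonic.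
Qed.

Lemma measurable_bump01 a b c : 0 < c -> measurable_fun setT (bump01 a b c).
Proof.
move=> c0; apply: continuous_measurable_fun => x.
exact: (is_derive_cvg (is_derive_bump _ _ _ _ c0)).
Qed.

Lemma locally_L1 g (N : R) : locally_integrable setT g -> L1 (fun x => g x * box N x).
Proof.
move=> [mg _ lg].
have L : mu.-integrable `[- N, N] (EFin \o g).
  apply/integrableP; split.
    by apply/measurable_EFinP; apply: measurable_funTS.
  by apply: lg => //; exact: segment_compact.
move: L; rewrite integrable_mkcond// /L1.
congr (integrable _ _ _); apply/funext => x; rewrite patchE /box /= indicE.
by case: (x \in _); rewrite ?mulr1 ?mulr0.
Qed.

Lemma measurable_itvoo (a b : R) : measurable_fun setT (fun x : R => ((a < x < b)%R)%:R : R).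
Proof.
rewrite (_ : (fun x => _) = (\1_`]a, b[ : R -> R)).
  by apply: measurable_indic; exact: measurable_itv.
by apply/funext => x; rewrite indicE mem_setE.
Qed.

Lemma itv_le_box (a b N x : R) : - N <= a -> b <= N -> ((a < x < b)%R)%:R <= box N x.
Proof.
move=> aN bN; rewrite boxE; case: (boolP (a < x < b)) => [/andP[ax xb]|_].
  rewrite ler_norml; have -> : - N <= x <= N by apply/andP; split; lra.
  by [].
by rewrite ler0n.
Qed.

Lemma locally_L1_itv g (a b : R) : locally_integrable setT g -> L1 (fun x => g x * ((a < x < b)%R)%:R).
Proof.
move=> lg; have [N [aN bN]] : exists N, - N <= a /\ b <= N.
  exists (`|a| + `|b|); have := ler_norm b; have := ler_norm (- a); rewrite normrN.
  by have := normr_ge0 a; have := normr_ge0 b; split; lra.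
apply: (@L1_le _ (fun x => `|g x * box N x|)).
- by apply: measurable_funM; [case: lg|exact: measurable_itvoo].
- move=> x; rewrite !normrM ler_wpM2l// !ger0_norm ?box_ge0//; exact: itv_le_box.
- by apply: L1_norm; exact: locally_L1.
Qed.

Lemma test_itv g a b : a < b -> locally_integrable setT g ->
  (forall phi, test_function phi -> I (fun x => g x * phi x) = 0) ->
  I (fun x => g x * ((a < x < b)%R)%:R) = 0.
Proof.
move=> ab lg h; have [mg _ _] := lg.
have c0 n : 0 < n.+1%:R^-1 :> R by rewrite invr_gt0 ltr0n.
have c1 : I (fun x => g x * bump01 a b n.+1%:R^-1 x) @[n --> \oo] --> I (fun x => g x * ((a < x < b)%R)%:R).
  apply: (@I_dominated _ _ _ (fun x => `|g x * ((a < x < b)%R)%:R|)).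
  - by move=> n; apply: measurable_funM => //; exact: measurable_bump01.
  - by apply: measurable_funM => //; exact: measurable_itvoo.
  - by apply: aeW => x; apply: cvgMr; exact: bump01_cvg.
  - by apply: L1_norm; exact: locally_L1_itv.
  - move=> n x; rewrite !normrM ler_wpM2l//.
    have /andP[b0 b1] := bump01_bounds x ab (c0 n).
    by rewrite (ger0_norm b0) ger0_norm ?ler0n.
rewrite (_ : (fun n => _) = fun=> 0) in c1; last first.
  by apply/funext => n; apply: h; exact: test_bump01.
by rewrite -(cvg_lim (@Rhausdorff R) c1); exact: lim_cst.
Qed.

Lemma ae_neq (a : R) : {ae mu, forall x, x <> a}.
Proof.
exists [set a]; split => //; first exact: lebesgue_measure_set1.
by move=> x /=; rewrite /=; move/contrapT.
Qed.

(** Bumps tending to indicators show that the integral of g over every bounded interval is 0. Cut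
    off to ]-N, N[, g has a primitive that vanishes identically, and Lebesgue's differentiation
    theorem makes g vanish almost everywhere there. *)
Lemma test_eq0 g : locally_integrable setT g ->
  (forall phi, test_function phi -> I (fun x => g x * phi x) = 0) ->
  {ae mu, forall x, g x = 0}.
Proof.
move=> lg h; have [mg _ _] := lg.
have [hN hE] : exists hN : nat -> R -> R, hN = fun N x => g x * ((- N%:R < x < N%:R)%R)%:R.
  by eexists.
have LN N : L1 (hN N) by rewrite hE; exact: locally_L1_itv.
have aN N : {ae mu, forall x, hN N x = 0}.
  have F0 : (fun x => \int[mu]_(t in `]-oo, x]) hN N t) = cst 0.
    apply/funext => x; rewrite Rintegral_mkcond.
    case: (ltP (- N%:R) (Num.min x N%:R)) => hx.
      rewrite -[RHS](test_itv hx lg h); apply: I_ae.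
      - have mI : @measurable _ (measurableTypeR R) `]-oo, x]%classic by exact: measurable_itv.
        apply/(measurable_restrictT (hN N) mI); apply: measurable_funTS; exact: L1_meas (LN N).
      - by apply: measurable_funM => //; exact: measurable_itvoo.
      - apply: (@ae_imply _ (fun y => y <> x) _ (ae_neq x)) => y yx; rewrite patchE mem_setE in_itv/= hE lt_min.
        by case: (ltgtP y x) yx => // xy; rewrite ?andbF ?mulr0.
    rewrite [LHS](_ : _ = I (cst 0)); first by rewrite /Rintegral integral0.
    congr Rintegral; apply/funext => y.
    rewrite patchE mem_setE in_itv/= hE; case: ifP => // yx.
    suff -> : (- N%:R < y < N%:R) = false by rewrite mulr0.
    apply/negbTE/negP => /andP[h1 h2]; move: hx; rewrite leNgt lt_min => /negP; apply.
    by rewrite (lt_le_trans h1 yx)/= (lt_trans h1 h2).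
  have LI y : mu.-integrable `]-oo, y] (EFin \o hN N).
    by apply: integrableS (LN N).
  have LL : locally_integrable [set: R] (hN N).
    by apply: open_integrable_locally; [exact: openT|exact: LN].
  have := FTC1Ny LI LL; rewrite /= F0 => FT.
  by apply: (@ae_imply _ (fun x => derivable (cst 0 : R -> R) x 1 /\ (cst 0 : R -> R)^`()%classic x = hN N x) _ FT) => x [_]; rewrite derive1_cst.
apply: (@ae_imply _ (fun x => forall N, hN N x = 0) _ (ae_foralln aN)) => x hx.
have [N Nx] : exists N : nat, `|x| < N%:R.
  by exists (Num.bound `|x|); exact: archi_boundP.
have := hx N; rewrite hE -ltr_norml Nx mulr1; exact.
Qed.

Lemma test_continuous phi : test_function phi -> continuous phi.
Proof.
move=> [d _] x; apply: differentiable_continuous; apply/derivable1_diffP; exact: (d 0%N).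
Qed.

Lemma test_bound phi : test_function phi -> exists M C, [/\ 0 < M, 0 <= C,
  forall x, M <= `|x| -> phi x = 0 & forall x, `|phi x| <= C * box M x].
Proof.
move=> tphi; have cphi := test_continuous tphi; have [_ [M Mphi]] := tphi.
(* The given M may be negative. With [|M| + 1] the interval is proper and phi also vanishes at its
   endpoints, which removes the boundary terms of an integration by parts. *)
have M0 : 0 < `|M| + 1 by rewrite ltr_pwDr.
have N0 : - (`|M| + 1) <= `|M| + 1 by lra.
have cn : {within `[- (`|M| + 1), `|M| + 1], continuous (fun x => `|phi x|)}.
  apply: continuous_subspaceT => x; apply: cvg_norm; exact: cphi.
have [c cI hc] := EVT_max N0 cn.
have P0 x : `|M| + 1 <= `|x| -> phi x = 0.
  by move=> h; apply: Mphi; have := ler_norm M; lra.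
exists (`|M| + 1), `|phi c|; split => // x.
rewrite boxE; case: (leP `|x| (`|M| + 1)) => h; last by rewrite P0 ?(ltW h)// normr0 mulr0.
by rewrite mulr1 hc// in_itv/= -ler_norml.
Qed.

Lemma locally_L1_test g phi : locally_integrable setT g -> test_function phi -> L1 (fun x => g x * phi x).
Proof.
move=> lg tphi; have [mg _ _] := lg; have [M [C [_ C0 _ hC]]] := test_bound tphi.
apply: (@L1_le _ (fun x => C * `|g x * box M x|)).
- by apply: measurable_funM => //; apply: continuous_measurable_fun; exact: test_continuous.
- by move=> x; rewrite !normrM mulrCA ler_wpM2l// (ger0_norm (box_ge0 _ _)).
- by apply: L1Zl; apply: L1_norm; exact: locally_L1.
Qed.

Lemma continuous_locally f : continuous f -> locally_integrable setT f.
Proof.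
move=> cf; split; [exact: continuous_measurable_fun|exact: openT|move=> K _ cK].
have := @continuous_compact_integrable R f K cK (@continuous_subspaceT _ _ K _ cf).
by move=> /integrableP[_].
Qed.

Lemma locally_ae f g : measurable_fun setT g -> {ae mu, forall x, f x = g x} ->
  locally_integrable setT f -> locally_integrable setT g.
Proof.
move=> mg fg [mf oT lf]; split => // K _ cK.
rewrite (_ : (\int[mu]_(x in K) `|g x|%:E)%E = (\int[mu]_(x in K) `|f x|%:E)%E); first exact: lf.
apply: ae_eq_integral.
- apply: compact_measurable => //.
- by apply/measurable_EFinP; apply: measurableT_comp => //; apply: measurable_funTS.
- by apply/measurable_EFinP; apply: measurableT_comp => //; apply: measurable_funTS.
- by apply: (@ae_imply _ (fun x => f x = g x) _ fg) => x -> _.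
Qed.

Lemma test_derive phi x : test_function phi -> is_derive x 1 phi (phi^`()%classic x).
Proof. by move=> [d _]; apply: DeriveDef; [exact: (d 0%N)|rewrite derive1E]. Qed.

Lemma test_support phi M x : (forall y, M < `|y| -> phi y = 0) -> M < `|x| -> phi^`()%classic x = 0.
Proof.
move=> hM hx; rewrite derive1E.
have d0 : is_derive x (1 : R) (cst (0 : R)) 0 by exact: is_derive_cst.
apply: (@derive_val _ _ _ _ _ _ _ (near_eq_is_derive _ d0)).
near=> y; rewrite hM//; near: y.
have cn : `|y| @[y --> x] --> `|x| by apply: cvg_norm.
exact: cvgr_gt cn _ hx.
Unshelve. all: by end_near.
Qed.

Lemma test_test phi : test_function phi -> test_function (phi^`()%classic).
Proof.
move=> [d [M hM]]; split; first by move=> n x; rewrite -derive1Sn; exact: d.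
by exists M => x; exact: test_support.
Qed.

Lemma derive_LRcontinuous f g a b : (forall x, is_derive x 1 f (g x)) -> derivable_oo_LRcontinuous f a b.
Proof.
move=> df; split.
- by move=> x _; exact: (@ex_derive _ _ _ _ _ _ _ (df x)).
- by apply: cvg_at_right_filter; exact: is_derive_cvg (df a).
- by apply: cvg_at_left_filter; exact: is_derive_cvg (df b).
Qed.

(** Integration by parts on an interval at whose ends the test function vanishes. The function v
    stands beside f because elements of H^s are known only up to null sets, while f is their
    continuously differentiable representative. *)
Lemma classical_weak f g v : (forall x, is_derive x 1 f (g x)) -> continuous g ->
  measurable_fun setT v -> {ae mu, forall x, f x = v x} -> is_weak_derivative v g.
Proof.
move=> df cg mv fv; have cf x : {for x, continuous f} := is_derive_cvg (df x).
split.
- by apply: locally_ae mv fv (continuous_locally _) => x; exact: cf.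
- exact: continuous_locally.
move=> phi tphi.
have tphi' := test_test tphi.
have mphi := continuous_measurable_fun (test_continuous tphi).
have mphi' := continuous_measurable_fun (test_continuous tphi').
have mf := @continuous_measurable_fun _ f cf.
rewrite (@I_ae _ (fun x => v x * phi^`()%classic x) (fun x => f x * phi^`()%classic x)).
- have [M [C [M0 C0 zM bM]]] := test_bound tphi.
  have zM' x : M < `|x| -> phi^`()%classic x = 0.
    by apply: test_support => y /ltW; exact: zM.
  have dphi x := test_derive x tphi.
  have := @Rintegration_by_parts R f phi g (phi^`()%classic) (- M) M.
  have supp (h k : R -> R) : (forall x, M < `|x| -> k x = 0) ->
    \int[mu]_(x in `[- M, M]) (h x * k x) = I (fun x => h x * k x).
    move=> hk; rewrite Rintegral_mkcond; congr Rintegral; apply/funext => x.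
    rewrite patchE mem_setE in_itv/= -ler_norml; case: (leP `|x| M) => // hx.
    by rewrite hk ?mulr0.
  rewrite !supp//; last by move=> x /ltW; exact: zM.
  rewrite !zM ?normrN ?(ger0_norm (ltW M0))// !mulr0 subr0 sub0r; apply.
  + by lra.
  + exact: continuous_subspaceT.
  + exact: derive_LRcontinuous df.
  + by move=> x _; rewrite derive1E; exact: (@derive_val _ _ _ _ _ _ _ (df x)).
  + by apply: continuous_subspaceT; exact: test_continuous.
  + exact: derive_LRcontinuous dphi.
  + by [].
- exact: measurable_funM.
- exact: measurable_funM.
- by apply: (@ae_imply _ (fun x => f x = v x) _ fv) => x ->.
Qed.

Lemma weak_derivative_unique f g g' : is_weak_derivative f g -> is_weak_derivative f g' ->
  {ae mu, forall x, g x = g' x}.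
Proof.
move=> [_ lg hg] [_ lg' hg'].
have E : {ae mu, forall x, g x - g' x = 0}.
  apply: test_eq0; first exact: locally_integrableB.
  move=> phi tphi; have := hg phi tphi; rewrite hg'//.
    have LL h lh := @locally_L1_test h phi lh tphi.
  move=> hh.
  rewrite (_ : (fun x => _) = (fun x => g x * phi x - g' x * phi x)); last first.
    by apply/funext => x; rewrite mulrBl.
  by rewrite IB; [rewrite (oppr_inj hh) subrr|exact: LL|exact: LL].
by apply: (@ae_imply _ (fun x => g x - g' x = 0) _ E) => x; exact: subr0_eq.
Qed.

Lemma weak_derivativeP f g : is_weak_derivative f g -> {ae mu, forall x, weak_derivative f x = g x}.
Proof. by move=> h; apply: weak_derivative_unique (h); exact: (@getPex _ (is_weak_derivative f) (ex_intro _ _ h)). Qed.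
End bump.

(** * The Hartley transform on L^2 and its inversion *)

Section hartley_L2.
Context {R : realType}.
Notation mu := (@lebesgue_measure R).
Implicit Types f g U W : R -> R.

Definition cut f (n : nat) (y : R) : R := f y * box n%:R y.

(** A relation, since the transform of an L^2 function is defined only almost everywhere. The
    cut-offs to [-n, n] are those of [trunc_fourier], so that the link with [is_fourier] is
    termwise. *)
Definition hart f U : Prop :=
  [/\ L2 f, L2 U & (fun n => nrm (fun x => ht (cut f n) x - U x)) @ \oo --> 0].

Definition sq2pi : R := Num.sqrt (2 * pi).

Lemma sq2pi_gt0 : 0 < sq2pi.
Proof. by rewrite sqrtr_gt0 mulr_gt0// pi_gt0. Qed.

Lemma sqr_sq2pi : sq2pi ^+ 2 = 2 * pi.
Proof. by rewrite sqr_sqrtr// mulr_ge0// ltW// pi_gt0. Qed.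

Lemma L2_ht f : L1 f -> L2 f -> L2 (ht f).
Proof. by move=> Lf L2f; exact: (plancherel Lf L2f).1. Qed.

Lemma nrm_ht f : L1 f -> L2 f -> nrm (ht f) = sq2pi * nrm f.
Proof.
move=> Lf L2f; apply/eqP.
rewrite -(@eqrXn2 _ 2) ?nrm_ge0 ?mulr_ge0 ?nrm_ge0 ?(ltW sq2pi_gt0)//.
by rewrite exprMn sqr_sq2pi (plancherel Lf L2f).2.
Qed.

Lemma L1_cut f n : L2 f -> L1 (cut f n). Proof. exact: L1_L2_box. Qed.
Lemma L2_cut f n : L2 f -> L2 (cut f n). Proof. exact: L2_box. Qed.
Lemma L2_ht_cut f n : L2 f -> L2 (ht (cut f n)).
Proof. by move=> Lf; apply: L2_ht; [exact: L1_cut|exact: L2_cut]. Qed.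

Lemma nrm_htB f g : L1 f -> L2 f -> L1 g -> L2 g ->
  nrm (fun x => ht f x - ht g x) = sq2pi * nrm (fun x => f x - g x).
Proof.
move=> Lf L2f Lg L2g; rewrite -nrm_ht; [|exact: L1B|exact: L2B].
by congr nrm; apply/funext => x; rewrite htB.
Qed.

Lemma cut_cvg f : L2 f -> (fun n => nrm (fun x => cut f n x - f x)) @ \oo --> 0.
Proof. exact: nrm_box_cvg. Qed.

Lemma cvg0_nat (a : nat -> R) : a @ \oo --> 0 -> forall e, 0 < e -> exists n, `|a n| <= e.
Proof.
move=> ca e e0; have /cvgr0_norm_le/(_ e e0)[n _ hn] := ca.
by exists n; apply: hn => /=.
Qed.

Lemma hart_exists f : L2 f -> exists U, hart f U.
Proof.
move=> Lf.
pose a n := nrm (fun x => cut f n x - f x).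
have ca : a @ \oo --> 0 by exact: cut_cvg.
have p0 := sq2pi_gt0.
have h2 (m : nat) : 0 < (2 : R) ^+ m by rewrite exprn_gt0.
(* Completeness is available for sequences with geometrically decreasing increments, so a
   subsequence of cut-offs at distance at most 2^-j from f is chosen. The whole sequence then
   converges at the rate [sq2pi * a n]. *)
have kex (j : nat) : {k : nat | a k <= 1 / 2 ^+ j}.
  apply: cid; have [k hk] := cvg0_nat ca (e := 1 / 2 ^+ j) (divr_gt0 ltr01 (h2 j)).
  by exists k; apply: le_trans (ler_norm _) hk.
pose k j := sval (kex j).
have ak j : a (k j) <= 1 / 2 ^+ j := svalP (kex j).
have Lc n := L2_cut n Lf; have L1c n := L1_cut n Lf.
pose F j := ht (cut f (k j)).
have LF j : L2 (F j) by exact: L2_ht_cut.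
have dF n m : nrm (fun x => ht (cut f n) x - ht (cut f m) x) <= sq2pi * (a n + a m).
  rewrite nrm_htB// ler_wpM2l ?(ltW p0)//.
  by apply: le_trans (nrm_triangle (Lc n) Lf (Lc m)) _; rewrite lerD2l nrmB.
have [|U [LU hU]] := @L2_complete R F (2 * sq2pi) LF.
  move=> j; apply: le_trans (dF _ _) _.
  rewrite -mulrA mulrCA ler_wpM2l ?(ltW p0)//.
  have := ak j; have := ak j.+1; rewrite exprS.
  have -> : (1 / (2 * 2 ^+ j) : R) = 2^-1 * (1 / 2 ^+ j) by field; rewrite gt_eqF.
  have : 0 < 1 / (2 : R) ^+ j by rewrite divr_gt0.
  rewrite div1r; lra.
exists U; split => //.
have key n : nrm (fun x => ht (cut f n) x - U x) <= sq2pi * a n.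
  apply/ler_addgt0Pr => e e0.
  have c2 : (fun j : nat => (5 * sq2pi) / 2 ^+ j : R) @ \oo --> 0.
    rewrite -(mulr0 (5 * sq2pi)); apply: cvgM; first exact: cvg_cst.
    under eq_fun do rewrite -exprVn.
    by apply: cvg_expr; rewrite ger0_norm// invf_lt1// ltr1n.
  have [j hj] := cvg0_nat c2 e0.
  have Lcn := L2_ht_cut n Lf.
  apply: le_trans (nrm_triangle Lcn (LF j) LU) _.
  apply: le_trans (lerD (dF n (k j)) (hU j)) _.
  rewrite mulrDr -addrA lerD2l; apply: le_trans hj.
  apply: le_trans (ler_norm _).
  apply: (@le_trans _ _ (sq2pi * (1 / 2 ^+ j) + 2 * (2 * sq2pi) / 2 ^+ j)).
    by rewrite lerD2r ler_wpM2l ?(ltW p0).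
  by apply: eq_ler; field; rewrite gt_eqF.
apply: (@squeeze_cvgr _ _ _ _ (fun=> 0) (fun n => sq2pi * a n)); last 2 first.
- exact: cvg_cst.
- by rewrite -(mulr0 sq2pi); apply: cvgM => //; exact: cvg_cst.
- by apply: nearW => n; rewrite nrm_ge0 key.
Qed.

Lemma nrm_cvg (a : nat -> R -> R) b : (forall n, L2 (a n)) -> L2 b ->
  (fun n => nrm (fun x => a n x - b x)) @ \oo --> 0 -> (fun n => nrm (a n)) @ \oo --> nrm b.
Proof.
move=> La Lb cab; apply/cvgrPdist_le => e e0.
have /cvgr0_norm_le/(_ e e0) := cab; apply: filterS => n hn.
rewrite distrC; apply: le_trans (nrm_dist (La n) Lb) _.
by apply: le_trans (ler_norm _) hn.
Qed.

Lemma dot_cvg (a b : nat -> R -> R) f g : (forall n, L2 (a n)) -> (forall n, L2 (b n)) ->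
  L2 f -> L2 g -> (fun n => nrm (fun x => a n x - f x)) @ \oo --> 0 ->
  (fun n => nrm (fun x => b n x - g x)) @ \oo --> 0 ->
  (fun n => I (fun x => a n x * b n x)) @ \oo --> I (fun x => f x * g x).
Proof.
move=> La Lb Lf Lg ca cb.
have cnb := nrm_cvg Lb Lg cb.
have c0 : (fun n => nrm (fun x => a n x - f x) * nrm (b n) + nrm f * nrm (fun x => b n x - g x))
    @ \oo --> 0 * nrm g + nrm f * 0.
  by apply: cvgD; apply: cvgM => //; exact: cvg_cst.
rewrite mul0r mulr0 addr0 in c0.
apply/subr_cvg0.
apply: (@squeeze_cvgr _ _ _ _
  (fun n => - (nrm (fun x => a n x - f x) * nrm (b n) + nrm f * nrm (fun x => b n x - g x)))
  (fun n => nrm (fun x => a n x - f x) * nrm (b n) + nrm f * nrm (fun x => b n x - g x))).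
- apply: nearW => n; rewrite -ler_norml.
  have -> : I (fun x => a n x * b n x) - I (fun x => f x * g x) =
    I (fun x => (a n x - f x) * b n x) + I (fun x => f x * (b n x - g x)).
    rewrite -IB; [|exact: L1M..].
    rewrite -ID; [|exact: L1M (L2B (La n) Lf) (Lb n)|exact: L1M Lf (L2B (Lb n) Lg)].
    by congr Rintegral; apply/funext => x; ring.
  apply: le_trans (ler_normD _ _) _; apply: lerD.
    exact: cauchy_schwarz (L2B (La n) Lf) (Lb n).
  exact: cauchy_schwarz Lf (L2B (Lb n) Lg).
- by rewrite -oppr0; exact: cvgN.
- exact: c0.
Qed.

Lemma hart_nrm f U : hart f U -> nrm U = sq2pi * nrm f.
Proof.
move=> [Lf LU cU].
have c1 := nrm_cvg (fun n => L2_ht_cut n Lf) LU cU.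
have c2 : (fun n => nrm (ht (cut f n))) @ \oo --> sq2pi * nrm f.
  rewrite (_ : (fun n => _) = (fun n => sq2pi * nrm (cut f n))); last first.
    by apply/funext => n; rewrite nrm_ht//; [exact: L1_cut|exact: L2_cut].
  apply: cvgM; first exact: cvg_cst.
  by apply: nrm_cvg => //; [move=> n; exact: L2_cut|exact: cut_cvg].
by rewrite -(cvg_lim (@Rhausdorff R) c1); exact: cvg_lim c2.
Qed.

Lemma hartD f g U W : hart f U -> hart g W ->
  hart (fun x => f x + g x) (fun x => U x + W x).
Proof.
move=> [Lf LU cU] [Lg LW cW]; split; [exact: L2D|exact: L2D|].
apply: (@squeeze_cvgr _ _ _ _ (fun=> 0) (fun n => nrm (fun x => ht (cut f n) x - U x)
  + nrm (fun x => ht (cut g n) x - W x))).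
- apply: nearW => n; rewrite nrm_ge0/=.
  have LA := L2B (L2_ht_cut n Lf) LU; have LB := L2B (L2_ht_cut n Lg) LW.
  rewrite (_ : (fun x => _ - _) = (fun x => (ht (cut f n) x - U x) + (ht (cut g n) x - W x))).
    exact: nrmD_le.
  apply/funext => x; rewrite (_ : cut (fun x => f x + g x) n = fun x => cut f n x + cut g n x).
    by rewrite htD; [ring|exact: L1_cut|exact: L1_cut].
  by apply/funext => y; rewrite /cut mulrDl.
- exact: cvg_cst.
- by rewrite -[0](addr0 (0 : R)); exact: cvgD.
Qed.

Lemma hartZ k f U : hart f U -> hart (fun x => k * f x) (fun x => k * U x).
Proof.
move=> [Lf LU cU]; split; [exact: L2Zl|exact: L2Zl|].
rewrite (_ : (fun n => _) = (fun n => `|k| * nrm (fun x => ht (cut f n) x - U x))).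
  by rewrite -(mulr0 `|k|); apply: cvgM => //; exact: cvg_cst.
apply/funext => n; rewrite -nrmZ; last exact: L2B (L2_ht_cut n Lf) LU.
congr nrm; apply/funext => x.
rewrite (_ : cut (fun x => k * f x) n = fun x => k * cut f n x).
  by rewrite htZ ?mulrBr//; exact: L1_cut.
by apply/funext => y; rewrite /cut mulrA.
Qed.

Lemma hartB f g U W : hart f U -> hart g W ->
  hart (fun x => f x - g x) (fun x => U x - W x).
Proof.
move=> hf /(hartZ (-1)) hg.
by have := hartD hf hg; under eq_fun do rewrite mulN1r; under [X in hart _ X]eq_fun do rewrite mulN1r.
Qed.

Lemma hart_ae f g U W : measurable_fun setT g -> measurable_fun setT W ->
  {ae mu, forall x, f x = g x} -> {ae mu, forall x, U x = W x} -> hart f U -> hart g W.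
Proof.
move=> mg mW fg UW [Lf LU cU].
split; [exact: L2_ae mg Lf fg|exact: L2_ae mW LU UW|].
rewrite (_ : (fun n => _) = (fun n => nrm (fun x => ht (cut f n) x - U x)))//.
apply/funext => n; have LA := L2_meas (L2_ht_cut n Lf).
have -> : ht (cut g n) = ht (cut f n).
  apply/funext => x; apply: I_ae.
  - apply: L1_meas; apply: L1_cas; apply: L1_cut; exact: L2_ae mg Lf fg.
  - by apply: L1_meas; apply: L1_cas; exact: L1_cut.
  - by apply: ae_imply fg _ => y; rewrite /cut => ->.
apply: nrm_ae.
- exact: measurable_funB.
- by apply: measurable_funB => //; exact: L2_meas.
- by apply: ae_imply UW _ => x ->.
Qed.

Lemma hart_unique f U W : hart f U -> hart f W -> {ae mu, forall x, U x = W x}.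
Proof.
move=> hU hW.
have := hart_nrm (hartB hU hW).
rewrite (@nrm_ae0 _ (fun x => f x - f x)); last 2 first.
- by case: hU => [[mf _] _ _]; exact: measurable_funB.
- by apply: ae_all => x; rewrite subrr.
rewrite mulr0 => h0; have [_ LU _] := hU; have [_ LW _] := hW.
by apply: ae_imply (nrm_eq0 (L2B LU LW) h0) _ => x /eqP; rewrite subr_eq0 => /eqP.
Qed.

Lemma hart_inj f g U : hart f U -> hart g U -> {ae mu, forall x, f x = g x}.
Proof.
move=> hU hW; have [Lf _ _] := hU; have [Lg LU _] := hW.
have := hart_nrm (hartB hU hW).
rewrite (@nrm_ae0 _ (fun x => U x - U x)); last 2 first.
- by case: LU => [mf _]; exact: measurable_funB.
- by apply: ae_all => x; rewrite subrr.
move=> /esym/eqP; rewrite mulf_eq0 (gt_eqF sq2pi_gt0)/= => /eqP h0.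
by apply: ae_imply (nrm_eq0 (L2B Lf Lg) h0) _ => x /eqP; rewrite subr_eq0 => /eqP.
Qed.

Lemma hart_L1 f : L1 f -> L2 f -> hart f (ht f).
Proof.
move=> Lf L2f; split => //; first exact: L2_ht.
rewrite (_ : (fun n => _) = (fun n => sq2pi * nrm (fun x => cut f n x - f x))); last first.
  by apply/funext => n; rewrite nrm_htB//; [exact: L1_cut|exact: L2_cut].
by rewrite -(mulr0 sq2pi); apply: cvgM; [exact: cvg_cst|exact: cut_cvg].
Qed.

Lemma hart_selfadjoint f g U W : hart f U -> hart g W ->
  I (fun x => U x * g x) = I (fun x => f x * W x).
Proof.
move=> [Lf LU cU] [Lg LW cW].
have c1 := dot_cvg (fun n => L2_ht_cut n Lf) (fun n => L2_cut n Lg) LU Lg cU (cut_cvg Lg).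
have c2 := dot_cvg (fun n => L2_cut n Lf) (fun n => L2_ht_cut n Lg) Lf LW (cut_cvg Lf) cW.
rewrite -(cvg_lim (@Rhausdorff R) c1) -(cvg_lim (@Rhausdorff R) c2).
congr (lim (_ @ \oo)); apply/funext => n.
by rewrite ht_selfadjoint//; exact: L1_cut.
Qed.

Lemma hart_dot f g U W : hart f U -> hart g W ->
  I (fun x => U x * W x) = 2 * pi * I (fun x => f x * g x).
Proof.
move=> hf hg; have [Lf LU _] := hf; have [Lg LW _] := hg.
have := congr1 (fun z => z ^+ 2) (hart_nrm (hartD hf hg)).
rewrite exprMn sqr_sq2pi (sqr_nrmD LU LW) (sqr_nrmD Lf Lg) (hart_nrm hf) (hart_nrm hg) !exprMn sqr_sq2pi.
set p := pi; set a := nrm f ^+ 2; set b := nrm g ^+ 2; lra.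
Qed.

(** For g = W - 2 pi f with transform G, self-adjointness and Plancherel's identity give int W g =
    int U G = 2 pi int f g. Hence int g^2 = 0. *)
Lemma hart_hart f U W : hart f U -> hart U W -> {ae mu, forall x, W x = 2 * pi * f x}.
Proof.
move=> hf hU; have [Lf LU _] := hf; have [_ LW _] := hU.
pose g x := W x - 2 * pi * f x.
have Lg : L2 g by apply: L2B => //; exact: L2Zl.
have [G hG] := hart_exists Lg.
have E : I (fun x => W x * g x) = 2 * pi * I (fun x => f x * g x).
  by rewrite (hart_selfadjoint hU hG) (hart_dot hf hG).
have : nrm g = 0.
  apply/eqP; rewrite -sqrf_eq0 sqr_nrm.
  rewrite (_ : (fun x => _) = (fun x => W x * g x - 2 * pi * (f x * g x))); last first.
    by apply/funext => x; rewrite /g; ring.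
  rewrite IB; [|exact: L1M|by apply: L1Zl; exact: L1M].
  by rewrite E IZl ?subrr//; exact: L1M.
move/(nrm_eq0 Lg); move/ae_imply; apply => x /eqP.
by rewrite subr_eq0 => /eqP.
Qed.

(** The Hartley transform is its own inverse up to the factor 2 pi. For an integrable U this is a
    function defined at every point. *)
Definition iht U (x : R) : R := (2 * pi)^-1 * ht U x.

Lemma hart_iht U : L1 U -> L2 U -> hart (iht U) U.
Proof.
move=> LU L2U; have h := hart_L1 LU L2U; have [_ Lh _] := h.
have [W hW] := hart_exists Lh.
have WE := hart_hart h hW.
have p0 : 2 * pi != 0 :> R by rewrite gt_eqF// mulr_gt0// pi_gt0.
apply: hart_ae (hartZ (2 * pi)^-1 hW).
- by apply: L2_meas; exact: L2Zl.
- exact: L2_meas.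
- exact: ae_all.
- by apply: ae_imply WE _ => x ->; rewrite mulrA mulVf// mul1r.
Qed.

End hartley_L2.

(** * Sobolev norms and the Hartley transform *)

Section bridge.
Context {R : realType}.
Notation mu := (@lebesgue_measure R).
Implicit Types f g U W : R -> R.

Lemma Lnorm2E f : L2 f -> ('N[mu]_2%:E [EFin \o f] = (nrm f)%:E)%E.
Proof.
move=> [mf Lf]; rewrite unlock.
under eq_integral => x _ do rewrite /= powR_mulrn// real_normK ?num_real//.
by rewrite -EFin_I// poweR_EFin powR12_sqrt// I_ge0// => x; exact: sqr_ge0.
Qed.

Lemma Lfun2P f : (f \in Lfun mu 2%:E) <-> L2 f.
Proof.
split => [Lf|Lf].
  split; last exact: (Lfun2_integrable_sqr Lf).
  by move: Lf; rewrite inE => /andP[/[!inE]].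
rewrite inE; apply/andP; split; rewrite inE/=; first exact: L2_meas.
by rewrite /finite_norm Lnorm2E// ltry.
Qed.

(** For a real function, the even part of the Hartley transform is the real part of the Fourier
    transform, and minus its odd part is the imaginary part. *)
Definition evenp f (x : R) := 2^-1 * (f x + f (- x)).
Definition oddp f (x : R) := 2^-1 * (f x - f (- x)).

Lemma L2_evenp f : L2 f -> L2 (evenp f).
Proof. by move=> Lf; apply: L2Zl; apply: L2D => //; exact: L2_opp. Qed.

Lemma L2_oddp f : L2 f -> L2 (oddp f).
Proof. by move=> Lf; apply: L2Zl; apply: L2B => //; exact: L2_opp. Qed.

Lemma nrm_evenp_le f : L2 f -> nrm (evenp f) <= nrm f.
Proof.
move=> Lf; rewrite /evenp nrmZ; last by apply: L2D => //; exact: L2_opp.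
have := nrmD_le Lf (L2_opp Lf); rewrite nrm_opp//.
rewrite ger0_norm ?invr_ge0//; lra.
Qed.

Lemma nrm_oddp_le f : L2 f -> nrm (oddp f) <= nrm f.
Proof.
move=> Lf; rewrite /oddp nrmZ; last by apply: L2B => //; exact: L2_opp.
have := nrmB_le Lf (L2_opp Lf); rewrite nrm_opp//.
rewrite ger0_norm ?invr_ge0//; lra.
Qed.

Lemma L1_cos f (x : R) : L1 f -> L1 (fun y => f y * cos (y * x)).
Proof.
move=> Lf; apply: (L1M_bounded Lf (C := 1)); last by move=> y; exact: norm_cos_le1.
by under eq_fun do rewrite mulrC; apply: measurable_trigM; exact: continuous_cos.
Qed.

Lemma L1_sin f (x : R) : L1 f -> L1 (fun y => f y * sin (y * x)).
Proof.
move=> Lf; apply: (L1M_bounded Lf (C := 1)); last by move=> y; exact: norm_sin_le1.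
by under eq_fun do rewrite mulrC; apply: measurable_trigM; exact: continuous_sin.
Qed.

Lemma Rintegral_cut f g n : \int[mu]_(x in `[- n%:R, n%:R]) (f x * g x) = I (fun x => cut f n x * g x).
Proof.
rewrite Rintegral_mkcond; congr Rintegral; apply/funext => x.
rewrite patchE /cut /box indicE; case: (x \in _); first by rewrite mulr1.
by rewrite mulr0 mul0r.
Qed.

Lemma trunc_fourierE f n : L2 f ->
  (trunc_fourier f n).1 = evenp (ht (cut f n)) /\
  (trunc_fourier f n).2 = (fun x => - oddp (ht (cut f n)) x).
Proof.
move=> Lf; have Lc := L1_cut n Lf.
split; apply/funext => x; rewrite /= Rintegral_cut /evenp /oddp /ht.
  rewrite -ID; [|exact: L1_cas..].
  rewrite -IZl; last by apply: L1D; exact: L1_cas.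
  congr Rintegral; apply/funext => y.
  by rewrite /cas mulNr cosN sinN (mulrC x y); field.
rewrite -IB; [|exact: L1_cas..].
rewrite -IZl; last by apply: L1B; exact: L1_cas.
congr (- _); congr Rintegral; apply/funext => y.
by rewrite /cas mulNr cosN sinN (mulrC x y); field.
Qed.

Lemma evenpB f g : (fun x => evenp f x - evenp g x) = evenp (fun x => f x - g x).
Proof. by apply/funext => x; rewrite /evenp; ring. Qed.
Lemma oddpB f g : (fun x => oddp f x - oddp g x) = oddp (fun x => f x - g x).
Proof. by apply/funext => x; rewrite /oddp; ring. Qed.

Lemma cvg_nrmE (a : nat -> R -> R) b : (forall n, L2 (a n)) -> L2 b ->
  (('N[mu]_2%:E [EFin \o (a n \- b)%R])%E @[n --> \oo] --> 0%E) <->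
  ((fun n => nrm (fun x => a n x - b x)) @ \oo --> 0).
Proof.
move=> La Lb.
have E : (fun n => 'N[mu]_2%:E [EFin \o (a n \- b)%R])%E = (fun n => (nrm (fun x => a n x - b x))%:E).
  by apply/funext => n; rewrite -Lnorm2E//; exact: L2B.
rewrite E; split => [/fine_cvgP[_]//|H].
by apply: cvg_EFin => //; exact: nearW.
Qed.

Lemma is_fourier_hart f U : hart f U -> is_fourier f (evenp U, fun x => - oddp U x).
Proof.
move=> [Lf LU cU]; have Lc n := L2_ht_cut n Lf.
have Le n : L2 (trunc_fourier f n).1 by rewrite (trunc_fourierE n Lf).1; exact: L2_evenp.
have Lo n : L2 (trunc_fourier f n).2.
  by rewrite (trunc_fourierE n Lf).2; apply: L2N; exact: L2_oddp.
split => /=.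
- by apply/Lfun2P; exact: L2_evenp.
- by apply/Lfun2P; apply: L2N; exact: L2_oddp.
- apply/(cvg_nrmE Le); first exact: L2_evenp.
  apply: (@squeeze_cvgr _ _ _ _ (fun=> 0) _ _ _ _ _ cU); last exact: cvg_cst.
  apply: nearW => n; apply/andP; split; first exact: nrm_ge0.
  rewrite (trunc_fourierE n Lf).1 evenpB.
  by apply: nrm_evenp_le; exact: L2B.
- apply/(cvg_nrmE Lo); first by apply: L2N; exact: L2_oddp.
  apply: (@squeeze_cvgr _ _ _ _ (fun=> 0) _ _ _ _ _ cU); last exact: cvg_cst.
  apply: nearW => n; apply/andP; split; first exact: nrm_ge0.
  rewrite (trunc_fourierE n Lf).2.
  rewrite (_ : (fun x => _) = (fun x => - (oddp (ht (cut f n)) x - oddp U x))); last first.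
    by apply/funext => x; rewrite opprB opprK addrC.
  rewrite nrmN oddpB.
  by apply: nrm_oddp_le; exact: L2B.
Qed.

Lemma L2_lim_unique (a : nat -> R -> R) f g : (forall n, L2 (a n)) -> L2 f -> L2 g ->
  (fun n => nrm (fun x => a n x - f x)) @ \oo --> 0 ->
  (fun n => nrm (fun x => a n x - g x)) @ \oo --> 0 -> {ae mu, forall x, f x = g x}.
Proof.
move=> La Lf Lg cf cg.
have n0 : nrm (fun x => f x - g x) = 0.
  apply/eqP; rewrite eq_le nrm_ge0 andbT.
  apply/ler_addgt0Pr => e e0; rewrite add0r.
  have e2 : 0 < e / 2 by rewrite divr_gt0.
  have /cvgr0_norm_le/(_ _ e2)[n _ hn] := cf.
  have /cvgr0_norm_le/(_ _ e2)[m _ hm] := cg.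
  have := nrm_triangle Lf (La (n + m)%N) Lg; rewrite (nrmB f (a _)).
  have := hn (n + m)%N (leq_addr _ _); have := hm (n + m)%N (leq_addl _ _).
  move=> /= /(le_trans (ler_norm _)) h1 /(le_trans (ler_norm _)) h2; lra.
by apply: ae_imply (nrm_eq0 (L2B Lf Lg) n0) _ => x /eqP; rewrite subr_eq0 => /eqP.
Qed.

(** [fourier f] is a choice among all pairs satisfying [is_fourier f]; uniqueness of L^2 limits ties
    it to [U] almost everywhere. *)
Lemma fourier_hart f U : hart f U ->
  [/\ L2 (fourier f).1, L2 (fourier f).2, {ae mu, forall x, (fourier f).1 x = evenp U x} &
      {ae mu, forall x, (fourier f).2 x = - oddp U x}].
Proof.
move=> hU; have [Lf LU cU] := hU; have hF := is_fourier_hart hU.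
have : is_fourier f (fourier f) by apply: getPex; exists (evenp U, fun x => - oddp U x).
move=> [/Lfun2P L1' /Lfun2P L2' c1 c2].
move: hF => [_ _ /= d1 d2].
have Le n : L2 (trunc_fourier f n).1 by rewrite (trunc_fourierE n Lf).1; apply: L2_evenp; exact: L2_ht_cut.
have Lo n : L2 (trunc_fourier f n).2.
  by rewrite (trunc_fourierE n Lf).2; apply: L2N; apply: L2_oddp; exact: L2_ht_cut.
have LeU := L2_evenp LU; have LoU := L2N (L2_oddp LU).
split => //.
- by apply: (L2_lim_unique Le) => //; apply/(cvg_nrmE Le).
- by apply: (L2_lim_unique Lo) => //; apply/(cvg_nrmE Lo).
Qed.

(* wt p xi = (1 + xi^2)^(p/2); Xs s and ns s are H^s and its norm on the Hartley side. *)
Definition wt (p x : R) : R := (1 + x ^+ 2) `^ (p / 2).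
Definition Xs (s : R) U : Prop := L2 (fun x => wt s x * U x).
Definition ns (s : R) U : R := nrm (fun x => wt s x * U x).

Lemma sqr1p_gt0 (x : R) : 0 < 1 + x ^+ 2.
Proof. by rewrite ltr_pwDl// sqr_ge0. Qed.

Lemma sqr1p_ge1 (x : R) : 1 <= 1 + x ^+ 2.
Proof. by rewrite lerDl sqr_ge0. Qed.

Lemma wt_gt0 p x : 0 < wt p x.
Proof. by rewrite powR_gt0// sqr1p_gt0. Qed.

Lemma wt_ge0 p x : 0 <= wt p x. Proof. by rewrite ltW ?wt_gt0. Qed.

Lemma wtD p q x : wt (p + q) x = wt p x * wt q x.
Proof. rewrite /wt mulrDl powRD//; apply/implyP => _.
by rewrite gt_eqF// sqr1p_gt0. Qed.

Lemma wt0 x : wt 0 x = 1. Proof. by rewrite /wt mul0r powRr0. Qed.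

Lemma wtN p x : wt (- p) x * wt p x = 1.
Proof. by rewrite -wtD addNr wt0. Qed.

Lemma wtV p x : wt (- p) x = (wt p x)^-1.
Proof. by rewrite /wt mulNr powRN. Qed.

Lemma wt_opp p x : wt p (- x) = wt p x. Proof. by rewrite /wt sqrrN. Qed.

Lemma sqr_wt p x : wt p x ^+ 2 = (1 + x ^+ 2) `^ p.
Proof. by rewrite expr2 -wtD /wt; congr (_ `^ _); lra. Qed.

Lemma wt2 x : wt 2 x = 1 + x ^+ 2.
Proof. by rewrite /wt divff// powRr1// ltW// sqr1p_gt0. Qed.

Lemma wt_le p q x : p <= q -> wt p x <= wt q x.
Proof. by move=> pq; rewrite /wt ler_powR ?sqr1p_ge1//; lra. Qed.

Lemma wt_le1 p x : p <= 0 -> wt p x <= 1.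
Proof. by move=> /(wt_le x); rewrite wt0. Qed.

Lemma measurable_wt p : measurable_fun setT (wt p).
Proof.
apply: (measurableT_comp (f := fun y : R => y `^ (p / 2))) => //.
exact: measurable_funD.
Qed.

Lemma Xs_meas s U : Xs s U -> measurable_fun setT U.
Proof.
move=> [mU _]; rewrite (_ : U = (fun x => wt (- s) x * (wt s x * U x))).
  by apply: measurable_funM => //; exact: measurable_wt.
by apply/funext => x; rewrite mulrA wtN mul1r.
Qed.

Lemma Xs0 U : Xs 0 U <-> L2 U.
Proof. by rewrite /Xs (_ : (fun x => _) = U)//; apply/funext => x; rewrite wt0 mul1r. Qed.

Lemma ns0 U : ns 0 U = nrm U.
Proof. by rewrite /ns (_ : (fun x => _) = U)//; apply/funext => x; rewrite wt0 mul1r. Qed.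

Lemma Xs_le s r U : r <= s -> Xs s U -> Xs r U /\ ns r U <= ns s U.
Proof.
move=> rs LU; have mU := Xs_meas LU.
have h x : `|wt r x * U x| <= `|wt s x * U x|.
  by rewrite !normrM ler_wpM2r// !ger0_norm ?wt_ge0// wt_le.
have LU' : Xs r U.
  by apply: L2_le (LU) => //; apply: measurable_funM => //; exact: measurable_wt.
by split; [exact: LU'|exact: nrm_le].
Qed.

Lemma Xs_L2 s U : 0 <= s -> Xs s U -> L2 U.
Proof. by move=> s0 /(Xs_le s0)[/Xs0]. Qed.

(** The squares of the even and odd parts add up to the mean of the squares at x and -x. As the
    integral is invariant under reflection, the Sobolev norm becomes [ns s U]. *)
Lemma sobolev_integrand s U x :
  (1 + x ^+ 2) `^ s * (evenp U x ^+ 2 + (- oddp U x) ^+ 2) =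
  2^-1 * ((wt s x * U x) ^+ 2 + (wt s (- x) * U (- x)) ^+ 2).
Proof. by rewrite wt_opp -sqr_wt /evenp /oddp; field. Qed.

Lemma sobolev_normE s f U : hart f U ->
  sobolev_norm s f = ((\int[mu]_x (2^-1 * ((wt s x * U x) ^+ 2 + (wt s (- x) * U (- x)) ^+ 2))%:E) `^ 2^-1)%E.
Proof.
move=> hU; have [_ LU _] := hU; have [[m1 _] [m2 _] e1 e2] := fourier_hart hU.
have mw := measurable_wt s.
have mU := L2_meas LU.
have mwU : measurable_fun setT (fun x => wt s x * U x) by exact: measurable_funM.
rewrite /sobolev_norm; congr (_ `^ _)%E; apply: ae_eq_integral => //.
- apply/measurable_EFinP; apply: measurable_funM.
    by apply: (measurableT_comp (f := fun y : R => y `^ s)) => //; exact: measurable_funD.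
  by apply: measurable_funD; exact: measurable_funX.
- apply/measurable_EFinP; apply: measurable_funM => //.
  apply: measurable_funD; apply: measurable_funX => //.
  by have := measurable_reflect 0 mwU; under eq_fun do rewrite sub0r.
- by apply: (ae_imply2 e1 e2) => x h1 h2 _ /=; rewrite h1 h2 sobolev_integrand.
Qed.

Lemma sobolev_norm_Xs s f U : hart f U -> Xs s U -> sobolev_norm s f = (ns s U)%:E.
Proof.
move=> hU [mU LU]; rewrite (sobolev_normE s hU).
have LUN := L1_opp LU.
rewrite -EFin_I; last by apply: L1Zl; exact: L1D.
rewrite IZl; last exact: L1D.
rewrite ID// (I_opp LU) poweR_EFin /ns /nrm powR12_sqrt.
  by congr (Num.sqrt _)%:E; lra.
by rewrite mulr_ge0// addr_ge0//; apply: I_ge0 => x; exact: sqr_ge0.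
Qed.

Lemma sobolevP s f U : hart f U -> sobolev s f <-> Xs s U.
Proof.
move=> hU; have [Lf LU _] := hU; split=> [[_]|XU]; last first.
  by split; [exact/Lfun2P|rewrite (sobolev_norm_Xs hU XU) ltry].
rewrite (sobolev_normE s hU) => h.
have mwU : measurable_fun setT (fun x => wt s x * U x).
  by apply: measurable_funM; [exact: measurable_wt|exact: L2_meas].
split => //; apply: (@L1_le _ (fun x => 2 * (2^-1 * ((wt s x * U x) ^+ 2 + (wt s (- x) * U (- x)) ^+ 2)))).
- exact: measurable_funX.
- by move=> x; rewrite ger0_norm ?sqr_ge0// mulrA divff// mul1r lerDl sqr_ge0.
apply: L1Zl; apply: L1_lty.
  apply: measurable_funM => //; apply: measurable_funD; apply: measurable_funX => //.
  by have := measurable_reflect 0 mwU; under eq_fun do rewrite sub0r.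
rewrite (@lty_poweRy _ _ 2^-1)//; apply: le_lt_trans h.
under eq_integral => x _ do rewrite ger0_norm ?mulr_ge0 ?addr_ge0 ?sqr_ge0//.
by [].
Qed.

End bridge.

(** * Weighted convolution estimates *)

Section weights.
Context {R : realType}.
Notation mu := (@lebesgue_measure R).
Implicit Types f g V W : R -> R.

Definition wtc (p : R) : R := 4 `^ (p / 2).

Lemma wtc_ge0 p : 0 <= wtc p. Proof. exact: powR_ge0. Qed.

(** |x| is at most twice the larger of |x - y| and |y|; the factor 4 in [wtc] is the square of this
    2. *)
Lemma wt_sum (p x y : R) : 0 <= p -> wt p x <= wtc p * (wt p (x - y) + wt p y).
Proof.
move=> p0.
have h (m : R) : 1 + x ^+ 2 <= 4 * (1 + m ^+ 2) -> wt p x <= wtc p * wt p m.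
  move=> hm; rewrite /wt /wtc -powRM//; last by rewrite ltW// sqr1p_gt0.
  by apply: ge0_ler_powR => //; rewrite ?nnegrE ?mulr_ge0 ?(ltW (sqr1p_gt0 _))// divr_ge0.
have [xy|xy] := leP (y ^+ 2) ((x - y) ^+ 2).
  apply: le_trans (h (x - y) _) _; first by nra.
  by rewrite ler_wpM2l ?wtc_ge0// lerDl wt_ge0.
apply: le_trans (h y _) _; first by nra.
by rewrite ler_wpM2l ?wtc_ge0// lerDr wt_ge0.
Qed.

Lemma powRN_cvg0 (d : R) : 0 < d -> (1 + x) `^ (- d) @[x --> +oo] --> (0 : R).
Proof.
move=> d0; apply/cvgr0Pnorm_le => e e0.
near=> x.
have x0 : 0 < 1 + x.
  have : 0 <= x by near: x; exact: nbhs_pinfty_ge.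
  by lra.
rewrite ger0_norm ?powR_ge0// powRN -[leRHS]invrK lef_pV2 ?posrE ?invr_gt0 ?powR_gt0//.
have -> : e^-1 = (e^-1 `^ d^-1) `^ d.
  by rewrite -powRrM mulVf ?gt_eqF// powRr1// invr_ge0 ltW.
apply: ge0_ler_powR; rewrite ?nnegrE ?powR_ge0 ?(ltW d0) ?(ltW x0)//.
apply: (@le_trans _ _ x); last by lra.
near: x; apply: nbhs_pinfty_ge; exact: num_real.
Unshelve. all: by end_near. Qed.

(** Comparison with (1 + |x|)^(-2p), which has an explicit antiderivative on the half-line. The
    factor 2^p comes from (1 + |x|)^2 <= 2 (1 + x^2). *)
Lemma L1_wtN (p : R) : 1 / 2 < p -> L1 (fun x => wt (- (2 * p)) x).
Proof.
move=> p12.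
pose d := 2 * p - 1; have d0 : 0 < d by rewrite /d; lra.
pose g (x : R) := (1 + `|x|) `^ (- (2 * p)).
have pos (x : R) : 0 <= x -> 0 < 1 + x by lra.
have cg : continuous g.
  move=> x; apply: (@cvg_comp _ _ _ (fun x : R => 1 + `|x|) (fun y : R => y `^ (- (2 * p))) _ (nbhs (1 + `|x|))).
    by apply: cvgD; [exact: cvg_cst|exact: norm_continuous].
  exact: is_derive_cvg (is_derive1_powR _ (pos _ (normr_ge0 x))).
have half : (\int[mu]_(x in `[0%R, +oo[) (g x)%:E = (d^-1)%:E)%E.
  pose F (x : R) := - d^-1 * (1 + x) `^ (- d).
  have dF (x : R) : 0 <= x -> is_derive x 1 F (g x).
    move=> x0; have x1 := pos _ x0.
    have h1 : is_derive x (1 : R) (fun x : R => 1 + x) (1 : R).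
      by rewrite -[X in is_derive _ _ _ X]add0r; apply: (@is_deriveD _ _ _ (cst (1 : R)) id).
    have h := @is_derive1_comp R (fun y : R => y `^ (- d)) (fun x : R => 1 + x) x _ _ (is_derive1_powR (- d) x1) h1.
    rewrite /F; apply: is_derive_eq.
    rewrite /g ger0_norm// /GRing.scale /= (_ : - d - 1 = - (2 * p)); last by rewrite /d; lra.
    by field; rewrite gt_eqF.
  rewrite (@ge0_continuous_FTC2y R g F 0 0).
  - by rewrite /F addr0 powR1 mulr1 -EFinB sub0r opprK.
  - by move=> x _; exact: powR_ge0.
  - exact: continuous_subspaceT.
  - rewrite -(mulr0 (- d^-1)); apply: cvgM; first exact: cvg_cst.
    exact: powRN_cvg0.
  - by move=> x x0; exact: (@ex_derive _ _ _ _ _ _ _ (dF x (ltW x0))).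
  - exact: cvg_at_right_filter (is_derive_cvg (dF 0 (lexx 0))).
  - move=> x; rewrite in_itv/= andbT => x0; rewrite derive1E.
    exact: (@derive_val _ _ _ _ _ _ _ (dF x (ltW x0))).
have [Lg _] := L1_even_half cg (fun x => powR_ge0 _ _) (fun x => congr1 (fun z => (1 + z) `^ (- (2 * p))) (normrN x)) half.
apply: (@L1_le _ (fun x => 2 `^ p * g x)); last exact: L1Zl.
  exact: measurable_wt.
move=> x; rewrite ger0_norm ?wt_ge0// /wt /g.
have -> : - (2 * p) / 2 = - p by lra.
have nx := normr_ge0 x; have x1 := pos _ nx.
rewrite mulrC !powRN ler_pdivlMl; last by rewrite powR_gt0.
rewrite ler_pdivrMr; last by rewrite powR_gt0// sqr1p_gt0.
rewrite powRrM -powRM; [|by []|by rewrite ltW// sqr1p_gt0].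
rewrite powR_mulrn ?(ltW x1)//.
apply: ge0_ler_powR; rewrite ?nnegrE ?sqr_ge0 ?mulr_ge0 ?(ltW (sqr1p_gt0 _))//; first by lra.
by rewrite -[x ^+ 2]real_normK ?num_real//; have := sqr_ge0 (`|x| - 1); nra.
Qed.

Lemma L2_wtN (p : R) : 1 / 2 < p -> L2 (wt (- p)).
Proof.
move=> p12; split; first exact: measurable_wt.
have := L1_wtN p12; congr L1; apply/funext => x.
by rewrite expr2 -wtD; congr wt; lra.
Qed.

Definition kwt (p : R) : R := nrm (fun x : R => wt (- p) x).

(** The Sobolev embedding on the transform side, by Cauchy-Schwarz against the square integrable
    weight [wt (- (p - q))]. *)
Lemma Xs_L1 (p q : R) V : 1 / 2 < p - q -> Xs p V ->
  L1 (fun x => wt q x * V x) /\ I (fun x => `|wt q x * V x|) <= kwt (p - q) * ns p V.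
Proof.
move=> pq XV.
have Lw := L2_wtN pq.
have E : (fun x => wt q x * V x) = (fun x => wt (- (p - q)) x * (wt p x * V x)).
  by apply/funext => x; rewrite mulrA -wtD; congr (wt _ _ * _); lra.
rewrite E; split; first exact: L1M.
apply: le_trans (I_normM_le Lw XV).
apply: eq_ler; congr Rintegral; apply/funext => x.
by rewrite -normrM mulrA -wtD; congr (`|wt _ _ * _|); lra.
Qed.

End weights.

(** * Fubini's theorem when sections are integrable only almost everywhere *)

Section fubini_ae.
Context {R : realType}.
Notation mu := (@lebesgue_measure R).

Lemma L1xy_meas (F : R -> R -> R) : L1xy F -> measurable_fun setT (fun p : R * R => F p.1 p.2).
Proof. by case/integrableP => /measurable_EFinP. Qed.

Lemma L1xy_ae (F : R -> R -> R) : L1xy F -> {ae mu, forall x, L1 (F x)}.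
Proof. by move=> LF; have := ae_integrable1 LF. Qed.

Lemma L1_marginal_ae (F : R -> R -> R) : L1xy F -> L1 (fun x => I (F x)) /\
  (I (fun x => I (F x)))%:E = (\int[mu]_x \int[mu]_y (F x y)%:E)%E.
Proof.
move=> LF; have h := integrable_fubini_F LF.
have ae := L1xy_ae LF.
have m1 : measurable_fun setT (fun x => I (F x)) by apply: measurable_I; exact: L1xy_meas.
have mh : measurable_fun setT (fun x : R => \int[mu]_y (F x y)%:E)%E.
  by case/integrableP: h.
have L : L1 (fun x => I (F x)).
  apply: L1_lty => //; case/integrableP: h => _; apply: le_lt_trans.
  apply: eq_ler; apply: ae_eq_integral => //.
  - by apply/measurable_EFinP; exact: measurableT_comp.
  - exact: measurableT_comp.
  - by apply: (ae_imply ae) => x Lx _ /=; rewrite /fubini_F -EFin_I.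
split => //; rewrite EFin_I//; apply: ae_eq_integral => //.
- by apply/measurable_EFinP.
- by apply: (ae_imply ae) => x Lx _ /=; rewrite -EFin_I.
Qed.

Lemma I_swap_ae (F : R -> R -> R) : L1xy F ->
  I (fun x => I (F x)) = I (fun y => I (F ^~ y)).
Proof.
move=> LF; apply: EFin_inj.
rewrite (L1_marginal_ae LF).2 (L1_marginal_ae (L1xy_swap LF)).2.
exact: (Fubini LF).
Qed.

Lemma L1xy_diff (f g : R -> R) : L1 f -> L1 g -> L1xy (fun x y => f (x - y) * g y).
Proof.
move=> Lf Lg.
have h := L1xy_swap (L1xy_shear (L1xy_prod Lg (L1_opp Lf))).
by move: h; congr L1xy; apply/funext => x; apply/funext => y; rewrite opprB mulrC.
Qed.

End fubini_ae.

(** * Convolutions and Young's inequality *)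

Section convolutions.
Context {R : realType}.
Notation mu := (@lebesgue_measure R).
Notation cv := (@convolution R).
Implicit Types f g V W : R -> R.

Lemma L1_cv f g x : L2 f -> L2 g -> L1 (fun y => f (x - y) * g y).
Proof. by move=> Lf Lg; apply: L1M => //; exact: L2_reflect. Qed.

Lemma cvC f g x : L2 f -> L2 g -> cv f g x = cv g f x.
Proof.
move=> Lf Lg; rewrite /convolution -(I_reflect x (L1_cv x Lf Lg)).
by congr Rintegral; apply/funext => y; rewrite subKr mulrC.
Qed.

Lemma measurable_cv f g : measurable_fun setT f -> measurable_fun setT g -> measurable_fun setT (cv f g).
Proof.
move=> mf mg; apply: (@measurable_I R (fun x y => f (x - y) * g y)).
apply: measurable_funM; last exact: (measurableT_comp mg measurable_snd).
by apply: (measurableT_comp mf); exact: measurable_funB.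
Qed.

Lemma cvDl f1 f2 g x : L2 f1 -> L2 f2 -> L2 g -> cv (fun x => f1 x + f2 x) g x = cv f1 g x + cv f2 g x.
Proof.
move=> L1' L2' Lg; rewrite /convolution -ID; [|exact: L1_cv..].
by congr Rintegral; apply/funext => y; rewrite mulrDl.
Qed.

Lemma cvDr f g1 g2 x : L2 f -> L2 g1 -> L2 g2 -> cv f (fun x => g1 x + g2 x) x = cv f g1 x + cv f g2 x.
Proof.
move=> Lf L1' L2'; rewrite /convolution -ID; [|exact: L1_cv..].
by congr Rintegral; apply/funext => y; rewrite mulrDr.
Qed.

Lemma cvZl k f g x : L2 f -> L2 g -> cv (fun x => k * f x) g x = k * cv f g x.
Proof.
move=> Lf Lg; rewrite /convolution -IZl; last exact: L1_cv.
by congr Rintegral; apply/funext => y; rewrite mulrA.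
Qed.

Lemma cv_norm_le f g f' g' x : L2 f -> L2 g -> L2 f' -> L2 g' ->
  (forall x, `|f x| <= f' x) -> (forall x, `|g x| <= g' x) -> `|cv f g x| <= cv f' g' x.
Proof.
move=> Lf Lg Lf' Lg' ff gg; apply: le_trans (I_norm (L1_cv x Lf Lg)) _.
apply: I_le; [exact: L1_norm (L1_cv x Lf Lg)|exact: L1_cv|].
by move=> y; rewrite normrM; apply: ler_pM.
Qed.

Lemma cv_ge0 f g x : (forall x, 0 <= f x) -> (forall x, 0 <= g x) -> 0 <= cv f g x.
Proof. by move=> f0 g0; apply: I_ge0 => y; rewrite mulr_ge0. Qed.

Lemma cv_le_nrm f g x : L2 f -> L2 g -> `|cv f g x| <= nrm f * nrm g.
Proof.
move=> Lf Lg; apply: le_trans (cauchy_schwarz (L2_reflect x Lf) Lg) _.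
by rewrite nrm_reflect.
Qed.

Lemma L1_cv_L1 f g : L1 f -> L1 g -> L1 (cv f g).
Proof. by move=> Lf Lg; exact: (L1_marginal_ae (L1xy_diff Lf Lg)).1. Qed.

(** Cauchy-Schwarz for the measure f(x - y) dy bounds the square of the convolution of f and g by
    [I f] times the convolution of f and g^2; integrating in x by Fubini's theorem gives the
    result. *)
Lemma young f g : (forall x, 0 <= f x) -> (forall x, 0 <= g x) -> L1 f -> L2 f -> L2 g ->
  L2 (cv f g) /\ nrm (cv f g) <= I f * nrm g.
Proof.
move=> f0 g0 Lf L2f Lg.
have mf := L1_meas Lf; have mg := L2_meas Lg.
have LF := L1xy_diff Lf (L1_sqr Lg).
pose h x := I f * I (fun y => f (x - y) * g y ^+ 2).
have Lh : L1 h by apply: L1Zl; exact: (L1_marginal_ae LF).1.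
have If0 : 0 <= I f by apply: I_ge0.
have key : {ae mu, forall x, cv f g x ^+ 2 <= h x}.
  apply: ae_imply (L1xy_ae LF) _ => x Lx.
  pose a y := Num.sqrt (f (x - y)).
  have La : L2 a.
    split.
      apply: (measurableT_comp (f := @Num.sqrt R)); last exact: measurable_reflect.
      exact: continuous_measurable_fun (@sqrt_continuous R).
    rewrite (_ : (fun _ => _) = (fun y => f (x - y))); first exact: L1_reflect.
    by apply/funext => y; rewrite sqr_sqrtr.
  have Lb : L2 (fun y => a y * g y).
    split; first by apply: measurable_funM => //; exact: L2_meas.
    rewrite (_ : (fun _ => _) = (fun y => f (x - y) * g y ^+ 2))//.
    by apply/funext => y; rewrite exprMn sqr_sqrtr.
  have := cauchy_schwarz La Lb.
  rewrite (_ : (fun y => a y * (a y * g y)) = (fun y => f (x - y) * g y)); last first.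
    by apply/funext => y; rewrite mulrA -expr2 sqr_sqrtr.
  rewrite -/(cv f g x) ger0_norm ?cv_ge0// => le1.
  rewrite -(@ler_sqr _ (cv f g x)) ?nnegrE ?mulr_ge0 ?nrm_ge0 ?cv_ge0// exprMn !sqr_nrm in le1.
  apply: le_trans le1 _; rewrite /h -(I_reflect x Lf).
  apply: eq_ler; congr (_ * _); congr Rintegral; apply/funext => y.
    by rewrite sqr_sqrtr.
  by rewrite exprMn sqr_sqrtr.
have mcv := measurable_cv mf mg.
have Lc : L1 (fun x => cv f g x ^+ 2).
  (* The bound by h holds only almost everywhere. The minimum with h is dominated everywhere, and
     agrees almost everywhere with the square of the convolution. *)
  apply: (@L1_ae _ (fun x => Num.min (cv f g x ^+ 2) (h x))).
  - exact: measurable_funX.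
  - apply: (@L1_le _ h) => //.
      by apply: measurable_minr; [exact: measurable_funX|exact: L1_meas].
    have h0 x : 0 <= h x by rewrite mulr_ge0// I_ge0// => y; rewrite mulr_ge0// sqr_ge0.
    by move=> x; rewrite ger0_norm ?le_min ?sqr_ge0 ?h0// ge_min lexx orbT.
  - by apply: ae_imply key _ => x hx; rewrite min_l.
split; first by split.
rewrite -ler_sqr ?nnegrE ?mulr_ge0 ?nrm_ge0// exprMn !sqr_nrm.
have <- : I h = I f ^+ 2 * I (fun x => g x ^+ 2).
  rewrite /h IZl; last exact: (L1_marginal_ae LF).1.
  rewrite I_swap_ae// expr2 -mulrA; congr (_ * _).
  rewrite -IZl; last exact: L1_sqr.
  congr Rintegral; apply/funext => y; rewrite IZr; last exact: (L1_shift (- y) Lf).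
  by rewrite (I_shift (- y) Lf).
rewrite -lee_fin !EFin_I//; apply: ae_ge0_le_integral => //.
- by move=> x _; rewrite lee_fin sqr_ge0.
- by apply/measurable_EFinP; exact: L1_meas.
- by move=> x _; rewrite lee_fin mulr_ge0// I_ge0// => y; rewrite mulr_ge0// sqr_ge0.
- by apply/measurable_EFinP; exact: L1_meas.
- by apply: ae_imply key _ => x hx _; rewrite lee_fin.
Qed.

Lemma young_r f g : (forall x, 0 <= f x) -> (forall x, 0 <= g x) -> L2 f -> L1 g -> L2 g ->
  L2 (cv f g) /\ nrm (cv f g) <= nrm f * I g.
Proof.
move=> f0 g0 Lf Lg L2g; have [h1 h2] := young g0 f0 Lg L2g Lf.
have E : cv f g = cv g f by apply/funext => x; exact: cvC.
by rewrite E mulrC.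
Qed.

Lemma wt_cv_le p f g x : 0 <= p -> (forall x, 0 <= f x) -> (forall x, 0 <= g x) ->
  L2 f -> L2 g -> Xs p f -> Xs p g ->
  wt p x * cv f g x <= wtc p * (cv (fun x => wt p x * f x) g x + cv f (fun x => wt p x * g x) x).
Proof.
move=> p0 f0 g0 Lf Lg Xf Xg.
rewrite /convolution -IZl; last exact: L1_cv.
rewrite -ID; [|exact: (L1_cv x Xf Lg)|exact: (L1_cv x Lf Xg)].
rewrite -IZl; last by apply: L1D; [exact: (L1_cv x Xf Lg)|exact: (L1_cv x Lf Xg)].
apply: I_le.
- by apply: L1Zl; exact: L1_cv.
- by apply: L1Zl; apply: L1D; [exact: (L1_cv x Xf Lg)|exact: (L1_cv x Lf Xg)].
move=> y; have fg : 0 <= f (x - y) * g y by rewrite mulr_ge0.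
have := ler_wpM2r fg (wt_sum x y p0).
by move/le_trans; apply; apply: eq_ler; ring.
Qed.

End convolutions.

(** * The product of two functions on the Hartley side *)

Section star.
Context {R : realType}.
Notation mu := (@lebesgue_measure R).
Notation cv := (@convolution R).
Implicit Types f g U V W : R -> R.

(* dt and star are the derivative and the product on the Hartley side. *)
Definition tld V (x : R) := V (- x).
Definition dt V (x : R) := - x * V (- x).
Definition sy V (x : R) := `|V x| + `|V (- x)|.
Definition c0 : R := (4 * pi)^-1.
Definition star V W (x : R) :=
  c0 * (cv V W x + cv V (tld W) x + cv (tld V) W x - cv (tld V) (tld W) x).

Lemma c0_ge0 : 0 <= c0. Proof. by rewrite invr_ge0 mulr_ge0// ltW// pi_gt0. Qed.

Lemma Xs_dom p U G : measurable_fun setT U -> (forall x, `|wt p x * U x| <= G x) -> L2 G ->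
  Xs p U /\ ns p U <= nrm G.
Proof.
move=> mU UG LG.
have h x : `|wt p x * U x| <= `|G x| by apply: le_trans (UG x) (ler_norm _).
have LU : Xs p U.
  by apply: L2_le LG => //; apply: measurable_funM => //; exact: measurable_wt.
by split; [exact: LU|exact: nrm_le].
Qed.

Lemma measurable_tld V : measurable_fun setT V -> measurable_fun setT (tld V).
Proof. by move=> mV; have := measurable_reflect 0 mV; under eq_fun do rewrite sub0r. Qed.

Lemma Xs_tld p V : Xs p V -> Xs p (tld V).
Proof. by move=> /L2_opp; under eq_fun do rewrite wt_opp. Qed.

Lemma ns_tld p V : Xs p V -> ns p (tld V) = ns p V.
Proof.
by move=> XV; rewrite -[RHS](nrm_opp XV); congr nrm; apply/funext => x; rewrite wt_opp.
Qed.

Lemma XsD p V W : Xs p V -> Xs p W -> Xs p (fun x => V x + W x).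
Proof.
move=> XV XW; have := L2D XV XW; congr L2; apply/funext => x; ring.
Qed.

Lemma XsZ p k V : Xs p V -> Xs p (fun x => k * V x).
Proof. move=> XV; have := L2Zl k XV; congr L2; apply/funext => x; ring. Qed.

Lemma XsB p V W : Xs p V -> Xs p W -> Xs p (fun x => V x - W x).
Proof. move=> XV XW; have := L2B XV XW; congr L2; apply/funext => x; ring. Qed.

Lemma nsD p V W : Xs p V -> Xs p W -> ns p (fun x => V x + W x) <= ns p V + ns p W.
Proof.
move=> XV XW; apply: le_trans (nrmD_le XV XW).
by apply: eq_ler; congr nrm; apply/funext => x; ring.
Qed.

Lemma nsB p V W : Xs p V -> Xs p W -> ns p (fun x => V x - W x) <= ns p V + ns p W.
Proof.
move=> XV XW; apply: le_trans (nrmB_le XV XW).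
by apply: eq_ler; congr nrm; apply/funext => x; ring.
Qed.

Lemma nsZ p k V : Xs p V -> ns p (fun x => k * V x) = `|k| * ns p V.
Proof.
move=> XV; rewrite -(nrmZ k XV); congr nrm; apply/funext => x; ring.
Qed.

Lemma ns_ge0 p V : 0 <= ns p V. Proof. exact: nrm_ge0. Qed.

Lemma Xs_norm p V : Xs p V -> Xs p (fun x => `|V x|) /\ ns p (fun x => `|V x|) = ns p V.
Proof.
move=> XV; have E : (fun x => wt p x * `|V x|) = (fun x => `|wt p x * V x|).
  by apply/funext => x; rewrite normrM (ger0_norm (wt_ge0 _ _)).
split; first by rewrite /Xs E; exact: L2_norm.
by rewrite /ns E nrm_norm.
Qed.

Lemma Xs_sy p V : Xs p V -> Xs p (sy V) /\ ns p (sy V) <= 2 * ns p V.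
Proof.
move=> XV; have [X1 N1] := Xs_norm XV; have [X2 N2] := Xs_norm (Xs_tld XV).
split; first exact: XsD X1 X2.
by apply: le_trans (nsD X1 X2) _; rewrite N1 N2 ns_tld//; lra.
Qed.

Lemma sy_ge0 V x : 0 <= sy V x. Proof. exact: addr_ge0. Qed.

Lemma wt1_ge (x : R) : `|x| <= wt 1 x.
Proof.
rewrite -ler_sqr ?nnegrE ?wt_ge0// real_normK ?num_real// sqr_wt powRr1 ?lerDr//.
by rewrite ltW// sqr1p_gt0.
Qed.

Lemma measurable_dt V : measurable_fun setT V -> measurable_fun setT (dt V).
Proof.
by move=> mV; apply: measurable_funM; [exact: measurable_funN|exact: measurable_tld].
Qed.

Lemma dt_le p V x : `|wt p x * dt V x| <= `|wt (p + 1) (- x) * V (- x)|.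
Proof.
rewrite /dt !normrM normrN !(ger0_norm (wt_ge0 _ _)) mulrA ler_wpM2r//.
by rewrite wt_opp wtD ler_wpM2l ?wt_ge0// wt1_ge.
Qed.

Lemma Xs_dt p V : Xs (p + 1) V -> Xs p (dt V) /\ ns p (dt V) <= ns (p + 1) V.
Proof.
move=> XV; have LV := L2_opp XV.
have [X1 N1] := Xs_dom (measurable_dt (Xs_meas XV)) (dt_le p V) (L2_norm LV).
by split => //; apply: le_trans N1 _; rewrite nrm_norm (nrm_opp XV).
Qed.

Lemma L2_tld V : L2 V -> L2 (tld V). Proof. exact: L2_opp. Qed.
Lemma L1_tld V : L1 V -> L1 (tld V). Proof. exact: L1_opp. Qed.

(** Expanding the convolution of [sy V] and [sy W] yields the four convolutions of absolute values
    and reflections that occur in [star]. All estimates are made on this nonnegative majorant. *)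
Lemma star_le V W x : L2 V -> L2 W -> `|star V W x| <= c0 * cv (sy V) (sy W) x.
Proof.
move=> LV LW; rewrite /star normrM (ger0_norm c0_ge0) ler_wpM2l ?c0_ge0//.
have [a1 a2] := (L2_norm LV, L2_norm LW).
have [b1 b2] := (L2_norm (L2_tld LV), L2_norm (L2_tld LW)).
rewrite (cvDl _ a1 b1 (L2D a2 b2)) (cvDr _ a1 a2 b2) (cvDr _ b1 a2 b2).
have h f g : L2 f -> L2 g -> `|cv f g x| <= cv (fun x => `|f x|) (fun x => `|g x|) x.
  by move=> Lf Lg; apply: cv_norm_le => //; exact: L2_norm.
have := h V W LV LW; have := h _ _ LV (L2_tld LW).
have := h _ _ (L2_tld LV) LW; have := h _ _ (L2_tld LV) (L2_tld LW).
set A := cv V W x; set B := cv V (tld W) x; set C := cv (tld V) W x; set D := cv (tld V) (tld W) x.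
move=> h4 h3 h2 h1.
apply: le_trans (ler_normB _ _) _; rewrite !addrA.
apply: le_trans (lerD (le_trans (ler_normD _ _) (lerD (ler_normD _ _) (lexx _))) (lexx _)) _.
move: h1 h2 h3 h4; rewrite /tld; lra.
Qed.

Lemma measurable_star V W : measurable_fun setT V -> measurable_fun setT W ->
  measurable_fun setT (star V W).
Proof.
move=> mV mW; have [tV tW] := (measurable_tld mV, measurable_tld mW).
apply: measurable_funM => //; apply: measurable_funB; last exact: measurable_cv.
by apply: measurable_funD; [apply: measurable_funD|]; exact: measurable_cv.
Qed.

Lemma starDl V V' W x : L2 V -> L2 V' -> L2 W ->
  star (fun x => V x + V' x) W x = star V W x + star V' W x.
Proof.
move=> L L' LW; have [[t t'] tW] := (L2_tld L, L2_tld L', L2_tld LW).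
rewrite /star (cvDl x L L' LW) (cvDl x L L' tW).
rewrite (cvDl x t t' LW : cv (tld (fun x => V x + V' x)) W x = _).
rewrite (cvDl x t t' tW : cv (tld (fun x => V x + V' x)) (tld W) x = _).
by rewrite -mulrDr; congr (_ * _); ring.
Qed.

Lemma starZl k V W x : L2 V -> L2 W ->
  star (fun x => k * V x) W x = k * star V W x.
Proof.
move=> L LW; have [t tW] := (L2_tld L, L2_tld LW).
rewrite /star (cvZl k x L LW) (cvZl k x L tW).
rewrite (cvZl k x t LW : cv (tld (fun x => k * V x)) W x = _).
rewrite (cvZl k x t tW : cv (tld (fun x => k * V x)) (tld W) x = _).
by rewrite mulrCA; congr (_ * _); ring.
Qed.

Lemma starC V W x : L2 V -> L2 W -> star V W x = star W V x.
Proof.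
move=> LV LW; have [tV tW] := (L2_tld LV, L2_tld LW).
rewrite /star (cvC x LV LW) (cvC x LV tW) (cvC x tV LW) (cvC x tV tW).
by congr (_ * _); ring.
Qed.

Lemma starBl V V' W x : L2 V -> L2 V' -> L2 W ->
  star (fun x => V x - V' x) W x = star V W x - star V' W x.
Proof.
move=> L L' LW; have LN := L2Zl (-1) L'.
rewrite (_ : (fun x => V x - V' x) = (fun x => V x + (-1) * V' x)); last first.
  by apply/funext => y; rewrite mulN1r.
by rewrite starDl// starZl// mulN1r.
Qed.

Lemma L1_star V W : L1 V -> L1 W -> L1 (star V W).
Proof.
move=> LV LW; have [tV tW] := (L1_tld LV, L1_tld LW).
by apply: L1Zl; apply: L1B; [apply: L1D; [apply: L1D|]|]; exact: L1_cv_L1.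
Qed.

Definition ct V (x : R) := I (fun y => V y * cos (y * x)).
Definition st V (x : R) := I (fun y => V y * sin (y * x)).

Lemma htE V x : L1 V -> ht V x = ct V x + st V x.
Proof.
move=> LV; rewrite /ct /st -ID; [|exact: L1_cos|exact: L1_sin].
by congr Rintegral; apply/funext => y; rewrite /cas (mulrC x) mulrDr.
Qed.

Lemma ct_tld V x : L1 V -> ct (tld V) x = ct V x.
Proof.
move=> LV; rewrite /ct -(I_opp (L1_cos x LV)).
by congr Rintegral; apply/funext => y; rewrite mulNr cosN.
Qed.

Lemma st_tld V x : L1 V -> st (tld V) x = - st V x.
Proof.
move=> LV; rewrite /st -(I_opp (L1_sin x LV)) -IN; last first.
  by have := L1_opp (L1_sin x LV).
by congr Rintegral; apply/funext => y; rewrite mulNr sinN mulrN opprK.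
Qed.

Lemma ht_cv V W x : L1 V -> L1 W ->
  ht (cv V W) x = ct V x * ct W x - st V x * st W x + st V x * ct W x + ct V x * st W x.
Proof.
move=> LV LW.
have [mV mW] := (L1_meas LV, L1_meas LW).
pose F (z y : R) := V (z - y) * W y * cas (x * z).
have LF : L1xy F.
  apply: (@L1xy_le R (fun z y => 2 * (`|V (z - y)| * `|W y|))).
  - apply: measurable_funM; last exact: (measurableT_comp (measurable_casr x) measurable_fst).
    apply: measurable_funM; last exact: (measurableT_comp mW measurable_snd).
    by apply: (measurableT_comp mV); exact: measurable_funB.
  - move=> z y; rewrite /F !normrM mulrC ler_wpM2r ?mulr_ge0//; exact: cas_le2.
  - have := L1xy_diff (L1Zl 2 (L1_norm LV)) (L1_norm LW).
    by congr L1xy; apply/funext => z; apply/funext => y; rewrite mulrA.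
have aeL := L1xy_ae (L1xy_diff LV LW).
transitivity (I (fun z => I (F z))).
  apply: I_ae.
  - by apply: L1_meas; apply: L1_cas; exact: L1_cv_L1.
  - exact: L1_meas (L1_marginal_ae LF).1.
  - apply: ae_imply aeL _ => z Lz; rewrite /convolution -IZr//.
rewrite I_swap_ae//.
set cV := ct V x; set sV := st V x.
transitivity (I (fun y => W y * (cV * cos (y * x) - sV * sin (y * x) + sV * cos (y * x) + cV * sin (y * x)))).
  congr Rintegral; apply/funext => y.
  have Lt (t : R -> R) : continuous t -> (forall x, `|t x| <= 1) -> L1 (fun z => V z * t (z * x)).
    move=> ct' t1; apply: (L1M_bounded LV (C := 1)) => //.
    by under eq_fun do rewrite mulrC; exact: measurable_trigM.
  have Lc := Lt _ (@continuous_cos R) norm_cos_le1.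
  have Ls := Lt _ (@continuous_sin R) norm_sin_le1.
  have LFy : L1 (fun z => V z * W y * cas (x * (z + y))).
    apply: L1M_bounded; [exact: L1Zr|by apply: (measurableT_comp (measurable_casr x)); exact: measurable_funD|by move=> z; exact: cas_le2].
  transitivity (I (fun z => V z * W y * cas (x * (z + y)))).
    rewrite -(I_shift (- y) LFy); congr Rintegral; apply/funext => z.
    by rewrite /F subrK.
  rewrite /cV /sV /ct /st -!IZr// -IB; [|exact: L1Zr..].
  rewrite -ID; [|apply: L1B; exact: L1Zr|exact: L1Zr].
  rewrite -ID; [|apply: L1D; [apply: L1B; exact: L1Zr|exact: L1Zr]|exact: L1Zr].
  rewrite -IZl; last by apply: L1D; [apply: L1D; [apply: L1B|]|]; exact: L1Zr.
  congr Rintegral; apply/funext => z.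
  by rewrite /cas (mulrC x) mulrDl cosD sinD; ring.
clearbody cV sV; have [Lc Ls] := (L1_cos x LW, L1_sin x LW).
rewrite /ct /st -!IZl//.
rewrite -IB; [|exact: L1Zl..].
rewrite -ID; [|apply: L1B; exact: L1Zl|exact: L1Zl].
rewrite -ID; [|apply: L1D; [apply: L1B; exact: L1Zl|exact: L1Zl]|exact: L1Zl].
by congr Rintegral; apply/funext => z; ring.
Qed.

(** This explains the formula of [star]. With c, s and c', s' the cosine and sine transforms of V
    and W, [cv V W] has transform c c' - s s' + s c' + c s', and a reflection changes the sign of
    the corresponding sine transform. The signs +, +, +, - combine the four convolutions into 2 (c +
    s) (c' + s'). *)
Lemma ht_star V W x : L1 V -> L1 W -> ht (star V W) x = (2 * pi)^-1 * (ht V x * ht W x).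
Proof.
move=> LV LW; have [tV tW] := (L1_tld LV, L1_tld LW).
have [L1' L2'] := (L1_cv_L1 LV LW, L1_cv_L1 LV tW).
have [L3 L4] := (L1_cv_L1 tV LW, L1_cv_L1 tV tW).
rewrite /star htZ; last by apply: L1B => //; apply: L1D => //; exact: L1D.
rewrite (htB x (L1D (L1D L1' L2') L3) L4) (htD x (L1D L1' L2') L3) (htD x L1' L2').
rewrite !ht_cv// !ct_tld// !st_tld// !htE//.
have p0 : (pi : R) != 0 by rewrite gt_eqF// pi_gt0.
have aux (p a b c d : R) : p != 0 -> (4 * p)^-1 * (a * c - b * d + b * c + a * d +
   (a * c - b * - d + b * c + a * - d) + (a * c - - b * d + - b * c + a * d) -
   (a * c - - b * - d + - b * c + a * - d)) = (2 * p)^-1 * ((a + b) * (c + d)).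
  by move=> pp; field.
exact: aux.
Qed.

Lemma iht_star V W x : L1 V -> L1 W -> iht (star V W) x = iht V x * iht W x.
Proof.
by move=> LV LW; rewrite /iht ht_star//; ring.
Qed.

End star.

Lemma convolutionE {R : realType} (f g : R -> R) x :
  convolution f g x = I (fun y => f (x - y) * g y).
Proof. by []. Qed.

(* Without this, failing conversion tests unfold the integrals and do not end. *)
Opaque Rintegral nrm wt convolution star kwt wtc c0.

(** * The nonlinearity *)

Section nonlinearity.
Context {R : realType}.
Notation mu := (@lebesgue_measure R).
Notation cv := (@convolution R).
Implicit Types f g U V W Z : R -> R.

Lemma sy_L1 p q V : 1 / 2 < p - q -> Xs p V ->
  L1 (fun x => wt q x * sy V x) /\ I (fun x => wt q x * sy V x) <= kwt (p - q) * (2 * ns p V).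
Proof.
move=> pq XV; have [X N] := Xs_sy XV; have [L IL] := Xs_L1 pq X; split => //.
apply: le_trans (ler_norm _) _; apply: le_trans (I_norm L) _; apply: le_trans IL _.
by rewrite ler_wpM2l ?nrm_ge0.
Qed.

Lemma kwt_ge0 p : 0 <= kwt p :> R. Proof. exact: nrm_ge0. Qed.

Lemma wt0E V : (fun x => wt 0 x * V x) = V.
Proof. by apply/funext => x; rewrite wt0 mul1r. Qed.

Lemma star_sy_bound p V W G (C : R) : (forall x, wt p x * cv (sy V) (sy W) x <= G x) ->
  L2 V -> L2 W -> L2 G -> nrm G <= C -> Xs p (star V W) /\ ns p (star V W) <= c0 * C.
Proof.
move=> hG LV LW LG GC.
have hx x : `|wt p x * star V W x| <= c0 * G x.
  rewrite normrM (ger0_norm (wt_ge0 _ _)).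
  apply: le_trans (ler_wpM2l (wt_ge0 _ _) (star_le x LV LW)) _.
  by rewrite mulrCA ler_wpM2l ?c0_ge0.
have [X N] := Xs_dom (measurable_star (L2_meas LV) (L2_meas LW)) hx (L2Zl c0 LG).
split => //; apply: le_trans N _; rewrite nrmZ// (ger0_norm c0_ge0).
by rewrite ler_wpM2l ?c0_ge0.
Qed.

Lemma nrm_sum2 (k A C : R) f g : 0 <= k -> L2 f /\ nrm f <= A -> L2 g /\ nrm g <= C ->
  L2 (fun x => k * (f x + g x)) /\ nrm (fun x => k * (f x + g x)) <= k * (A + C).
Proof.
move=> k0 [Lf fA] [Lg gC]; split; first by apply: L2Zl; exact: L2D.
rewrite nrmZ; last exact: L2D.
rewrite ger0_norm// ler_wpM2l//; apply: le_trans (nrmD_le Lf Lg) _; exact: lerD.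
Qed.

Lemma wsy_ge0 p V x : 0 <= wt p x * sy V x.
Proof. by rewrite mulr_ge0 ?wt_ge0 ?sy_ge0. Qed.

Lemma bound_trans (P : Prop) (a b c : R) : P /\ a <= b -> b <= c -> P /\ a <= c.
Proof. by move=> [? ab] bc; split => //; exact: le_trans ab bc. Qed.

(** The weight falls on one factor, kept in L^2, while the other is measured in L^1 and thus in H^1.
    That no product of two s-norms appears is what makes the estimate tame. *)
Lemma star_high (s : R) V W : 1 <= s -> Xs s V -> Xs s W ->
  Xs s (star V W) /\ ns s (star V W) <=
    c0 * (wtc s * (2 * ns s V * (kwt 1 * (2 * ns 1 W)) + kwt 1 * (2 * ns 1 V) * (2 * ns s W))).
Proof.
move=> s1 XV XW; have s0 : 0 <= s by lra.
have [X1V _] := Xs_le s1 XV; have [X1W _] := Xs_le s1 XW.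
have [LV LW] := (Xs_L2 s0 XV, Xs_L2 s0 XW).
have k1 : (1 : R) / 2 < 1 - 0 by lra.
have [Lf If] := sy_L1 k1 X1V; have [Lg Ig] := sy_L1 k1 X1W.
rewrite !wt0E subr0 in Lf If Lg Ig.
have [Xf Nf] := Xs_sy XV; have [Xg Ng] := Xs_sy XW.
have [L2f L2g] := (Xs_L2 s0 Xf, Xs_L2 s0 Xg).
have [f0 g0] := (sy_ge0 V, sy_ge0 W).
have H1 := young_r (wsy_ge0 s V) g0 Xf Lg L2g.
have H2 := young f0 (wsy_ge0 s W) Lf L2f Xg.
have b1 : ns s (sy V) * I (sy W) <= 2 * ns s V * (kwt 1 * (2 * ns 1 W)).
  exact: (ler_pM (nrm_ge0 _) (I_ge0 g0) Nf Ig).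
have b2 : I (sy V) * ns s (sy W) <= kwt 1 * (2 * ns 1 V) * (2 * ns s W).
  exact: (ler_pM (I_ge0 f0) (nrm_ge0 _) If Ng).
have [LG NG] := nrm_sum2 (wtc_ge0 s) (bound_trans H1 b1) (bound_trans H2 b2).
apply: (star_sy_bound _ LV LW LG NG) => x.
exact: (wt_cv_le x s0 f0 g0 L2f L2g Xf Xg).
Qed.

(** Here the weighted factor is measured in L^1 and the other in L^2. It is meant for u_x^2 with p =
    s - 1: the L^2 norm of a derivative costs only the H^1 norm. *)
Lemma star_low (p r : R) V W : 0 <= r -> 1 / 2 < p - r -> Xs p V -> Xs p W ->
  Xs r (star V W) /\ ns r (star V W) <=
    c0 * (wtc r * (kwt (p - r) * (2 * ns p V) * (2 * ns 0 W) + 2 * ns 0 V * (kwt (p - r) * (2 * ns p W)))).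
Proof.
move=> r0 pr XV XW; have p0 : 0 <= p by lra. have rp : r <= p by lra.
have [LV LW] := (Xs_L2 p0 XV, Xs_L2 p0 XW).
have [Lf If] := sy_L1 pr XV; have [Lg Ig] := sy_L1 pr XW.
have [XrV _] := Xs_le rp XV; have [XrW _] := Xs_le rp XW.
have [Xf _] := Xs_sy XrV; have [Xg _] := Xs_sy XrW.
have [X0f Nf] := Xs_sy ((Xs0 V).2 LV); have [X0g Ng] := Xs_sy ((Xs0 W).2 LW).
rewrite ns0 in Nf; rewrite ns0 in Ng.
have [L2f L2g] := (Xs_L2 (lexx 0) X0f, Xs_L2 (lexx 0) X0g).
have [f0 g0] := (sy_ge0 V, sy_ge0 W).
have H1 := young (wsy_ge0 r V) g0 Lf Xf L2g.
have H2 := young_r f0 (wsy_ge0 r W) L2f Lg Xg.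
have b1 : I (fun x => wt r x * sy V x) * nrm (sy W) <= kwt (p - r) * (2 * ns p V) * (2 * ns 0 W).
  exact: (ler_pM (I_ge0 (wsy_ge0 r V)) (nrm_ge0 _) If Ng).
have b2 : nrm (sy V) * I (fun x => wt r x * sy W x) <= 2 * ns 0 V * (kwt (p - r) * (2 * ns p W)).
  exact: (ler_pM (nrm_ge0 _) (I_ge0 (wsy_ge0 r W)) Nf Ig).
have [LG NG] := nrm_sum2 (wtc_ge0 r) (bound_trans H1 b1) (bound_trans H2 b2).
apply: (star_sy_bound _ LV LW LG NG) => x.
exact: (wt_cv_le x r0 f0 g0 L2f L2g Xf Xg).
Qed.

(** Asymmetric on purpose: the weak norm is on V, the strong one on W. In the uniqueness proof V is
    a difference of two solutions, W one of them. *)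
Lemma star_mixed (p r : R) V W : 0 <= r -> 1 / 2 < p - r -> Xs p V -> Xs p W ->
  Xs r (star V W) /\ ns r (star V W) <=
    c0 * (wtc r * (2 * ns r V * (kwt p * (2 * ns p W)) + 2 * ns r V * (kwt (p - r) * (2 * ns p W)))).
Proof.
move=> r0 pr XV XW; have p0 : 0 <= p by lra. have rp : r <= p by lra.
have pr0 : 1 / 2 < p - 0 by lra.
have [LV LW] := (Xs_L2 p0 XV, Xs_L2 p0 XW).
have [Lg Ig] := sy_L1 pr XW; have [Lg0 Ig0] := sy_L1 pr0 XW.
rewrite !wt0E subr0 in Lg0 Ig0.
have [XrV _] := Xs_le rp XV; have [XrW _] := Xs_le rp XW.
have [Xf Nf] := Xs_sy XrV; have [Xg _] := Xs_sy XrW.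
have [L2f L2g] := (Xs_L2 r0 Xf, Xs_L2 r0 Xg).
have [f0 g0] := (sy_ge0 V, sy_ge0 W).
have N0f : nrm (sy V) <= 2 * ns r V.
  by rewrite -ns0; apply: le_trans Nf; exact: (Xs_le r0 Xf).2.
have H1 := young_r (wsy_ge0 r V) g0 Xf Lg0 L2g.
have H2 := young_r f0 (wsy_ge0 r W) L2f Lg Xg.
have b1 : ns r (sy V) * I (sy W) <= 2 * ns r V * (kwt p * (2 * ns p W)).
  exact: (ler_pM (nrm_ge0 _) (I_ge0 g0) Nf Ig0).
have b2 : nrm (sy V) * I (fun x => wt r x * sy W x) <= 2 * ns r V * (kwt (p - r) * (2 * ns p W)).
  exact: (ler_pM (nrm_ge0 _) (I_ge0 (wsy_ge0 r W)) N0f Ig).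
have [LG NG] := nrm_sum2 (wtc_ge0 r) (bound_trans H1 b1) (bound_trans H2 b2).
apply: (star_sy_bound _ LV LW LG NG) => x.
exact: (wt_cv_le x r0 f0 g0 L2f L2g Xf Xg).
Qed.

(* The low regularity is compensated by the smoothing factor wt (-2) of the
   Helmholtz kernel. *)
Lemma star_negative (p : R) V W : 1 / 2 < p -> Xs p V -> Xs p W ->
  Xs (- (3 / 2)) (star V W) /\ ns (- (3 / 2)) (star V W) <=
    c0 * (wtc (1 / 2) * (2 * ns (- (1 / 2)) V * (kwt p * (2 * ns p W)) + 2 * ns (- (1 / 2)) V * (2 * ns p W) * kwt (3 / 2))).
Proof.
move=> p12 XV XW; have p0 : 0 <= p by lra.
have pr0 : 1 / 2 < p - 0 by lra.
have h0 : 0 <= (1 : R) / 2 by lra.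
have k32 : (1 : R) / 2 < 3 / 2 by lra.
have w1 : - (3 / 2) + (1 / 2) <= 0 :> R by lra.
have hp : 1 / 2 <= p by lra. have np : - (1 / 2) <= p by lra.
have [LV LW] := (Xs_L2 p0 XV, Xs_L2 p0 XW).
have [Lg Ig] := sy_L1 pr0 XW; rewrite !wt0E subr0 in Lg Ig.
have [XhW NhW] := Xs_le hp XW; have [XnV _] := Xs_le np XV.
have [Xf Nf] := Xs_sy XnV; have [Xg Ng] := Xs_sy XhW.
have [L2f _] := Xs_sy XV; have {}L2f := Xs_L2 p0 L2f.
have L2g := Xs_L2 h0 Xg.
pose f' := fun x => wt (- (1 / 2)) x * sy V x.
have f'0 x : 0 <= f' x by exact: wsy_ge0.
have g0 := sy_ge0 W.
have H1 := young_r f'0 g0 Xf Lg L2g.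
pose K := nrm f' * ns (1 / 2) (sy W).
have K0 : 0 <= K by exact: (mulr_ge0 (nrm_ge0 _) (nrm_ge0 _)).
have Lw := L2_wtN k32.
have H2 : L2 (fun x => K * wt (- (3 / 2)) x) /\ nrm (fun x => K * wt (- (3 / 2)) x) <= K * kwt (3 / 2).
  split; first exact: L2Zl.
  by rewrite (nrmZ K Lw) (ger0_norm K0); exact: lexx.
have b1 : nrm f' * I (sy W) <= 2 * ns (- (1 / 2)) V * (kwt p * (2 * ns p W)).
  exact: (ler_pM (nrm_ge0 _) (I_ge0 g0) Nf Ig).
have b2 : K * kwt (3 / 2) <= 2 * ns (- (1 / 2)) V * (2 * ns p W) * kwt (3 / 2).
  apply: (ler_wpM2r (kwt_ge0 _)); apply: (ler_pM (nrm_ge0 _) (nrm_ge0 _) Nf).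
  apply: (le_trans Ng); exact: (ler_wpM2l (ler0n _ 2) NhW).
have [LG NG] := nrm_sum2 (wtc_ge0 (1 / 2)) (bound_trans H1 b1) (bound_trans H2 b2).
apply: (star_sy_bound _ LV LW LG NG) => x.
have e1 : wt (- (3 / 2)) x * wt (1 / 2) x <= 1 by rewrite -wtD; exact: wt_le1.
clear NG LG b1 b2 H1 H2 Ig Nf Ng NhW hp np k32 w1.
(* V belongs to the weighted space of order -1/2, and [wt (1 / 2) (x - y)] compensates for its
   weight. Splitting this factor between x and y gives a term absorbed by the outer weight, and a
   convolution of two L^2 functions, which is bounded; the outer [wt (- (3 / 2))] is itself in
   L^2. *)
have step : cv (sy V) (sy W) x <= wtc (1 / 2) * (wt (1 / 2) x * cv f' (sy W) x +
    cv f' (fun y => wt (1 / 2) y * sy W y) x).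
  have [l1 l2] := (L1_cv x Xf L2g, L1_cv x Xf Xg).
  rewrite !convolutionE -(IZl _ l1) -(ID (L1Zl _ l1) l2).
  rewrite -(IZl _ (L1D (L1Zl _ l1) l2)).
  apply: I_le; [exact: (L1_cv x L2f L2g)|exact: (L1Zl _ (L1D (L1Zl _ l1) l2))|].
  move=> y.
  have -> : sy V (x - y) * sy W y = wt (1 / 2) (x - y) * (f' (x - y) * sy W y).
    by rewrite /f' !mulrA -wtD subrr wt0 mul1r.
  have fg : 0 <= f' (x - y) * sy W y by exact: mulr_ge0.
  have := ler_wpM2r fg (wt_sum (x - y) (- y) h0).
  rewrite opprK subrK wt_opp /f'.
  move/le_trans; apply; apply: eq_ler; ring.
apply: le_trans (ler_wpM2l (wt_ge0 _ _) step) _.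
rewrite mulrCA; apply: (ler_wpM2l (wtc_ge0 _)); rewrite mulrDr; apply: lerD.
  rewrite mulrA; exact: (ler_piMl (cv_ge0 x f'0 g0) e1).
rewrite mulrC; apply: (ler_wpM2r (wt_ge0 _ _)).
apply: le_trans (ler_norm _) _; exact: (cv_le_nrm x Xf Xg).
Qed.

(* With u the inverse transform of U, the inverse transform of nl l1 l5 U U is u_t. *)
Definition nl (l1 l5 : R) V W (x : R) : R :=
  l1 * (wt (-2) x * star V W x - star V W x)
  + 2 * l1 * (wt (-2) x * star (dt V) (dt W) x)
  - l5 * (wt (-2) x * dt (star V W) x).

Lemma wtm2_le1 (x : R) : `|wt (-2) x| <= 1.
Proof. by rewrite ger0_norm ?wt_ge0// wt_le1//; lra. Qed.

Lemma smooth_le p V : Xs p V -> Xs p (fun x => wt (-2) x * V x) /\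
  ns p (fun x => wt (-2) x * V x) <= ns p V.
Proof.
move=> XV; rewrite -[leRHS]nrm_norm; apply: Xs_dom; last exact: L2_norm.
  by apply: measurable_funM; [exact: measurable_wt|exact: Xs_meas XV].
by move=> x; rewrite mulrCA normrM ler_piMl// wtm2_le1.
Qed.

Lemma smooth_dt_le p V : Xs p V -> Xs p (fun x => wt (-2) x * dt V x) /\
  ns p (fun x => wt (-2) x * dt V x) <= ns p V.
Proof.
move=> XV; have N := nrm_opp XV; rewrite -/(ns p V) in N; rewrite -N -[leRHS]nrm_norm.
apply: Xs_dom; last by apply: L2_norm; exact: (L2_opp XV).
  by apply: measurable_funM; [exact: measurable_wt|apply: measurable_dt; exact: Xs_meas XV].
move=> x; rewrite wt_opp /dt.
rewrite (_ : wt p x * _ = (wt (-2) x * - x) * (wt p x * V (- x))); last by ring.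
rewrite normrM ler_piMl// normrM normrN (ger0_norm (wt_ge0 _ _)).
apply: le_trans (ler_wpM2l (wt_ge0 _ _) (wt1_ge x)) _.
by rewrite -wtD wt_le1//; lra.
Qed.

Lemma nl_combine (l1 l5 p : R) V W (a b : R) :
  Xs p (star V W) /\ ns p (star V W) <= a ->
  Xs p (fun x => wt (-2) x * star (dt V) (dt W) x) /\
    ns p (fun x => wt (-2) x * star (dt V) (dt W) x) <= b ->
  Xs p (nl l1 l5 V W) /\ ns p (nl l1 l5 V W) <= (2 * `|l1| + `|l5|) * a + 2 * `|l1| * b.
Proof.
move=> [X1 N1] [X2 N2].
have [X3 N3] := smooth_le X1; have [X4 N4] := smooth_dt_le X1.
have Y1 := XsZ l1 (XsB X3 X1); have Y2 := XsZ (2 * l1) X2; have Y3 := XsZ l5 X4.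
split; first exact: (XsB (XsD Y1 Y2) Y3).
apply: le_trans (nsB (XsD Y1 Y2) Y3) _; apply: le_trans (lerD (nsD Y1 Y2) (lexx _)) _.
rewrite (nsZ _ (XsB X3 X1)) (nsZ _ X2) (nsZ _ X4) normrM (ger0_norm (ler0n R 2)).
have h1 := le_trans (nsB X3 X1) (lerD (le_trans N3 N1) N1).
have h3 := le_trans N4 N1.
have {}h1 := ler_wpM2l (normr_ge0 l1) h1.
have {}h2 := ler_wpM2l (mulr_ge0 (ler0n R 2) (normr_ge0 l1)) N2.
have {}h3 := ler_wpM2l (normr_ge0 l5) h3.
apply: le_trans (lerD (lerD h1 h2) h3) _; clear.
apply: eq_ler; ring.
Qed.

Lemma Xs_dt' (s : R) V : Xs s V -> Xs (s - 1) (dt V) /\ ns (s - 1) (dt V) <= ns s V.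
Proof. by move=> XV; have := @Xs_dt R (s - 1) V; rewrite subrK; exact. Qed.

(** The multiplier of the Helmholtz kernel gains two derivatives. *)
Lemma wt_shift p q V : Xs q V -> p - 2 <= q -> Xs p (fun x => wt (-2) x * V x) /\
  ns p (fun x => wt (-2) x * V x) <= ns q V.
Proof.
move=> XV pq; rewrite -[leRHS]nrm_norm; apply: Xs_dom; last exact: L2_norm.
  by apply: measurable_funM; [exact: measurable_wt|exact: Xs_meas XV].
move=> x; rewrite mulrA -wtD !normrM (ger0_norm (wt_ge0 _ _)) (ger0_norm (wt_ge0 _ _)).
by apply: ler_wpM2r (wt_le x pq).
Qed.

Lemma tame_arith (c w' k' a b A B' A' B0 x y : R) :
  0 <= c -> 0 <= w' -> 0 <= k' -> 0 <= A' -> 0 <= B0 -> 0 <= a -> 0 <= b ->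
  A' <= A -> B0 <= B' -> a <= x -> b <= y ->
  c * (w' * (k' * (2 * A') * (2 * b) + 2 * a * (k' * (2 * B0)))) <=
  c * (w' * (4 * k')) * (A * y + x * B').
Proof.
move=> c0' w0 k0 A0 B00 a0 b0 AA BB ax bY.
have h1 : A' * b <= A * y by apply: ler_pM.
have h2 : a * B0 <= x * B' by apply: ler_pM.
have -> : c * (w' * (k' * (2 * A') * (2 * b) + 2 * a * (k' * (2 * B0)))) =
  c * (w' * (4 * k')) * (A' * b + a * B0) by ring.
apply: ler_wpM2l; last exact: lerD.
by apply: mulr_ge0 => //; apply: mulr_ge0 => //; apply: mulr_ge0.
Qed.

Lemma tame_eq (c w k a b a' b' : R) :
  c * (w * (2 * a * (k * (2 * b')) + k * (2 * a') * (2 * b))) = c * (w * (4 * k)) * (a * b' + a' * b).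
Proof. by ring. Qed.

Lemma half_eq (c w k k' a b : R) :
  c * (w * (2 * a * (k * (2 * b)) + 2 * a * (k' * (2 * b)))) = c * (w * (4 * (k + k'))) * (a * b).
Proof. by ring. Qed.

Lemma nl_tame (l1 l5 s : R) : 3 / 2 < s -> exists2 C : R, 0 <= C &
  forall V W, Xs s V -> Xs s W -> Xs s (nl l1 l5 V W) /\
   ns s (nl l1 l5 V W) <= C * (ns s V * ns 1 W + ns 1 V * ns s W).
Proof.
move=> s32.
(* r is the larger of s - 2 and 0. The product of derivatives need only have order s - 2 before
   smoothing, and r < s - 3/2 keeps the weighted derivatives integrable; such an r exists because s
   > 3/2. *)
have [r [r0 sr pr]] : exists r, [/\ 0 <= r, s - 2 <= r & 1 / 2 < s - 1 - r].
  by case: (leP 0 (s - 2)) => h; [exists (s - 2)|exists 0]; split; lra.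
have s1 : 1 <= s by lra.
have e1 : 0 + 1 <= s by lra.
have : exists C1 : R, C1 = c0 * (wtc s * (4 * kwt 1)) by exact: (ex_intro _ _ erefl).
move=> [C1 C1E].
have : exists C2 : R, C2 = c0 * (wtc r * (4 * kwt (s - 1 - r))) by exact: (ex_intro _ _ erefl).
move=> [C2 C2E].
have C10 : 0 <= C1 by rewrite C1E !mulr_ge0 ?c0_ge0 ?wtc_ge0 ?kwt_ge0.
have C20 : 0 <= C2 by rewrite C2E !mulr_ge0 ?c0_ge0 ?wtc_ge0 ?kwt_ge0.
exists ((2 * `|l1| + `|l5|) * C1 + 2 * `|l1| * C2).
  exact: (addr_ge0 (mulr_ge0 (addr_ge0 (mulr_ge0 (ler0n R 2) (normr_ge0 l1)) (normr_ge0 l5)) C10)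
    (mulr_ge0 (mulr_ge0 (ler0n R 2) (normr_ge0 l1)) C20)).
move=> V W XV XW.
set N := ns s V * ns 1 W + ns 1 V * ns s W.
rewrite mulrDl -(mulrA _ C1 N) -(mulrA _ C2 N); apply: nl_combine.
  have E : c0 * (wtc s * (2 * ns s V * (kwt 1 * (2 * ns 1 W)) + kwt 1 * (2 * ns 1 V) * (2 * ns s W)))
    = C1 * N by rewrite C1E; exact: tame_eq.
  by rewrite -E; exact: star_high.
have [X1V N1V] := Xs_dt' XV; have [X1W N1W] := Xs_dt' XW.
have [M0V K0V] := Xs_dt (Xs_le e1 XV).1; have [M0W K0W] := Xs_dt (Xs_le e1 XW).1.
rewrite add0r in K0V; rewrite add0r in K0W.
have [Xr Nr] := star_low r0 pr X1V X1W.
apply: bound_trans (wt_shift Xr sr) _; apply: (le_trans Nr).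
rewrite C2E /N; exact: (@tame_arith c0 (wtc r) (kwt (s - 1 - r)) (ns 0 (dt V)) (ns 0 (dt W))
  (ns s V) (ns s W) (ns (s - 1) (dt V)) (ns (s - 1) (dt W)) (ns 1 V) (ns 1 W) c0_ge0 (wtc_ge0 r)
  (kwt_ge0 _) (ns_ge0 _ _) (ns_ge0 _ _) (ns_ge0 _ _) (ns_ge0 _ _) N1V N1W K0V K0W).
Qed.

Lemma half_arith (c w k k' a a' B' B0 : R) :
  0 <= c -> 0 <= w -> 0 <= k -> 0 <= k' -> 0 <= a -> 0 <= B0 -> a <= a' -> B0 <= B' ->
  c * (w * (2 * a * (k * (2 * B0)) + 2 * a * (2 * B0) * k')) <=
  c * (w * (4 * (k + k'))) * (a' * B').
Proof.
move=> c0' w0 k0 k'0 a0 B00 aa BB.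
have -> : c * (w * (2 * a * (k * (2 * B0)) + 2 * a * (2 * B0) * k')) =
  c * (w * (4 * (k + k'))) * (a * B0) by ring.
apply: ler_wpM2l; last exact: ler_pM.
by apply: mulr_ge0 => //; apply: mulr_ge0 => //; apply: mulr_ge0 => //; exact: addr_ge0.
Qed.

(** The estimate behind uniqueness, with V a difference of solutions. For the term u_x^2 the
    derivative of V has order -1/2 only; the product is controlled in order -3/2, and the smoothing
    by two leads back to 1/2. *)
Lemma nl_half (l1 l5 s : R) : 3 / 2 < s -> exists2 C : R, 0 <= C &
  forall V W, Xs s V -> Xs s W -> ns (1 / 2) (nl l1 l5 V W) <= C * (ns (1 / 2) V * ns s W).
Proof.
move=> s32.
have h0 : 0 <= (1 : R) / 2 by lra.
have pr : 1 / 2 < s - 1 / 2 by lra.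
have p12 : 1 / 2 < s - 1 by lra.
have eh : - (1 / 2) + 1 = (1 : R) / 2 by lra.
have hs : - (1 / 2) + 1 <= s by lra.
have e32 : (1 : R) / 2 - 2 <= - (3 / 2) by lra.
have : exists C1 : R, C1 = c0 * (wtc (1 / 2) * (4 * (kwt s + kwt (s - 1 / 2)))) by exact: (ex_intro _ _ erefl).
move=> [C1 C1E].
have : exists C2 : R, C2 = c0 * (wtc (1 / 2) * (4 * (kwt (s - 1) + kwt (3 / 2)))) by exact: (ex_intro _ _ erefl).
move=> [C2 C2E].
have C10 : 0 <= C1 by rewrite C1E !mulr_ge0 ?c0_ge0 ?wtc_ge0 ?addr_ge0 ?kwt_ge0.
have C20 : 0 <= C2 by rewrite C2E !mulr_ge0 ?c0_ge0 ?wtc_ge0 ?addr_ge0 ?kwt_ge0.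
exists ((2 * `|l1| + `|l5|) * C1 + 2 * `|l1| * C2).
  exact: (addr_ge0 (mulr_ge0 (addr_ge0 (mulr_ge0 (ler0n R 2) (normr_ge0 l1)) (normr_ge0 l5)) C10)
    (mulr_ge0 (mulr_ge0 (ler0n R 2) (normr_ge0 l1)) C20)).
move=> V W XV XW.
set N := ns (1 / 2) V * ns s W.
suff : Xs (1 / 2) (nl l1 l5 V W) /\ ns (1 / 2) (nl l1 l5 V W) <=
  (2 * `|l1| + `|l5|) * (C1 * N) + 2 * `|l1| * (C2 * N).
  by move=> [_ H]; rewrite [leRHS]mulrDl -(mulrA _ C1 N) -(mulrA _ C2 N); exact: H.
apply: nl_combine.
  have E : c0 * (wtc (1 / 2) * (2 * ns (1 / 2) V * (kwt s * (2 * ns s W)) + 2 * ns (1 / 2) V * (kwt (s - 1 / 2) * (2 * ns s W))))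
    = C1 * N by rewrite C1E; exact: half_eq.
  by rewrite -E; exact: star_mixed.
have [X1V N1V] := Xs_dt' XV; have [X1W N1W] := Xs_dt' XW.
have [MV KV] := Xs_dt (Xs_le hs XV).1.
rewrite eh in KV.
have [Xr Nr] := star_negative p12 X1V X1W.
apply: bound_trans (wt_shift Xr e32) _; apply: (le_trans Nr).
rewrite C2E /N; exact: (@half_arith c0 (wtc (1 / 2)) (kwt (s - 1)) (kwt (3 / 2)) (ns (- (1 / 2)) (dt V))
  (ns (1 / 2) V) (ns s W) (ns (s - 1) (dt W)) c0_ge0 (wtc_ge0 _) (kwt_ge0 _) (kwt_ge0 _) (ns_ge0 _ _)
  (ns_ge0 _ _) KV N1W).
Qed.

Lemma L2_dt V : Xs 1 V -> L2 (dt V).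
Proof.
by rewrite -[1]add0r => XV; apply/Xs0; exact: (Xs_dt XV).1.
Qed.

Lemma dtB V W : dt (fun x => V x - W x) = (fun x => dt V x - dt W x).
Proof. by apply/funext => x; rewrite /dt mulrBr. Qed.

Lemma nlC (l1 l5 : R) V W : Xs 1 V -> Xs 1 W -> nl l1 l5 V W = nl l1 l5 W V.
Proof.
move=> XV XW; have [LV LW] := (Xs_L2 ler01 XV, Xs_L2 ler01 XW).
have E : star V W = star W V by apply/funext => x; exact: starC.
have E' : star (dt V) (dt W) = star (dt W) (dt V).
  by apply/funext => x; apply: starC; exact: L2_dt.
by apply/funext => x; rewrite /nl E E'.
Qed.

Lemma nlBl (l1 l5 : R) V V' W : Xs 1 V -> Xs 1 V' -> Xs 1 W ->
  nl l1 l5 (fun x => V x - V' x) W = (fun x => nl l1 l5 V W x - nl l1 l5 V' W x).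
Proof.
move=> XV XV' XW.
have [[LV LV'] LW] := (Xs_L2 ler01 XV, Xs_L2 ler01 XV', Xs_L2 ler01 XW).
have E : star (fun x => V x - V' x) W = (fun x => star V W x - star V' W x).
  by apply/funext => x; exact: starBl.
apply/funext => x; rewrite /nl E dtB starBl; [|exact: L2_dt..].
by rewrite dtB; ring.
Qed.

(** [nl] is bilinear and symmetric. The difference is written so that V - W always stands in the
    first slot, where [nl_half] puts the weak norm. *)
Lemma nl_diff (l1 l5 : R) V W : Xs 1 V -> Xs 1 W ->
  (fun x => nl l1 l5 V V x - nl l1 l5 W W x) =
  (fun x => nl l1 l5 (fun x => V x - W x) V x + nl l1 l5 (fun x => V x - W x) W x).
Proof.
move=> XV XW; apply/funext => x.
by rewrite !nlBl// (nlC l1 l5 XV XW); ring.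
Qed.

End nonlinearity.

(** * Back to the equation *)

Section physical.
Context {R : realType}.
Notation mu := (@lebesgue_measure R).
Implicit Types (f g v U V W Z : R -> R).

Lemma is_derive_cas (t : R) : is_derive t 1 (@cas R) (cas (- t)).
Proof.
have d := is_deriveD (is_derive_cos t) (is_derive_sin t).
by apply: (is_derive_eq d); rewrite /cas cosN sinN addrC.
Qed.

Lemma is_derive_casl (x y : R) : is_derive x 1 (fun x => cas (x * y)) (cas (- (x * y)) * y).
Proof.
have dl : is_derive x (1 : R) (fun x : R => x * y) y.
  have d := is_deriveM (is_derive_id x (1 : R)) (is_derive_cst y x (1 : R)).
  by apply: (is_derive_eq d); rewrite scaler0 add0r /GRing.scale/= mulr1.
exact: (is_derive1_comp (is_derive_cas _) dl).
Qed.

Lemma L1_mulX V : L1 (dt V) -> L1 (fun y => y * V y).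
Proof.
by move=> /L1_opp; rewrite /dt; under eq_fun do rewrite !opprK.
Qed.

(** Differentiation under the integral sign. The derivative of cas at t is cas (- t), and this
    reflection is the one built into [dt]. *)
Lemma is_derive_iht V (x : R) : L1 V -> L1 (dt V) -> is_derive x 1 (iht V) (iht (dt V) x).
Proof.
move=> LV LdV; have LX := L1_mulX LdV; have mV := L1_meas LV.
have d1E a y : partial1of2 (fun a y => V y * cas (a * y)) a y = V y * (cas (- (a * y)) * y).
  rewrite partial1of2E.
  have d := is_deriveZ (V y) (is_derive_casl a y).
  exact: (@derive_val _ _ _ _ _ _ _ d).
have xI : `]x - 1, x + 1[%classic x by rewrite /= in_itv/=; apply/andP; split; lra.
have G0 y : 0 <= 2 * `|y * V y| by rewrite mulr_ge0.
have LG : L1 (fun y => 2 * `|y * V y|) by apply: L1Zl; exact: L1_norm.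
have Lf a : `]x - 1, x + 1[%classic a -> mu.-integrable setT (EFin \o (fun y => V y * cas (a * y))).
  by move=> _; exact: L1_cas.
have := @cvg_differentiation_under_integral R _ _ mu _ setT measurableT x (x - 1) (x + 1) xI Lf _ _ G0 LG _.
move=> C.
have {C} : h^-1 *: (ht V (h + x) - ht V x) @[h --> 0^'] --> ht (dt V) x.
  have -> : ht (dt V) x = I (fun y => partial1of2 (fun a y => V y * cas (a * y)) x y).
    rewrite /ht -I_opp; last exact: L1_cas.
    by congr Rintegral; apply/funext => y; rewrite d1E /dt opprK mulrN; ring.
  apply: C => [a y _ _|a y _ _].
    have d := is_deriveZ (V y) (is_derive_casl a y).
    exact: (@ex_derive _ _ _ _ _ _ _ d).
  rewrite d1E (_ : V y * _ = cas (- (a * y)) * (y * V y)); last by ring.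
  by rewrite normrM ler_wpM2r// cas_le2.
move=> C.
have dht : is_derive x 1 (ht V) (ht (dt V) x).
  have C' : h^-1 *: (ht V (h *: 1 + x) - ht V x) @[h --> 0^'] --> ht (dt V) x.
    by under eq_fun do rewrite /GRing.scale/= mulr1.
  by split; [apply/cvg_ex; eexists; exact: C'|exact: cvg_lim C'].
exact: (is_deriveZ (2 * pi)^-1 dht).
Qed.

Lemma continuous_iht V : L1 V -> continuous (iht V).
Proof.
move=> LV x; have mV := L1_meas LV.
have xI : x \in `]x - 1, x + 1[%classic by rewrite mem_setE in_itv/=; apply/andP; split; lra.
have Lf a : `]x - 1, x + 1[%classic a -> mu.-integrable setT (EFin \o (fun y => V y * cas (a * y))).
  by move=> _; exact: L1_cas.
have LG : L1 (fun y => `|V y| * 2) by apply: L1Zr; exact: L1_norm.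
have C := @continuity_under_integral R _ _ mu _ setT measurableT (x - 1) (x + 1) Lf _ _ LG.
apply: cvgM; first exact: cvg_cst.
apply: C xI.
  apply: aeW => y _ a _; apply: cvgM; first exact: cvg_cst.
  exact: is_derive_cvg (is_derive_casl a y).
by move=> a _; apply: aeW => y _; rewrite normrM ler_wpM2l// cas_le2.
Qed.

Lemma helmholtzE x : helmholtz x = 2^-1 * poisson 1 x :> R.
Proof. by rewrite /helmholtz /poisson mul1r. Qed.

Lemma L1_helmholtz (x : R) : L1 (fun y => helmholtz (x - y)).
Proof.
apply: (@L1_reflect R x (@helmholtz R)).
have := L1Zl 2^-1 (@L1_poisson R 1 ltr01); congr L1; apply/funext => y.
by rewrite helmholtzE.
Qed.

Lemma ht_helmholtz (x z : R) : ht (fun y => helmholtz (x - y)) z = wt (-2) z * cas (x * z).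
Proof.
rewrite /ht -(I_reflect x); last by apply: L1_cas; exact: L1_helmholtz.
transitivity (I (fun y => 2^-1 * (cas (x * z) * (poisson 1 y * cos (z * y)) +
   (sin (x * z) - cos (x * z)) * (poisson 1 y * sin (z * y))))).
  congr Rintegral; apply/funext => y.
  rewrite helmholtzE opprB addrCA subrr addr0 mulrBr (mulrC z x) /cas cosB sinB; ring.
have Lc := @L1_poisson_cos R 1 z ltr01; have Ls := @L1_poisson_sin R 1 z ltr01.
rewrite IZl; last by apply: L1D; exact: L1Zl.
rewrite ID; [|exact: L1Zl..].
rewrite !IZl// I_poisson_cos// I_poisson_sin// mulr0 addr0 wtV wt2 expr1n mulr1.
by field; have := sqr1p_gt0 z; lra.
Qed.

(** Self-adjointness moves the transform onto the translated kernel, whose transform is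
    [wt (-2) z * cas (x * z)]: the symbol 1 / (1 + z^2) of the kernel appears under the inverse
    transform. *)
Lemma convolution_helmholtz Z x : L1 Z ->
  convolution helmholtz (iht Z) x = iht (fun z => wt (-2) z * Z z) x.
Proof.
move=> LZ; rewrite convolutionE /iht.
have Lh := L1_helmholtz x.
transitivity (I (fun y => (2 * pi)^-1 * (helmholtz (x - y) * ht Z y))).
  by congr Rintegral; apply/funext => y; rewrite mulrCA.
rewrite IZl; last exact: L1_mul_ht.
rewrite -ht_selfadjoint//; congr (_ * _); rewrite /ht; congr Rintegral; apply/funext => z.
rewrite -/(ht _ z) ht_helmholtz; ring.
Qed.

(** For s > 3/2 both V and its derivative symbol are integrable, so that [iht V] is continuously
    differentiable and the equation can be read pointwise. *)
Lemma Xs_regular s V : 3 / 2 < s -> Xs s V -> [/\ L2 V, L1 V, L2 (dt V) & L1 (dt V)].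
Proof.
move=> s32 XV; have s0 : 0 <= s by lra. have s1 : 1 <= s by lra.
have k0 : 1 / 2 < s - 0 by lra. have k1 : 1 / 2 < s - 1 - 0 by lra.
have [L _] := Xs_L1 k0 XV; have [X' _] := Xs_dt' XV; have [L' _] := Xs_L1 k1 X'.
rewrite !wt0E in L L'.
split => //; first exact: Xs_L2 XV.
by apply: L2_dt; exact: (Xs_le s1 XV).1.
Qed.

Lemma iht_hart s v V : 3 / 2 < s -> Xs s V -> hart v V -> {ae mu, forall x, iht V x = v x}.
Proof.
move=> s32 XV hv; have [L2V LV _ _] := Xs_regular s32 XV.
exact: hart_inj (hart_iht LV L2V) hv.
Qed.

Lemma weak_derivative_iht V v : L1 V -> L1 (dt V) -> measurable_fun setT v ->
  {ae mu, forall x, iht V x = v x} -> {ae mu, forall x, weak_derivative v x = iht (dt V) x}.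
Proof.
move=> LV LdV mv hv; apply: weak_derivativeP.
by apply: (classical_weak _ (continuous_iht LdV) mv hv) => x; exact: is_derive_iht.
Qed.

Lemma convolution_ae g f f' x : {ae mu, forall y, f y = f' y} ->
  measurable_fun setT g -> measurable_fun setT f -> measurable_fun setT f' ->
  convolution g f x = convolution g f' x.
Proof.
move=> ff' mg mf mf'; rewrite !convolutionE; apply: I_ae.
- by apply: measurable_funM => //; exact: measurable_reflect.
- by apply: measurable_funM => //; exact: measurable_reflect.
- by apply: (@ae_imply _ (fun y => f y = f' y) _ ff') => y ->.
Qed.

Lemma iht_lin a b V W x : L1 V -> L1 W -> iht (fun x => a * V x + b * W x) x = a * iht V x + b * iht W x.
Proof. by move=> LV LW; rewrite /iht htD ?htZ//; [ring|exact: L1Zl|exact: L1Zl]. Qed.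

Lemma L1_smooth Z : L1 Z -> L1 (fun x => wt (-2) x * Z x).
Proof.
move=> LZ; apply: (@L1_le _ (fun x => `|Z x|)).
- by apply: measurable_funM; [exact: measurable_wt|exact: L1_meas].
- by move=> x; rewrite normrM ler_piMl// wtm2_le1.
- exact: L1_norm.
Qed.

Lemma wt_mulX_le1 (x : R) : `|wt (-2) x * x| <= 1.
Proof.
rewrite normrM (ger0_norm (wt_ge0 _ _)).
apply: le_trans (ler_wpM2l (wt_ge0 _ _) (wt1_ge x)) _.
by rewrite -wtD wt_le1//; lra.
Qed.

Lemma L1_smooth_dt Z : L1 Z -> L1 (fun x => wt (-2) x * dt Z x).
Proof.
move=> LZ; apply: (@L1_le _ (fun x => `|Z (- x)|)).
- apply: measurable_funM; first exact: measurable_wt.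
  by apply: measurable_dt; exact: L1_meas.
- move=> x; have -> : wt (-2) x * dt Z x = - (wt (-2) x * x) * Z (- x) by rewrite /dt; ring.
  by rewrite normrM normrN ler_piMl// wt_mulX_le1.
- by apply: L1_norm; exact: L1_opp.
Qed.

Lemma measurable_iht V : L1 V -> measurable_fun setT (iht V).
Proof. by move=> LV; apply: continuous_measurable_fun; exact: continuous_iht. Qed.

Lemma measurable_helmholtz : measurable_fun setT (@helmholtz R).
Proof.
rewrite (_ : helmholtz = fun x => 2^-1 * poisson 1 x).
  by apply: measurable_funM => //; exact: measurable_poisson.
by apply/funext => x; exact: helmholtzE.
Qed.

Lemma convolution_physical a b V v w x : L1 V -> L1 (dt V) ->
  measurable_fun setT v -> measurable_fun setT w ->
  {ae mu, forall x, iht V x = v x} -> {ae mu, forall x, w x = iht (dt V) x} ->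
  convolution helmholtz (fun y => a * v y ^+ 2 + b * w y ^+ 2) x =
  iht (fun z => wt (-2) z * (a * star V V z + b * star (dt V) (dt V) z)) x.
Proof.
move=> LV LdV mv mw hv hw.
have LS := L1_star LV LV; have LS' := L1_star LdV LdV.
rewrite -convolution_helmholtz; last by apply: L1D; exact: L1Zl.
apply: convolution_ae.
- apply: (ae_imply2 hv hw) => y vy ->.
  by rewrite iht_lin// !iht_star// -vy !expr2.
- exact: measurable_helmholtz.
- by apply: measurable_funD; apply: measurable_funM => //; exact: measurable_funX.
- by apply: measurable_iht; apply: L1D; exact: L1Zl.
Qed.

(** The dictionary between the two forms of the equation. The convolutions do not see null sets, and
    weak derivatives are exchanged for classical ones of the representative [iht V]. *)
Lemma equation_physical (l1 l5 : R) V v : L1 V -> L1 (dt V) -> measurable_fun setT v ->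
  {ae mu, forall x, iht V x = v x} ->
  {ae mu, forall x, l1 * v x ^+ 2 + 0 * (v x * weak_derivative v x)
     + convolution helmholtz (fun y => - l1 * v y ^+ 2 + - (2 * l1) * weak_derivative v y ^+ 2) x
     + weak_derivative (convolution helmholtz
          (fun y => l5 * v y ^+ 2 + 0 * weak_derivative v y ^+ 2)) x = - iht (nl l1 l5 V V) x}.
Proof.
move=> LV LdV mv hv; have hw := weak_derivative_iht LV LdV mv hv.
have mw : measurable_fun setT (weak_derivative v).
  have wv := classical_weak (fun x => is_derive_iht x LV LdV) (continuous_iht LdV) mv hv.
  by have [_ [mw _ _] _] := @getPex _ (is_weak_derivative v) (ex_intro _ _ wv).
have LS := L1_star LV LV; have LS' := L1_star LdV LdV.
have E a b : convolution helmholtz (fun y => a * v y ^+ 2 + b * weak_derivative v y ^+ 2) =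
  iht (fun z => wt (-2) z * (a * star V V z + b * star (dt V) (dt V) z)).
  by apply/funext => x; exact: convolution_physical.
rewrite !E.
have [Z hZ] : exists Z, Z = (fun z => wt (-2) z * (l5 * star V V z + 0 * star (dt V) (dt V) z)).
  by eexists.
have LZ : L1 Z by rewrite hZ; apply: L1_smooth; apply: L1D; exact: L1Zl.
have ZE : dt Z = (fun z => l5 * (wt (-2) z * dt (star V V) z)).
  by apply/funext => z; rewrite hZ /dt wt_opp; ring.
have LdZ : L1 (dt Z) by rewrite ZE; apply: L1Zl; exact: L1_smooth_dt.
have hZw := weak_derivative_iht LZ LdZ (measurable_iht LZ) (ae_all (fun x => erefl)).
apply: (ae_imply2 hv hZw) => x vx; rewrite -hZ => ->.
rewrite -vx mul0r addr0 ZE expr2 -iht_star//.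
have nlE : nl l1 l5 V V = fun z => 1 * (- l1 * star V V z + - 1 * (wt (-2) z * (- l1 * star V V z + - (2 * l1) * star (dt V) (dt V) z)))
   + - 1 * (l5 * (wt (-2) z * dt (star V V) z)).
  by apply/funext => z; rewrite /nl; ring.
have L1' : L1 (fun z => wt (-2) z * (- l1 * star V V z + - (2 * l1) * star (dt V) (dt V) z)).
  by apply: L1_smooth; apply: L1D; exact: L1Zl.
have L2' : L1 (fun z => l5 * (wt (-2) z * dt (star V V) z)) by apply: L1Zl; exact: L1_smooth_dt.
rewrite nlE (iht_lin 1 (-1) _ _ L2'); last by apply: L1D; exact: L1Zl.
rewrite (iht_lin (- l1) (-1) _ LS L1').
move: (iht _ x) (iht _ x) (iht _ x) => p q r; clear; ring.
Qed.

End physical.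

(** * Conservation of the H^1 norm *)

Section conservation.
Context {R : realType}.
Notation mu := (@lebesgue_measure R).
Implicit Types (f g v U V W Z : R -> R).

Lemma hart_dot_iht V W : L1 V -> L2 V -> L1 W -> L2 W ->
  I (fun x => V x * W x) = 2 * pi * I (fun x => iht V x * iht W x).
Proof. by move=> LV L2V LW L2W; exact: hart_dot (hart_iht LV L2V) (hart_iht LW L2W). Qed.

Lemma star_regular (s : R) U V : 3 / 2 < s -> Xs (s - 1) U -> Xs (s - 1) V ->
  L1 (star U V) /\ L2 (star U V).
Proof.
move=> s32 XU XV; have k1 : 1 / 2 < s - 1 - 0 by lra.
have [LU _] := Xs_L1 k1 XU; have [LV _] := Xs_L1 k1 XV.
rewrite !wt0E in LU LV; split; first exact: L1_star.
by apply/Xs0; exact: (star_low (lexx 0) k1 XU XV).1.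
Qed.

(** The rule (u^2)_x = 2 u u_x. Both sides have the same inverse transform, by the classical product
    rule for [iht U]; uniqueness of the transform then gives equality almost everywhere. *)
Lemma dt_star (s : R) U : 3 / 2 < s -> Xs s U ->
  {ae mu, forall x, dt (star U U) x = 2 * star U (dt U) x}.
Proof.
move=> s32 XU; have s1 : 1 <= s by lra. have ss : s - 1 <= s by lra.
have [L2U LU L2D LD] := Xs_regular s32 XU.
have [L2S LS L2DS LDS] := Xs_regular s32 (star_high s1 XU XU).1.
have [LM L2M] := star_regular s32 (Xs_le ss XU).1 (Xs_dt' XU).1.
have E : iht (dt (star U U)) = iht (fun x => 2 * star U (dt U) x).
  apply/funext => x.
  have dU := is_derive_iht x LU LD.
  have dS := is_derive_iht x LS LDS.
  have dM := is_deriveM dU dU.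
  have SE : iht (star U U) = iht U * iht U by apply/funext => y; exact: iht_star.
  rewrite -SE in dM.
  rewrite -(@derive_val _ _ _ _ _ _ _ dS) (@derive_val _ _ _ _ _ _ _ dM).
  rewrite [RHS]/iht htZ// mulrCA -/(iht _ x) iht_star// /GRing.scale/=; ring.
have h1 := hart_iht LDS L2DS; rewrite E in h1.
apply: hart_unique h1 _; apply: hart_iht; [exact: L1Zl|exact: L2Zl].
Qed.

(* Plancherel's identity reduces the three terms to int u u_x^2 and int u^2 u_x. *)
Lemma nl_conserved (l1 l5 s : R) U : 3 / 2 < s -> Xs s U ->
  I (fun x => (wt 1 x * U x) * (wt 1 x * nl l1 l5 U U x)) = 0.
Proof.
move=> s32 XU; have s1 : 1 <= s by lra. have ss : s - 1 <= s by lra.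
have [L2U LU L2D LD] := Xs_regular s32 XU.
have [L2S LS L2DS LDS] := Xs_regular s32 (star_high s1 XU XU).1.
have [LM L2M] := star_regular s32 (Xs_le ss XU).1 (Xs_dt' XU).1.
have [LN L2N] := star_regular s32 (Xs_dt' XU).1 (Xs_dt' XU).1.
have hD := dt_star s32 XU.
have mDS := L2_meas L2DS. have mU := L2_meas L2U. have mD := L2_meas L2D.
have [S hS] : exists S, S = star U U by eexists.
have [N hN] : exists N, N = star (dt U) (dt U) by eexists.
rewrite -hS in L2S LS L2DS LDS hD mDS. rewrite -hN in LN L2N.
have J1 : I (fun x => dt U x * dt S x) = 2 * I (fun x => U x * N x).
  transitivity (I (fun x => 2 * (dt U x * star U (dt U) x))).
    apply: I_ae.
    - exact: measurable_funM.
    - by apply: measurable_funM => //; apply: measurable_funM => //; exact: L2_meas.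
    - by apply: (@ae_imply _ (fun x => dt S x = 2 * star U (dt U) x) _ hD) => x ->; ring.
  rewrite IZl; last exact: L1M.
  rewrite (hart_dot_iht LD L2D LM L2M) (hart_dot_iht LU L2U LN L2N).
  congr (_ * (_ * _)); congr Rintegral; apply/funext => x.
  by rewrite hN !iht_star//; move: (iht _ x) (iht _ x) => a b; clear; ring.
have J2 : I (fun x => U x * dt S x) = 0.
  have e1 : I (fun x => U x * dt S x) = 2 * I (fun x => U x * star U (dt U) x).
    rewrite -IZl; last exact: L1M.
    apply: I_ae.
    - exact: measurable_funM.
    - by apply: measurable_funM => //; apply: measurable_funM => //; exact: L2_meas.
    - by apply: (@ae_imply _ (fun x => dt S x = 2 * star U (dt U) x) _ hD) => x ->; ring.
  have e2 : I (fun x => U x * dt S x) = - I (fun x => dt U x * S x).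
    rewrite -I_opp; last exact: L1M.
    rewrite -IN; last exact: L1M.
    by congr Rintegral; apply/funext => x; rewrite /dt opprK; ring.
  have e3 : I (fun x => dt U x * S x) = I (fun x => U x * star U (dt U) x).
    rewrite (hart_dot_iht LD L2D LS L2S) (hart_dot_iht LU L2U LM L2M).
    congr (_ * _); congr Rintegral; apply/funext => x.
    by rewrite hS !iht_star//; move: (iht _ x) (iht _ x) => a b; clear; ring.
  (* With a = int u (u^2)_x: a = 2 b by the product rule, a = - c by parts, and c = b since u_x u^2
     = u (u u_x). Hence a = 0. *)
  move: e1 e2 e3; move: (I _) (I _) (I _) => a b c; clear; lra.
have J3 : I (fun x => x ^+ 2 * U x * S x) = I (fun x => dt U x * dt S x).
  rewrite -[RHS]I_opp; last exact: L1M.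
  by congr Rintegral; apply/funext => x; rewrite /dt !opprK; ring.
have L3 : L1 (fun x => x ^+ 2 * U x * S x).
  have := L1_opp (L1M L2D L2DS); congr L1; apply/funext => x; rewrite /dt !opprK; ring.
have LUN := L1M L2U L2N; have LUD := L1M L2U L2DS.
(* The squared weight of H^1 undoes the smoothing: [wt 1 ^+ 2 * wt (-2) = 1]. The unsmoothed term
   leaves 1 - (1 + x^2) = - x^2, whose integral [J3] and [J1] turn into twice that of [U * N]; this
   cancels the second term. *)
transitivity (I (fun x => (- l1) * (x ^+ 2 * U x * S x) + 2 * l1 * (U x * N x) + (- l5) * (U x * dt S x))).
  congr Rintegral; apply/funext => x; rewrite /nl -hS -hN.
  have w : wt 1 x * wt 1 x * wt (-2) x = 1 by rewrite -!wtD -[RHS](wt0 x); congr wt; lra.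
  have w2 : wt 1 x * wt 1 x = 1 + x ^+ 2 by rewrite -wtD wt2.
  transitivity (l1 * (U x * ((wt 1 x * wt 1 x * wt (-2) x) * S x - wt 1 x * wt 1 x * S x))
     + 2 * l1 * (U x * ((wt 1 x * wt 1 x * wt (-2) x) * N x)) - l5 * (U x * ((wt 1 x * wt 1 x * wt (-2) x) * dt S x))).
    by ring.
  by rewrite w w2; ring.
rewrite ID; [|by apply: L1D; exact: L1Zl|exact: L1Zl].
rewrite ID; [|exact: L1Zl|exact: L1Zl].
rewrite !IZl// J3 J1 J2; ring.
Qed.

End conservation.

Opaque nl.

(** * Euler polygons *)

Lemma step_arith {R : realType} (h d e a b kh hc Lh : R) : 0 <= h -> 1 <= a -> 1 + Lh <= b ->
  d <= a * kh * hc -> e <= h * hc -> 0 <= kh -> 0 <= hc -> 0 <= Lh ->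
  (1 + Lh) * d + e <= a * b * (kh + h) * hc.
Proof.
move=> h0 E1 E2 dk ek kh0 hc0 Lh0.
have -> : a * b * (kh + h) * hc = b * (a * kh * hc) + (a * b) * (h * hc) by ring.
have b1 : 1 <= b by lra.
have a0 : 0 <= a by lra.
apply: lerD.
  apply: (@le_trans _ _ ((1 + Lh) * (a * kh * hc))); first by apply: ler_wpM2l => //; lra.
  by apply: ler_wpM2r => //; rewrite !mulr_ge0.
apply: le_trans ek _; rewrite ler_peMl ?mulr_ge0//.
by rewrite -[1]mulr1; apply: ler_pM.
Qed.

Lemma sqr_arith {R : realType} (t r T0 h q : R) : 0 <= t -> t <= r -> r <= T0 -> 0 <= h -> h <= 1 ->
  0 <= q -> - h <= q - (r - t) -> q - (r - t) <= h ->
  q ^+ 2 <= (r - t) ^+ 2 + (2 * T0 + 1) * h.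
Proof.
move=> t0 tr rT h0 h1 q0 d1 d2.
have : q ^+ 2 <= (r - t + h) ^+ 2 by rewrite ler_sqr ?nnegrE; lra.
move=> le1; apply: le_trans le1 _.
nra.
Qed.

(** The passage to the limit over dyadic meshes, used for all bounds inherited from the polygons. *)
Lemma le_halves {R : realType} (a b C : R) : (forall n, a <= b + C / 2 ^+ n) -> a <= b.
Proof.
move=> h; rewrite leNgt; apply/negP => ba.
have d0 : 0 < a - b by lra.
have C0 : 0 <= C.
  by have := h 0%N; rewrite expr0 divr1; lra.
have := archi_boundP (divr_ge0 C0 (ltW d0)); set n := Num.bound _ => hn.
have n2 : n%:R <= 2 ^+ n :> R by rewrite -natrX ler_nat ltnW// ltn_expl.
have := lt_le_trans hn n2; rewrite ltr_pdivrMr// => h1.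
have p0 : 0 < 2 ^+ n :> R by rewrite exprn_gt0.
by have := h n; rewrite -lerBlDl ler_pdivlMr// mulrC leNgt h1.
Qed.

Section euler.
(** N is a seminorm on functions, not a norm on classes: it will be [ns s], which vanishes on
    functions that are null almost everywhere. Completeness is asked for sequences with
    geometrically decreasing increments, which dyadic refinement produces. *)
Context {R : realType} {T : Type} (X : (T -> R) -> Prop) (N : (T -> R) -> R).
Implicit Types (u v w : T -> R) (a h t : R) (k n : nat).
Context (XD : forall u v, X u -> X v -> X (fun x => u x + v x)).
Context (XZ : forall a u, X u -> X (fun x => a * u x)).
Context (N_ge0 : forall u, 0 <= N u).
Context (ND : forall u v, X u -> X v -> N (fun x => u x + v x) <= N u + N v).
Context (NZ : forall a u, X u -> N (fun x => a * u x) = `|a| * N u).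
Context (complete : forall (f : nat -> T -> R) (C : R), (forall n, X (f n)) ->
  (forall n, N (fun x => f n.+1 x - f n x) <= C / 2 ^+ n) ->
  exists2 v, X v & forall n, N (fun x => f n x - v x) <= 2 * C / 2 ^+ n).
Context (F : (T -> R) -> (T -> R)) (A : R).
Context (XF : forall u, X u -> X (F u)) (A_ge0 : 0 <= A).
Context (NF : forall u, X u -> N (F u) <= A * N u).
Context (lipschitz : forall rho : R, exists2 L : R, 0 <= L & forall u v, X u -> X v ->
  N u <= rho -> N v <= rho -> N (fun x => F u x - F v x) <= L * N (fun x => u x - v x)).

Lemma XB u v : X u -> X v -> X (fun x => u x - v x).
Proof.
by move=> Xu /(XZ (-1)) Xv; have := XD Xu Xv; congr X; apply/funext => x; ring.
Qed.

Lemma NN u : X u -> N (fun x => - u x) = N u.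
Proof.
move=> Xu; rewrite -[RHS]mul1r -[1](normrN1 R) -NZ//; congr N; apply/funext => x; ring.
Qed.

Lemma NB u v : X u -> X v -> N (fun x => u x - v x) <= N u + N v.
Proof.
move=> Xu Xv; rewrite -(NN Xv); apply: ND => //.
by have := XZ (-1) Xv; congr X; apply/funext => x; ring.
Qed.

Definition step h w : T -> R := fun x => w x + h * F w x.
Definition euler h v k : T -> R := iter k (step h) v.

Lemma X_step h w : X w -> X (step h w).
Proof. by move=> Xw; apply: XD => //; apply: XZ; exact: XF. Qed.

Lemma X_euler h v k : X v -> X (euler h v k).
Proof. by move=> Xv; elim: k => //= k IH; exact: X_step. Qed.

Lemma N_step h w : 0 <= h -> X w -> N (step h w) <= expR (A * h) * N w.
Proof.
move=> h0 Xw; apply: (@le_trans _ _ ((1 + A * h) * N w)).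
  apply: le_trans (ND Xw (XZ h (XF Xw))) _; rewrite NZ ?(ger0_norm h0); last exact: XF.
  rewrite mulrDl mul1r lerD2l -mulrA mulrCA; apply: ler_wpM2l => //; exact: NF.
by apply: ler_wpM2r => //; exact: expR_ge1Dx.
Qed.

Lemma N_euler h v k : 0 <= h -> X v -> N (euler h v k) <= expR (A * (k%:R * h)) * N v.
Proof.
move=> h0 Xv; elim: k => [|k IH]; first by rewrite mul0r mulr0 expR0 mul1r.
apply: le_trans (N_step h0 (X_euler h k Xv)) _.
rewrite -natr1 mulrDl mul1r mulrDr addrC expRD -mulrA.
by apply: ler_wpM2l; first exact: expR_ge0.
Qed.

Section bounded.
(** Linear growth of F confines every polygon to the ball of radius rho up to time T0, so that a
    single Lipschitz constant, that of this ball, serves for all meshes. *)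
Context (v : T -> R) (Xv : X v) (T0 rho L : R).
Context (L_ge0 : 0 <= L) (rhoE : rho = expR (A * T0) * N v).
Context (lip : forall u w, X u -> X w -> N u <= rho -> N w <= rho ->
  N (fun x => F u x - F w x) <= L * N (fun x => u x - w x)).

Lemma rho_ge0 : 0 <= rho.
Proof. by rewrite rhoE mulr_ge0// expR_ge0. Qed.

Lemma euler_ball h k : 0 <= h -> k%:R * h <= T0 -> N (euler h v k) <= rho.
Proof.
move=> h0 kT; apply: le_trans (N_euler k h0 Xv) _; rewrite rhoE ler_wpM2r// ler_expR.
by apply: ler_wpM2l.
Qed.

Lemma euler_F h k : 0 <= h -> k%:R * h <= T0 -> N (F (euler h v k)) <= A * rho.
Proof.
move=> h0 kT; apply: le_trans (NF (X_euler h k Xv)) _.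
by apply: ler_wpM2l => //; exact: euler_ball.
Qed.

Lemma euler_shift h k j : 0 <= h -> (k + j)%:R * h <= T0 ->
  N (fun x => euler h v (k + j) x - euler h v k x) <= j%:R * h * (A * rho).
Proof.
move=> h0; elim: j => [|j IH] kT.
  rewrite addn0 !mul0r (_ : (fun x => _) = (fun x => 0 * v x)).
    by rewrite NZ// normr0 mul0r.
  by apply/funext => x; ring.
have kT' : (k + j)%:R * h <= T0.
  by apply: le_trans kT; apply: ler_wpM2r => //; rewrite ler_nat addnS.
have Xk := X_euler h k Xv; have Xj := X_euler h (k + j) Xv.
rewrite addnS (_ : (fun x => _) = (fun x => (euler h v (k + j) x - euler h v k x) + h * F (euler h v (k + j)) x)).
  apply: le_trans (ND (XB Xj Xk) (XZ h (XF Xj))) _.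
  rewrite -natr1 mulrDl mulrDl mul1r; apply: lerD; first exact: IH.
  by rewrite NZ ?(ger0_norm h0); [apply: ler_wpM2l => //; exact: euler_F|exact: XF].
by apply/funext => x; rewrite /= /step; ring.
Qed.

Lemma halving_arith (h d e c : R) k : 0 <= h -> 0 <= c -> 0 <= e ->
  d <= expR (L * (k%:R * h)) * (k%:R * h) * (h * c) -> e <= h * (h * c) ->
  d + h * (L * d) + e <= expR (L * (k.+1%:R * h)) * (k.+1%:R * h) * (h * c).
Proof.
move=> h0 c0 e0 dk ek.
have -> : k.+1%:R * h = k%:R * h + h by rewrite -natr1 mulrDl mul1r.
rewrite [L * (_ + _)]mulrDr expRD.
have E1 : 1 <= expR (L * (k%:R * h)) by rewrite -expR0 ler_expR mulr_ge0// mulr_ge0.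
have E2 : 1 + L * h <= expR (L * h) by exact: expR_ge1Dx.
have kh0 : 0 <= k%:R * h by rewrite mulr_ge0.
have hc0 : 0 <= h * c by rewrite mulr_ge0.
have Lh0 : 0 <= L * h by rewrite mulr_ge0.
have -> : d + h * (L * d) + e = (1 + L * h) * d + e by ring.
move: E1 E2 dk ek kh0 hc0 Lh0.
move: (expR (L * (k%:R * h))) => a; move: (expR (L * h)) => b.
move: (k%:R * h) (h * c) (L * h) => kh hc Lh.
by move=> E1 E2 dk ek kh0 hc0 Lh0; exact: step_arith h0 E1 E2 dk ek kh0 hc0 Lh0.
Qed.

(** Against a full step, two half steps multiply the previous error by 1 + L h and add (h / 2) (F m
    - F a), where m is the midpoint. As m - a is O(h), this local error is O(h^2), and the errors
    accumulate to O(h). *)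
Lemma euler_halving h k : 0 <= h -> k%:R * h <= T0 ->
  N (fun x => euler (h / 2) v (k.*2) x - euler h v k x) <=
    expR (L * (k%:R * h)) * (k%:R * h) * (h * (L * A * rho)).
Proof.
move=> h0; elim: k => [|k IH] kT.
  rewrite !mul0r mulr0 mul0r (_ : (fun x => _) = (fun x => 0 * v x)).
    by rewrite NZ// normr0 mul0r.
  by apply/funext => x; rewrite /=; ring.
have kT' : k%:R * h <= T0.
  by apply: le_trans kT; apply: ler_wpM2r => //; rewrite ler_nat.
have h20 : 0 <= h / 2 by rewrite divr_ge0.
have T1 : (k.*2)%:R * (h / 2) <= T0.
  by rewrite -muln2 natrM (_ : _ * _ * _ = k%:R * h)//; field.
have T2 : (k.*2.+1)%:R * (h / 2) <= T0.
  rewrite -natr1 -muln2 natrM (_ : _ * (h / 2) = k%:R * h + h / 2); last by field.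
  move: kT; rewrite -natr1 mulrDl mul1r; move: (k%:R * h) => kh; lra.
have [a aE] : exists a : T -> R, a = euler (h / 2) v k.*2 by eexists.
have [b bE] : exists b : T -> R, b = euler h v k by eexists.
have [m mE] : exists m : T -> R, m = euler (h / 2) v k.*2.+1 by eexists.
have Xa : X a by rewrite aE; exact: X_euler.
have Xb : X b by rewrite bE; exact: X_euler.
have Xm : X m by rewrite mE; exact: X_euler.
have Na : N a <= rho by rewrite aE; exact: euler_ball.
have Nb : N b <= rho by rewrite bE; exact: euler_ball.
have Nm : N m <= rho by rewrite mE; exact: euler_ball.
have E : (fun x => euler (h / 2) v (k.+1.*2) x - euler h v k.+1 x) =
  (fun x => (a x - b x) + h * (F a x - F b x) + (h / 2) * (F m x - F a x)).
  apply/funext => x; rewrite doubleS.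
  have -> : euler (h / 2) v k.*2.+2 x = m x + (h / 2) * F m x by rewrite mE.
  have -> : m x = a x + (h / 2) * F a x by rewrite mE aE.
  have -> : euler h v k.+1 x = b x + h * F b x by rewrite bE.
  by field.
have mDa : N (fun x => m x - a x) <= h / 2 * (A * rho).
  rewrite (_ : (fun x => _) = (fun x => (h / 2) * F a x)); last first.
    by apply/funext => y; rewrite mE aE /= /step; ring.
  rewrite NZ ?(ger0_norm h20); last exact: XF.
  by apply: ler_wpM2l => //; rewrite aE; exact: euler_F.
have X1 := XB Xa Xb; have X2 := XB (XF Xa) (XF Xb); have X3 := XB (XF Xm) (XF Xa).
rewrite E; apply: le_trans (ND (XD X1 (XZ h X2)) (XZ (h / 2) X3)) _.
apply: le_trans (lerD (ND X1 (XZ h X2)) (lexx _)) _.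
rewrite !NZ// (ger0_norm h0) (ger0_norm h20).
have IH' := IH kT'; rewrite -aE -bE in IH'.
apply: le_trans (halving_arith (e := h / 2 * N (fun x => F m x - F a x)) h0 _ _ IH' _).
- by apply: lerD => //; apply: lerD => //; apply: ler_wpM2l => //; exact: lip.
- by rewrite !mulr_ge0// rho_ge0.
- by rewrite mulr_ge0.
- have AR : 0 <= A * rho by rewrite mulr_ge0// rho_ge0.
  have l1 : N (fun x => F m x - F a x) <= L * (h / 2 * (A * rho)).
    by apply: le_trans (lip Xm Xa Nm Na) _; apply: ler_wpM2l.
  apply: le_trans (ler_wpM2l h20 l1) _.
  rewrite (_ : h / 2 * (L * (h / 2 * (A * rho))) = (h * (h * (L * A * rho))) / 4); last by field.
  rewrite ler_pdivrMr// ler_peMr ?ler1n// !mulr_ge0//; exact: rho_ge0.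
Qed.

(** After j steps the polygon has moved by j h F up to a quadratic error: F changes by at most L
    times the distance covered. This becomes the differentiability of the limit. *)
Lemma euler_sum h i j : 0 <= h -> (i + j)%:R * h <= T0 ->
  N (fun x => euler h v (i + j) x - euler h v i x - (j%:R * h) * F (euler h v i) x) <=
  L * A * rho * (j%:R * h) ^+ 2.
Proof.
move=> h0; elim: j => [|j IH] kT.
  rewrite !mul0r expr0n mulr0 addn0 (_ : (fun x => _) = (fun x => 0 * v x)).
    by rewrite NZ// normr0 mul0r.
  by apply/funext => x; ring.
have kT' : (i + j)%:R * h <= T0.
  by apply: le_trans kT; apply: ler_wpM2r => //; rewrite ler_nat addnS.
have iT : i%:R * h <= T0.
  by apply: le_trans kT; apply: ler_wpM2r => //; rewrite ler_nat leq_addr.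
have Xi := X_euler h i Xv; have Xj := X_euler h (i + j) Xv.
have X1 := XB (XB Xj Xi) (XZ (j%:R * h) (XF Xi)); have X2 := XB (XF Xj) (XF Xi).
rewrite addnS (_ : (fun x => _) = (fun x => (euler h v (i + j) x - euler h v i x - (j%:R * h) * F (euler h v i) x)
   + h * (F (euler h v (i + j)) x - F (euler h v i) x))); last first.
  by apply/funext => x; rewrite /= /step -natr1; ring.
apply: le_trans (ND X1 (XZ h X2)) _; rewrite NZ// (ger0_norm h0).
have l1 : N (fun x => F (euler h v (i + j)) x - F (euler h v i) x) <= L * (j%:R * h * (A * rho)).
  apply: le_trans (lip Xj Xi _ _) _; [exact: euler_ball|exact: euler_ball|].
  by apply: ler_wpM2l => //; exact: euler_shift.
apply: le_trans (lerD (IH kT') (ler_wpM2l h0 l1)) _.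
rewrite (_ : h * _ = L * A * rho * (j%:R * h * h)); last by ring.
rewrite -mulrDr; apply: ler_wpM2l; first by rewrite !mulr_ge0// rho_ge0.
have jh : 0 <= j%:R * h by rewrite mulr_ge0.
rewrite -natr1 mulrDl mul1r; move: (j%:R * h) jh => q q0; nra.
Qed.

Definition grid n t : nat := Num.truncn (t * 2 ^+ n).
Definition mesh n : R := (2 ^+ n)^-1.

Lemma mesh_ge0 n : 0 <= mesh n. Proof. by rewrite invr_ge0 exprn_ge0. Qed.
Lemma mesh_le1 n : mesh n <= 1. Proof. by rewrite invf_le1 ?exprn_gt0// exprn_ege1// ler1n. Qed.
Lemma meshS n : mesh n / 2 = mesh n.+1.
Proof. by rewrite /mesh exprS invfM mulrC. Qed.

Lemma grid_itv n t : 0 <= t -> (grid n t)%:R * mesh n <= t < (grid n t)%:R * mesh n + mesh n.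
Proof.
move=> t0; have p0 : 0 < 2 ^+ n :> R by rewrite exprn_gt0.
have := @truncn_itv R (t * 2 ^+ n) (mulr_ge0 t0 (ltW p0)).
rewrite -/(grid n t) => /andP[h1 h2]; apply/andP; split; first by rewrite ler_pdivrMr.
by rewrite -{2}[mesh n]mul1r -mulrDl natr1 ltr_pdivlMr.
Qed.

Lemma gridS n t : 0 <= t -> exists b : bool, grid n.+1 t = ((grid n t).*2 + b)%N.
Proof.
move=> t0; have := @truncn_itv R (t * 2 ^+ n) (mulr_ge0 t0 (exprn_ge0 n (ler0n R 2))).
rewrite /grid exprS (_ : t * (2 * _) = 2 * (t * 2 ^+ n)); last by ring.
move: (t * 2 ^+ n) => y; move: (Num.truncn y) => k /andP[h1 h2].
case: (ltP (2 * y) (k.*2.+1)%:R) => hy.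
  exists false; rewrite addn0; apply: truncn_def; rewrite hy andbT -muln2 natrM mulrC.
  by rewrite ler_pM2l.
exists true; rewrite addn1; apply: truncn_def; rewrite hy/= -doubleS -muln2 natrM mulrC.
by rewrite ltr_pM2r.
Qed.

(** The value at the last grid point before t, without interpolation: the resulting error is of the
    order of the mesh and disappears in the limit. *)
Definition polygon n t : T -> R := euler (mesh n) v (grid n t).

(** The two terms of the constant are the halving error at a common grid point and, when the finer
    grid has one more point before t, one further step of length [mesh n.+1]. *)
Lemma polygon_cauchy n t : 0 <= t <= T0 ->
  N (fun x => polygon n.+1 t x - polygon n t x) <= (expR (L * T0) * T0 * (L * A * rho) + A * rho) / 2 ^+ n.
Proof.
move=> /andP[t0 tT]; have [b hb] := gridS n t0.
have /andP[g1 _] := grid_itv n t0; have /andP[g2 _] := grid_itv n.+1 t0.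
have gT := le_trans g1 tT; have gT2 := le_trans g2 tT.
have h0 := mesh_ge0 n; have h1 := mesh_ge0 n.+1.
have [g gE] : exists g, g = grid n t by eexists.
rewrite hb in gT2; rewrite -gE in gT gT2.
have Xa := X_euler (mesh n.+1) (g.*2 + b) Xv; have Xb := X_euler (mesh n.+1) g.*2 Xv.
have Xc := X_euler (mesh n) g Xv.
rewrite /polygon hb -gE (_ : (fun x => _) = (fun x => (euler (mesh n.+1) v (g.*2 + b) x - euler (mesh n.+1) v g.*2 x)
   + (euler (mesh n.+1) v g.*2 x - euler (mesh n) v g x))); last by apply/funext => x; ring.
apply: le_trans (ND (XB Xa Xb) (XB Xb Xc)) _.
have s1 := euler_shift h1 gT2; have s2 := euler_halving h0 gT; rewrite meshS in s2.
apply: le_trans (lerD s1 s2) _.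
rewrite -/(mesh n) mulrDl addrC; apply: lerD.
  rewrite [leLHS](_ : _ = expR (L * (g%:R * mesh n)) * (g%:R * mesh n) * (L * A * rho) * mesh n); last by ring.
  have gh0 : 0 <= g%:R * mesh n by rewrite mulr_ge0.
  apply: ler_wpM2r => //; apply: ler_wpM2r; first by rewrite !mulr_ge0// rho_ge0.
  by apply: ler_pM => //; rewrite ler_expR; exact: ler_wpM2l.
rewrite [leRHS]mulrC; apply: ler_wpM2r; first by rewrite mulr_ge0// rho_ge0.
rewrite -meshS; case: b {hb gT2 Xa s1} => /=; lra.
Qed.

Lemma polygon_ball n t : 0 <= t <= T0 -> N (polygon n t) <= rho.
Proof.
move=> /andP[t0 tT]; apply: euler_ball; first exact: mesh_ge0.
by have /andP[g1 _] := grid_itv n t0; exact: le_trans tT.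
Qed.

(** The grid times differ from r and t by less than a mesh. Replacing the discrete elapsed time by r
    - t costs [2 * T0 + 1] in the square and [A * rho] in the linear term, both multiplied by the
    mesh. *)
Lemma polygon_quadratic n t r : 0 <= t -> t <= r -> r <= T0 ->
  N (fun x => polygon n r x - polygon n t x - (r - t) * F (polygon n t) x) <=
   L * A * rho * (r - t) ^+ 2 + (L * A * rho * (2 * T0 + 1) + A * rho) * mesh n.
Proof.
move=> t0 tr rT; have r0 := le_trans t0 tr.
have h0 := mesh_ge0 n; have h1 := mesh_le1 n.
have /andP[t1 t2] := grid_itv n t0; have /andP[r1 r2] := grid_itv n r0.
have gg : (grid n t <= grid n r)%N.
  by rewrite /grid le_truncn// ler_wpM2r ?exprn_ge0.
have [j jE] : exists j, grid n r = (grid n t + j)%N by exists (grid n r - grid n t)%N; rewrite subnKC.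
have jT : (grid n t + j)%:R * mesh n <= T0 by rewrite -jE; exact: le_trans r1 rT.
have iT : (grid n t)%:R * mesh n <= T0 by apply: le_trans t1 (le_trans tr rT).
have S := euler_sum h0 jT; rewrite -jE in S.
have Xi := X_euler (mesh n) (grid n t) Xv; have Xj := X_euler (mesh n) (grid n r) Xv.
have X1 := XB (XB Xj Xi) (XZ (j%:R * mesh n) (XF Xi)).
rewrite /polygon (_ : (fun x => _) = (fun x => (euler (mesh n) v (grid n r) x - euler (mesh n) v (grid n t) x
   - (j%:R * mesh n) * F (euler (mesh n) v (grid n t)) x) + (j%:R * mesh n - (r - t)) * F (euler (mesh n) v (grid n t)) x)); last first.
  by apply/funext => x; ring.
apply: le_trans (ND X1 (XZ _ (XF Xi))) _; rewrite NZ; last exact: XF.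
have dj : `|j%:R * mesh n - (r - t)| <= mesh n.
  move: r1 r2 t1 t2; rewrite jE natrD mulrDl.
  move: (_ * mesh n) (_ * mesh n) => a b r1 r2 t1 t2.
  rewrite ler_norml; apply/andP; split; lra.
have fi := euler_F h0 iT.
have AR : 0 <= A * rho by rewrite mulr_ge0// rho_ge0.
have LAR : 0 <= L * A * rho by rewrite -mulrA mulr_ge0.
apply: le_trans (lerD S (ler_pM (normr_ge0 _) (N_ge0 _) dj fi)) _.
have jh : 0 <= j%:R * mesh n by rewrite mulr_ge0.
rewrite [(_ + A * rho) * mesh n]mulrDl addrA; apply: lerD; last by rewrite mulrC.
rewrite -[X in _ + X]mulrA -mulrDr; apply: ler_wpM2l => //.
move: dj; rewrite ler_norml => /andP[d1 d2].
move: h0 h1 jh d1 d2; move: (j%:R * mesh n) => q; move: (mesh n) => h.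
by move=> h0 h1 q0 d1 d2; exact: sqr_arith.
Qed.

End bounded.

Lemma polygon0 v n : polygon v n 0 = v.
Proof. by rewrite /polygon /grid mul0r truncn0. Qed.

(** The limit is determined only up to functions of seminorm 0. At t = 0 it is chosen to be v
    itself, so that the initial value is attained exactly; for t < 0 the choice is immaterial. *)
Lemma polygon_limit v t : X v -> exists w, (t = 0 -> w = v) /\ (0 <= t -> X w /\
  exists2 C, 0 <= C & forall n, N (fun x => polygon v n t x - w x) <= C / 2 ^+ n).
Proof.
move=> Xv; have N0 : N (fun x => v x - v x) = 0.
  rewrite (_ : (fun x => _) = (fun x => 0 * v x)); first by rewrite NZ// normr0 mul0r.
  by apply/funext => x; ring.
have [->|t0] := eqVneq t 0.
  exists v; split => // _; split => //; exists 0 => // n.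
  by rewrite polygon0 N0 mul0r.
case: (leP 0 t) => ht; last by exists v; split => // h; move: t0; rewrite h eqxx.
have [L L0 lip] := lipschitz (expR (A * t) * N v).
have tt : 0 <= t <= t by rewrite ht lexx.
have [w Xw wE] := complete (fun n => X_euler (mesh n) (grid n t) Xv)
  (fun n => polygon_cauchy Xv L0 erefl lip n tt).
exists w; split; first by move=> h; move: t0; rewrite h eqxx.
move=> _; split => //.
have AR : 0 <= A * (expR (A * t) * N v) by rewrite !mulr_ge0// expR_ge0.
eexists; last by move=> n; exact: wE.
by rewrite mulr_ge0// addr_ge0// !mulr_ge0// expR_ge0.
Qed.

(** The quadratic remainder expresses u' = F u uniformly on bounded time intervals, in a form that
    passes directly to the limit of the polygons. *)
Theorem euler_solution v : X v -> exists u : R -> T -> R,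
  [/\ u 0 = v, forall t, 0 <= t -> X (u t) &
    forall T0, 0 <= T0 -> exists2 C, 0 <= C & forall t r, 0 <= t <= T0 -> 0 <= r <= T0 ->
      N (u t) <= expR (A * T0) * N v /\
      N (fun x => u r x - u t x - (r - t) * F (u t) x) <= C * (r - t) ^+ 2].
Proof.
move=> Xv; have [u uP] := choice (fun t => polygon_limit t Xv).
exists u; split; first by have [+ _] := uP 0; exact.
  by move=> t t0; have [_ /(_ t0)[]] := uP t.
move=> T0 T00.
have [L L0 lip] := lipschitz (expR (A * T0) * N v).
have [rho rhoE] : exists rho, rho = expR (A * T0) * N v by eexists.
rewrite -rhoE in lip; rewrite -rhoE.
have r0 : 0 <= rho by rewrite rhoE mulr_ge0// expR_ge0.
have AR : 0 <= A * rho by exact: mulr_ge0.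
have LAR : 0 <= L * A * rho by rewrite -mulrA mulr_ge0.
have Xu t : 0 <= t -> X (u t) by move=> t0; have [_ /(_ t0)[]] := uP t.
have Xp n t : X (polygon v n t) by exact: X_euler.
have uball t : 0 <= t <= T0 -> N (u t) <= rho.
  move=> tT; have /andP[t0 _] := tT; have [_ /(_ t0)[Xt [C C0 hC]]] := uP t.
  apply: (@le_halves _ _ _ C) => n.
  rewrite (_ : u t = fun x => polygon v n t x - (polygon v n t x - u t x)); last first.
    by apply/funext => x; ring.
  apply: le_trans (NB (Xp n t) (XB (Xp n t) Xt)) _.
  by apply: lerD => //; exact: (polygon_ball Xv rhoE).
have quad t r : 0 <= t -> t <= r -> r <= T0 ->
  N (fun x => u r x - u t x - (r - t) * F (u t) x) <= (L * A * rho) * (r - t) ^+ 2.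
  move=> t0 tr rT; have r00 := le_trans t0 tr.
  have tT : 0 <= t <= T0 by rewrite t0 (le_trans tr).
  have [_ /(_ t0)[Xt [Ct Ct0 ht]]] := uP t; have [_ /(_ r00)[Xr [Cr Cr0 hr]]] := uP r.
  have rt0 : 0 <= r - t by rewrite subr_ge0.
  (* The errors collected here are the approximation errors at r and t, the mesh terms, and the
     change of F between the polygon and its limit. *)
  apply: (@le_halves _ _ _ (Cr + Ct + (L * A * rho * (2 * T0 + 1) + A * rho) + (r - t) * (L * Ct))) => n.
  have Y1 := XB (Xp n r) Xr; have Y2 := XB (Xp n t) Xt.
  have Y3 := XB (XB (Xp n r) (Xp n t)) (XZ (r - t) (XF (Xp n t))).
  have Y4 := XB (XF (Xp n t)) (XF Xt).
  have q := polygon_quadratic Xv L0 rhoE lip n t0 tr rT.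
  have l := lip _ _ (Xp n t) Xt (polygon_ball Xv rhoE n tT) (uball t tT).
  rewrite (_ : (fun x => _) = (fun x => ((polygon v n r x - polygon v n t x - (r - t) * F (polygon v n t) x) +
    (polygon v n t x - u t x)) - (polygon v n r x - u r x) + (r - t) * (F (polygon v n t) x - F (u t) x))); last first.
    by apply/funext => x; ring.
  apply: le_trans (ND (XB (XD Y3 Y2) Y1) (XZ (r - t) Y4)) _.
  rewrite (NZ _ Y4) (ger0_norm rt0).
  have s1 := le_trans (NB (XD Y3 Y2) Y1) (lerD (ND Y3 Y2) (lexx _)).
  have s2 := lerD (lerD q (ht n)) (hr n).
  have s3 := ler_wpM2l rt0 (le_trans l (ler_wpM2l L0 (ht n))).
  apply: le_trans (lerD (le_trans s1 s2) s3) _.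
  apply: eq_ler; rewrite /mesh.
  by move: (2 ^+ n)^-1 => z; ring.
exists (L * A * rho + L * (L * A * rho * T0 + A * rho)).
  by rewrite addr_ge0// mulr_ge0// addr_ge0// mulr_ge0.
move=> t r tT rT; split; first exact: uball.
have /andP[t0 tT0] := tT; have /andP[r00 rT0] := rT.
case: (leP t r) => tr.
  apply: le_trans (quad _ _ t0 tr rT0) _.
  by apply: ler_wpM2r; [exact: sqr_ge0|rewrite lerDl mulr_ge0// addr_ge0// mulr_ge0].
(* Backwards in time the expansion is taken at the earlier time r; passing from F (u r) to F (u t)
   costs another quadratic term by the Lipschitz bound. *)
have Q := quad _ _ r00 (ltW tr) tT0.
have [Xt Xr] := (Xu t t0, Xu r r00).
have tr0 : 0 <= t - r by rewrite subr_ge0 ltW.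
have Y1 := XB (XB Xt Xr) (XZ (t - r) (XF Xr)).
have Y2 := XB (XF Xt) (XF Xr).
have dtr : N (fun x => u t x - u r x) <= (t - r) * (L * A * rho * T0 + A * rho).
  rewrite (_ : (fun x => _) = (fun x => (u t x - u r x - (t - r) * F (u r) x) + (t - r) * F (u r) x)); last first.
    by apply/funext => x; ring.
  apply: le_trans (ND Y1 (XZ _ (XF Xr))) _; rewrite (NZ _ (XF Xr)) (ger0_norm tr0).
  rewrite mulrDr; apply: lerD.
    apply: le_trans Q _; rewrite (_ : _ * _ ^+ 2 = (t - r) * (L * A * rho * (t - r))); last by ring.
    by apply: ler_wpM2l => //; apply: ler_wpM2l => //; lra.
  apply: ler_wpM2l => //; apply: le_trans (NF Xr) _; apply: ler_wpM2l => //; exact: uball.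
rewrite (_ : (fun x => _) = (fun x => (t - r) * (F (u t) x - F (u r) x) - (u t x - u r x - (t - r) * F (u r) x))); last first.
  by apply/funext => x; ring.
apply: le_trans (NB (XZ _ Y2) Y1) _; rewrite (NZ _ Y2) (ger0_norm tr0).
have l := le_trans (lip _ _ Xt Xr (uball t tT) (uball r rT)) (ler_wpM2l L0 dtr).
apply: le_trans (lerD (ler_wpM2l tr0 l) Q) _.
apply: eq_ler; ring.
Qed.

End euler.

(** * Elementary inequalities for the damped equation *)

Lemma sum4_le {R : realType} (a b c d m : R) : a <= m -> b <= m -> c <= m -> d <= m ->
  a + b + (c + d) <= 4 * m.
Proof. lra. Qed.

Lemma dist_le {R : realType} (a b t : R) : 0 <= a -> a <= t -> 0 <= b -> b <= t -> `|b - a| <= t.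
Proof. by move=> a0 at0 b0 bt0; rewrite ler_norml; apply/andP; split; lra. Qed.

Lemma sqr_norm_le {R : realType} (n z k : R) : 0 <= n -> n <= `|z| * k -> n ^+ 2 <= k ^+ 2 * z ^+ 2.
Proof.
move=> n0 nk; rewrite -[z ^+ 2]real_normK ?num_real// -exprMn mulrC.
by rewrite ler_sqr ?nnegrE//; exact: le_trans nk.
Qed.

(** 2 n <= 1 + n^2: dividing by 1 + n^2 absorbs the factor n of the tame estimate and leaves a bound
    linear in a. *)
Lemma growth_arith {R : realType} (M n a C : R) : 0 <= n -> 0 <= a -> 0 <= C ->
  (1 + M ^+ 2) / (1 + n ^+ 2) * (C * (a * n + n * a)) <= (1 + M ^+ 2) * C * a.
Proof.
move=> n0 a0 C0; have d0 : 0 < 1 + n ^+ 2 by have := sqr_ge0 n; lra.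
rewrite (_ : _ * _ = ((1 + M ^+ 2) * C * a) * ((n + n) / (1 + n ^+ 2))); last by field; rewrite gt_eqF.
rewrite ler_piMr//.
  by rewrite !mulr_ge0// addr_ge0// sqr_ge0.
by rewrite ler_pdivrMr// mul1r; have := sqr_ge0 (n - 1); nra.
Qed.

Lemma factor_lip {R : realType} (m a b rho d : R) : 0 <= m -> 0 <= a -> a <= rho -> 0 <= b -> b <= rho ->
  `|a - b| <= d -> `|m / (1 + a ^+ 2) - m / (1 + b ^+ 2)| <= m * (2 * rho * d).
Proof.
move=> m0 a0 ar b0 br abd.
have da : 1 <= 1 + a ^+ 2 by have := sqr_ge0 a; lra.
have db : 1 <= 1 + b ^+ 2 by have := sqr_ge0 b; lra.
have [da0 db0] : 0 < 1 + a ^+ 2 /\ 0 < 1 + b ^+ 2 by lra.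
rewrite (_ : _ - _ = m * ((b - a) * (a + b) / ((1 + a ^+ 2) * (1 + b ^+ 2)))); last first.
  by field; rewrite !gt_eqF.
rewrite normrM (ger0_norm m0); apply: ler_wpM2l => //.
have dd : 1 <= (1 + a ^+ 2) * (1 + b ^+ 2) by apply: mulr_ege1.
have dd0 : 0 < (1 + a ^+ 2) * (1 + b ^+ 2) by rewrite mulr_gt0.
rewrite normrM normfV (gtr0_norm dd0) ler_pdivrMr//.
have ab0 : 0 <= a + b by lra.
rewrite normrM distrC (ger0_norm ab0).
apply: (@le_trans _ _ (2 * rho * d)).
  by rewrite mulrC; apply: ler_pM => //; lra.
rewrite ler_peMr// mulr_ge0//; [lra|exact: le_trans abd].
Qed.

(** Over 2^n equal pieces of [0, t] the increments sum to at most 2^n K (t / 2^n)^2, which tends to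
    0. *)
Lemma quadratic_constant {R : realType} (q : R -> R) (K t : R) : 0 <= t ->
  (forall a b, 0 <= a <= t -> 0 <= b <= t -> `|q b - q a| <= K * (b - a) ^+ 2) -> q t = q 0.
Proof.
move=> t0 hq; apply/eqP; rewrite -subr_eq0 -normr_le0.
apply: (@le_halves _ _ _ (K * t ^+ 2)) => n; rewrite add0r.
have p0 : 0 < 2 ^+ n :> R by rewrite exprn_gt0.
have [d dE] : exists d, d = t / 2 ^+ n by eexists.
have d0 : 0 <= d by rewrite dE divr_ge0// ltW.
have step j : (j <= 2 ^ n)%N -> `|q (j%:R * d) - q 0| <= j%:R * (K * d ^+ 2).
  elim: j => [|j IH] jn; first by rewrite !mul0r subrr normr0.
  have jt i : (i <= 2 ^ n)%N -> 0 <= i%:R * d <= t.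
    move=> ni; rewrite mulr_ge0//= dE mulrCA ler_piMr// ler_pdivrMr// mul1r -natrX ler_nat//.
  have h := hq _ _ (jt _ (ltnW jn)) (jt _ jn).
  have E : j.+1%:R * d - j%:R * d = d by rewrite -natr1; ring.
  rewrite E in h; rewrite -(subrKA (q (j%:R * d))) addrC.
  have -> : j.+1%:R * (K * d ^+ 2) = j%:R * (K * d ^+ 2) + K * d ^+ 2 by rewrite -natr1; ring.
  apply: le_trans (ler_normD _ _) _; apply: lerD => //.
  by apply: IH; exact: ltnW.
have := step _ (leqnn _).
have E : (2 ^ n)%:R * d = t by rewrite dE natrX mulrC divfK// gt_eqF.
rewrite E natrX => h; apply: le_trans h _; apply: eq_ler.
by rewrite dE; field; rewrite gt_eqF.
Qed.

(** * Global existence *)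

Section spectral.
Context {R : realType}.
Notation mu := (@lebesgue_measure R).
Implicit Types (f g v U V W Z : R -> R) (s : R).

Lemma Xs_complete s (f : nat -> R -> R) (C : R) : (forall n, Xs s (f n)) ->
  (forall n, ns s (fun x => f n.+1 x - f n x) <= C / 2 ^+ n) ->
  exists2 v, Xs s v & forall n, ns s (fun x => f n x - v x) <= 2 * C / 2 ^+ n.
Proof.
move=> Xf fC.
have h n : nrm (fun x => wt s x * f n.+1 x - wt s x * f n x) <= C / 2 ^+ n.
  by have := fC n; rewrite /ns; under eq_fun do rewrite mulrBr.
have [g [Lg gn]] := L2_complete Xf h.
have E x : wt s x * (wt (- s) x * g x) = g x by rewrite mulrA -wtD subrr wt0 mul1r.
exists (fun x => wt (- s) x * g x).
  by rewrite /Xs; under eq_fun do rewrite E.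
move=> n; have := gn n; rewrite /ns; congr (nrm _ <= _).
by apply/funext => x; rewrite mulrBr E.
Qed.

Lemma ns_dist s U V : Xs s U -> Xs s V -> `|ns s U - ns s V| <= ns s (fun x => U x - V x).
Proof.
move=> XU XV; have E : (fun x => wt s x * (U x - V x)) = (fun x => wt s x * U x - wt s x * V x).
  by apply/funext => x; rewrite mulrBr.
by rewrite /ns E; exact: nrm_dist.
Qed.

Lemma nl_lip (l1 l5 s : R) : 3 / 2 < s -> exists2 C, 0 <= C & forall rho U V, Xs s U -> Xs s V ->
  ns s U <= rho -> ns s V <= rho ->
  Xs s (fun x => nl l1 l5 U U x - nl l1 l5 V V x) /\
  ns s (fun x => nl l1 l5 U U x - nl l1 l5 V V x) <= C * rho * ns s (fun x => U x - V x).
Proof.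
move=> s32; have s1 : 1 <= s by lra.
have [C C0 hC] := nl_tame l1 l5 s32.
exists (4 * C); first by lra.
move=> rho U V XU XV Ur Vr.
have [X1U N1U] := Xs_le s1 XU; have [X1V N1V] := Xs_le s1 XV.
have XD := XsB XU XV; have [X1D N1D] := Xs_le s1 XD.
have [Y1 M1] := hC _ _ XD XU; have [Y2 M2] := hC _ _ XD XV.
rewrite (nl_diff l1 l5 X1U X1V); split; first exact: XsD.
apply: le_trans (nsD Y1 Y2) _; apply: le_trans (lerD M1 M2) _.
have [d0 d10] := (ns_ge0 s (fun x => U x - V x), ns_ge0 1 (fun x => U x - V x)).
have [u0 v0] := (ns_ge0 1 U, ns_ge0 1 V).
have [su0 sv0] := (ns_ge0 s U, ns_ge0 s V).
have U1r := le_trans N1U Ur. have V1r := le_trans N1V Vr.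
move: d0 d10 u0 v0 su0 sv0 U1r V1r N1D Ur Vr.
move: (ns s (fun x => U x - V x)) (ns 1 (fun x => U x - V x)) (ns 1 U) (ns 1 V) (ns s U) (ns s V).
move=> d d' u u' w w' d0 d10 u0 v0 su0 sv0 U1r V1r N1D Ur Vr.
have r0 := le_trans su0 Ur.
have a1 : d * u <= rho * d by rewrite mulrC; apply: ler_pM.
have a2 : d' * w <= rho * d by rewrite mulrC; apply: ler_pM.
have a3 : d * u' <= rho * d by rewrite mulrC; apply: ler_pM.
have a4 : d' * w' <= rho * d by rewrite mulrC; apply: ler_pM.
rewrite -mulrDr (_ : 4 * C * rho * d = C * (4 * (rho * d))); last by ring.
by apply: ler_wpM2l => //; exact: sum4_le.
Qed.

(* The factor equals 1 when ns 1 U = M, and makes the growth linear. *)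
Definition damped (M l1 l5 : R) U (x : R) := (1 + M ^+ 2) / (1 + ns 1 U ^+ 2) * nl l1 l5 U U x.

Lemma damped_growth (M l1 l5 s : R) : 3 / 2 < s -> exists2 A, 0 <= A & forall U, Xs s U ->
  Xs s (damped M l1 l5 U) /\ ns s (damped M l1 l5 U) <= A * ns s U.
Proof.
move=> s32; have [C C0 hC] := nl_tame l1 l5 s32.
exists ((1 + M ^+ 2) * C); first by rewrite mulr_ge0// addr_ge0// sqr_ge0.
move=> U XU; have [Y N] := hC _ _ XU XU.
split; first exact: XsZ.
rewrite nsZ// ger0_norm; last by rewrite divr_ge0// addr_ge0// sqr_ge0.
apply: le_trans (growth_arith M (ns_ge0 1 U) (ns_ge0 s U) C0).
by apply: ler_wpM2l => //; rewrite divr_ge0// addr_ge0// sqr_ge0.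
Qed.

Lemma damped_lipschitz (M l1 l5 s : R) : 3 / 2 < s -> forall rho, exists2 L, 0 <= L &
  forall U V, Xs s U -> Xs s V -> ns s U <= rho -> ns s V <= rho ->
  ns s (fun x => damped M l1 l5 U x - damped M l1 l5 V x) <= L * ns s (fun x => U x - V x).
Proof.
move=> s32; have s1 : 1 <= s by lra.
have [C C0 hC] := nl_tame l1 l5 s32; have [C' C'0 hC'] := nl_lip l1 l5 s32.
have [m mE] : exists m, m = 1 + M ^+ 2 by eexists.
have m0 : 0 <= m by rewrite mE addr_ge0// sqr_ge0.
move=> rho; case: (leP 0 rho) => r0; last first.
  exists 0 => // U V _ _ Ur _; have := le_lt_trans Ur r0.
  by rewrite ltNge ns_ge0.
exists (m * (C' * rho) + m * (2 * rho) * (C * (rho * rho + rho * rho))).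
  by rewrite addr_ge0// !mulr_ge0// addr_ge0// mulr_ge0.
move=> U V XU XV Ur Vr.
have [X1U N1U] := Xs_le s1 XU; have [X1V N1V] := Xs_le s1 XV.
have [X1D N1D] := Xs_le s1 (XsB XU XV).
have [Y1 M1] := hC' _ _ _ XU XV Ur Vr; have [Y2 M2] := hC _ _ XV XV.
have U1r := le_trans N1U Ur. have V1r := le_trans N1V Vr.
have df := factor_lip m0 (ns_ge0 1 U) U1r (ns_ge0 1 V) V1r (le_trans (ns_dist X1U X1V) N1D).
have E : (fun x => damped M l1 l5 U x - damped M l1 l5 V x) =
  (fun x => m / (1 + ns 1 U ^+ 2) * (nl l1 l5 U U x - nl l1 l5 V V x) +
   (m / (1 + ns 1 U ^+ 2) - m / (1 + ns 1 V ^+ 2)) * nl l1 l5 V V x).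
  by apply/funext => x; rewrite /damped -mE; move: (m / _) (m / _) => p q; ring.
rewrite E; apply: le_trans (nsD (XsZ _ Y1) (XsZ _ Y2)) _.
rewrite (nsZ _ Y1) (nsZ _ Y2).
have f0 : `|m / (1 + ns 1 U ^+ 2)| <= m.
  have dU : 1 <= 1 + ns 1 U ^+ 2 by rewrite lerDl sqr_ge0.
  have dU0 : 0 < 1 + ns 1 U ^+ 2 by exact: lt_le_trans ltr01 dU.
  by rewrite ger0_norm ?divr_ge0 ?(ltW dU0)// ler_pdivrMr// ler_peMr.
have nV : ns s (nl l1 l5 V V) <= C * (rho * rho + rho * rho).
  apply: le_trans M2 _; apply: ler_wpM2l => //.
  apply: lerD; first exact: ler_pM (ns_ge0 _ _) (ns_ge0 _ _) Vr V1r.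
  exact: ler_pM (ns_ge0 _ _) (ns_ge0 _ _) V1r Vr.
apply: le_trans (lerD (ler_pM (normr_ge0 _) (ns_ge0 _ _) f0 M1) (ler_pM (normr_ge0 _) (ns_ge0 _ _) df nV)) _.
apply: eq_ler.
by move: (ns s _) => d; ring.
Qed.

Lemma sqr_ns1_diff U V : Xs 1 U -> Xs 1 V ->
  ns 1 V ^+ 2 - ns 1 U ^+ 2 = 2 * I (fun x => (wt 1 x * U x) * (wt 1 x * (V x - U x)))
    + ns 1 (fun x => V x - U x) ^+ 2.
Proof.
move=> XU XV; have XD := XsB XV XU.
have := sqr_nrmD XU XD; rewrite /ns.
rewrite (_ : (fun x => wt 1 x * U x + wt 1 x * (V x - U x)) = (fun x => wt 1 x * V x)).
  by move=> ->; move: (I _) (nrm _) (nrm _) => p q r; ring.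
by apply/funext => x; ring.
Qed.

(** In the expansion of the squared H^1 norm the term linear in h vanishes by [nl_conserved],
    whatever the scalar k; what remains is quadratic in h. Here k will be the damping factor. *)
Lemma conserved_diff (s k h C l1 l5 : R) U V : 3 / 2 < s -> Xs s U -> Xs s V ->
  ns s (fun x => V x - U x - h * (k * nl l1 l5 U U x)) <= C * h ^+ 2 ->
  `|ns 1 V ^+ 2 - ns 1 U ^+ 2| <= 2 * (ns 1 U * (C * h ^+ 2)) + ns 1 (fun x => V x - U x) ^+ 2.
Proof.
move=> s32 XU XV hN; have s1 : 1 <= s by lra.
have [Cn _ hn] := nl_tame l1 l5 s32; have [XN _] := hn _ _ XU XU.
have [X1U _] := Xs_le s1 XU; have [X1V _] := Xs_le s1 XV; have [X1N _] := Xs_le s1 XN.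
have [X1E N1E] := Xs_le s1 (XsB (XsB XV XU) (XsZ h (XsZ k XN))).
rewrite sqr_ns1_diff//; apply: le_trans (ler_normD _ _) _.
rewrite (ger0_norm (sqr_ge0 _)) lerD2r normrM ger0_norm//.
apply: ler_wpM2l => //.
have -> : I (fun x => (wt 1 x * U x) * (wt 1 x * (V x - U x))) =
  I (fun x => (wt 1 x * U x) * (wt 1 x * (V x - U x - h * (k * nl l1 l5 U U x)))).
  have c := nl_conserved l1 l5 s32 XU.
  have L := L1M X1U X1N; have L' := L1M X1U X1E.
  have -> : (fun x => (wt 1 x * U x) * (wt 1 x * (V x - U x))) =
    (fun x => (wt 1 x * U x) * (wt 1 x * (V x - U x - h * (k * nl l1 l5 U U x))) +
      h * k * ((wt 1 x * U x) * (wt 1 x * nl l1 l5 U U x))).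
    by apply/funext => x; ring.
  by rewrite ID//; [rewrite IZl// c mulr0 addr0|exact: L1Zl].
apply: le_trans (cauchy_schwarz X1U X1E) _.
by apply: ler_wpM2l; [exact: nrm_ge0|exact: le_trans N1E hN].
Qed.

Theorem spectral_solution (l1 l5 s : R) U0 : 3 / 2 < s -> Xs s U0 -> exists U : R -> R -> R,
  [/\ U 0 = U0, forall t, 0 <= t -> Xs s (U t) &
    forall T, 0 <= T -> exists2 C, 0 <= C & forall t r, 0 <= t <= T -> 0 <= r <= T ->
      ns s (U t) <= C /\
      ns s (fun x => U r x - U t x - (r - t) * nl l1 l5 (U t) (U t) x) <= C * (r - t) ^+ 2].
Proof.
move=> s32 XU0; have s1 : 1 <= s by lra.
have [M ME] : exists M, M = ns 1 U0 by eexists.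
have [A A0 hA] := damped_growth M l1 l5 s32.
have [U [UE XU hU]] := @euler_solution R R (Xs s) (ns s) (@XsD R s) (@XsZ R s) (@ns_ge0 R s)
  (@nsD R s) (@nsZ R s) (@Xs_complete s) (damped M l1 l5) A (fun U XU => (hA U XU).1) A0
  (fun U XU => (hA U XU).2) (damped_lipschitz M l1 l5 s32) U0 XU0.
have Uq t : 0 <= t -> ns 1 (U t) ^+ 2 = M ^+ 2.
  move=> t0; have [C C0 hC] := hU t t0.
  have [rho rhoE] : exists rho, rho = expR (A * t) * ns s U0 by eexists.
  have r0 : 0 <= rho by rewrite rhoE mulr_ge0 ?expR_ge0 ?ns_ge0.
  rewrite ME -UE.
  (* The first part of the constant bounds the remainder paired with U a, the second the squared
     increment, U being Lipschitz in time on [0, t]. *)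
  apply: (@quadratic_constant _ (fun t => ns 1 (U t) ^+ 2) (2 * (rho * C) + (C * t + A * rho) ^+ 2)) => //.
  move=> a b aT bT; have /andP[a0 at0] := aT; have /andP[b0 bt0] := bT.
  have [Na Ea] := hC a b aT bT; rewrite -rhoE in Na.
  have [Xa Xb] := (XU a a0, XU b b0).
  have [X1a N1a] := Xs_le s1 Xa.
  have d := conserved_diff s32 Xa Xb Ea.
  apply: le_trans d _; rewrite [leRHS]mulrDl; apply: lerD.
    rewrite -[leRHS]mulrA -[in leRHS]mulrA; apply: ler_wpM2l => //.
    apply: ler_wpM2r; first by rewrite mulr_ge0// sqr_ge0.
    exact: le_trans N1a Na.
  have [XF NF] := hA _ Xa.
  have [X1D N1D] := Xs_le s1 (XsB Xb Xa).
  have Xe := XsB (XsB Xb Xa) (XsZ (b - a) XF).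
  have nD : ns s (fun x => U b x - U a x) <= `|b - a| * (C * t + A * rho).
    rewrite (_ : (fun x => _) = (fun x => (U b x - U a x - (b - a) * damped M l1 l5 (U a) x) +
      (b - a) * damped M l1 l5 (U a) x)); last by apply/funext => x; ring.
    apply: le_trans (nsD Xe (XsZ (b - a) XF)) _; rewrite (nsZ _ XF) mulrDr; apply: lerD.
      apply: le_trans Ea _; rewrite -real_normK ?num_real// expr2 mulrCA; apply: ler_wpM2l => //.
      apply: ler_wpM2l => //; exact: dist_le.
    apply: ler_wpM2l => //; apply: le_trans NF _; exact: ler_wpM2l.
  exact: sqr_norm_le (ns_ge0 _ _) (le_trans N1D nD).
exists U; split => // T T0; have [C C0 hC] := hU T T0.
have [rho rhoE] : exists rho, rho = expR (A * T) * ns s U0 by eexists.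
have r0 : 0 <= rho by rewrite rhoE mulr_ge0 ?expR_ge0 ?ns_ge0.
exists (C + rho); first exact: addr_ge0.
move=> t r tT rT; have [Nt Et] := hC t r tT rT; rewrite -rhoE in Nt.
have /andP[t0 _] := tT.
have dE : damped M l1 l5 (U t) = nl l1 l5 (U t) (U t).
  apply/funext => x; rewrite /damped Uq// divff ?mul1r//.
  by rewrite gt_eqF// ltr_pwDl// sqr_ge0.
rewrite dE in Et; split.
  by apply: le_trans Nt _; rewrite lerDr.
by apply: le_trans Et _; apply: ler_wpM2r; [exact: sqr_ge0|rewrite lerDl].
Qed.

End spectral.

(** * Limits of extended real functions along restricted neighbourhoods *)

Section filters.
Context {R : realType}.
Implicit Types (F : set_system R).

Lemma ereal_cvg0 F {FF : Filter F} (f : R -> \bar R) (g : R -> R) :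
  (\forall r \near F, exists2 a, f r = a%:E & `|a| <= g r) -> g r @[r --> F] --> 0 ->
  f r @[r --> F] --> 0%E.
Proof.
move=> h cg; apply: cvg_EFin.
  by apply: filterS h => r [a -> _].
apply: norm_cvg0; apply: squeeze_cvgr (@cvg_cst R _ _ _ _) cg.
near=> r; have [a fa ag] : exists2 a, f r = a%:E & `|a| <= g r by near: r.
by rewrite /= fa/= normr_ge0.
Unshelve. all: by end_near.
Qed.

Lemma cvg0_ereal F {FF : Filter F} (f : R -> \bar R) (a : R -> R) :
  (\forall r \near F, f r = (a r)%:E) -> f r @[r --> F] --> 0%E -> a r @[r --> F] --> 0.
Proof.
move=> h /fine_cvg; apply: cvg_trans; apply: near_eq_cvg.
by apply: filterS h => r /= ->.
Qed.

Lemma within_lipschitz_cvg0 (D : set R) (K t : R) : K * `|r - t| @[r --> within D (nbhs t)] --> 0.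
Proof.
apply: cvg_within_filter.
have c1 : `|r - t| @[r --> t] --> `|t - t|.
  by apply: cvg_norm; apply: cvgB; [exact: cvg_id|exact: cvg_cst].
have c : K * `|r - t| @[r --> t] --> K * `|t - t| by apply: cvgM => //; exact: cvg_cst.
by rewrite subrr normr0 mulr0 in c.
Qed.

Lemma near_nbhs_within (D : set R) (t : R) : \forall r \near within D (nbhs t), D r /\ `|r - t| < 1.
Proof.
rewrite near_withinE.
have : \forall r \near nbhs t, `|r - t| < 1.
  have c1 : `|r - t| @[r --> t] --> `|t - t|.
    by apply: cvg_norm; apply: cvgB; [exact: cvg_id|exact: cvg_cst].
  by apply: cvgr_lt c1 _ _; rewrite subrr normr0.
by apply: filterS => r h Dr.
Qed.

Lemma within_dlipschitz_cvg0 (D : set R) (K t : R) : K * `|r - t| @[r --> within D (t^')] --> 0.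
Proof. by apply: cvg_within_filter; exact: within_lipschitz_cvg0. Qed.

Lemma near_dnbhs_within (D : set R) (t : R) :
  \forall r \near within D (t^'), [/\ D r, `|r - t| < 1 & r != t].
Proof.
rewrite near_withinE near_withinE.
have := near_nbhs_within setT t; rewrite near_withinE.
by apply: filterS => r /(_ Logic.I)[_ h] rt Dr.
Qed.

End filters.

(** * The global solution in physical space *)

Section global.
Context {R : realType}.
Notation mu := (@lebesgue_measure R).
Implicit Types (f g v U V W Z : R -> R).

Lemma sobolev_norm_B (s : R) f g U W : hart f U -> hart g W -> Xs s U -> Xs s W ->
  sobolev_norm s (fun x => f x - g x) = (ns s (fun x => U x - W x))%:E.
Proof. by move=> hf hg XU XW; apply: sobolev_norm_Xs; [exact: hartB|exact: XsB]. Qed.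

Lemma hart_iht_Xs (s : R) U : 3 / 2 < s -> Xs s U -> hart (iht U) U.
Proof. by move=> s32 XU; have [L2U LU _ _] := Xs_regular s32 XU; exact: hart_iht. Qed.

Lemma quadratic_lipschitz (l1 l5 s C t : R) (U : R -> R -> R) : 3 / 2 < s -> 0 <= t ->
  (forall r, 0 <= r -> Xs s (U r)) -> 0 <= C ->
  (forall r, 0 <= r <= t + 1 -> ns s (U r) <= C /\
    ns s (fun x => U r x - U t x - (r - t) * nl l1 l5 (U t) (U t) x) <= C * (r - t) ^+ 2) ->
  exists K, forall r, 0 <= r -> `|r - t| < 1 ->
    ns s (fun x => U r x - U t x) <= K * `|r - t| /\
    ns s (fun x => nl l1 l5 (U r) (U r) x - nl l1 l5 (U t) (U t) x) <= K * `|r - t|.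
Proof.
move=> s32 t0 XU C0 hC.
have [Ct _ hCt] := nl_tame l1 l5 s32.
have [C' C'0 hC'] := nl_lip l1 l5 s32.
have Xt := XU t t0; have XN := (hCt _ _ Xt Xt).1.
have [A AE] : exists A, A = ns s (nl l1 l5 (U t) (U t)) by eexists.
have A0 : 0 <= A by rewrite AE ns_ge0.
have tT : 0 <= t <= t + 1 by rewrite t0 lerDl ler01.
exists ((C + A) * (1 + C' * C)) => r r0 rt.
have rT : 0 <= r <= t + 1 by rewrite r0/= -lerBlDl; exact: le_trans (ler_norm _) (ltW rt).
have Xr := XU r r0; have [Nr Er] := hC r rT; have [Nt _] := hC t tT.
have d : ns s (fun x => U r x - U t x) <= (C + A) * `|r - t|.
  rewrite (_ : (fun x => U r x - U t x) = (fun x => (U r x - U t x - (r - t) * nl l1 l5 (U t) (U t) x) +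
    (r - t) * nl l1 l5 (U t) (U t) x)); last by apply/funext => x; ring.
  apply: le_trans (nsD (XsB (XsB Xr Xt) (XsZ (r - t) XN)) (XsZ (r - t) XN)) _.
  rewrite (nsZ _ XN) -AE mulrDl [A * _]mulrC lerD2r; apply: le_trans Er _.
  apply: ler_wpM2l => //; rewrite -real_normK ?num_real// expr2 ler_piMl//; exact: ltW.
have CA : 0 <= (C + A) * `|r - t| by rewrite mulr_ge0// addr_ge0.
have CC : 0 <= C' * C by rewrite mulr_ge0.
split.
  by apply: le_trans d _; rewrite mulrAC ler_peMr// lerDl.
apply: le_trans (hC' _ _ _ Xr Xt Nr Nt).2 _.
apply: le_trans (ler_wpM2l CC d) _.
by rewrite [leRHS]mulrAC [leRHS]mulrC; apply: ler_wpM2r => //; rewrite lerDr.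
Qed.

Lemma quadratic_derivative (s C t r : R) (U N : R -> R) (W : R -> R) : Xs s U -> Xs s W -> Xs s N -> r != t ->
  ns s (fun x => W x - U x - (r - t) * N x) <= C * (r - t) ^+ 2 ->
  ns s (fun x => (r - t)^-1 * (W x - U x) - N x) <= C * `|r - t|.
Proof.
move=> XU XW XN rt h; have d0 : r - t != 0 by rewrite subr_eq0.
have dn : 0 < `|r - t| by rewrite normr_gt0.
rewrite (_ : (fun x => _) = (fun x => (r - t)^-1 * (W x - U x - (r - t) * N x))); last first.
  by apply/funext => x; rewrite [RHS]mulrBr (mulrA _ _ (N x)) mulVf// mul1r.
rewrite (nsZ _ (XsB (XsB XW XU) (XsZ _ XN))) normfV mulrC ler_pdivrMr// -mulrA.
by rewrite -expr2 real_normK ?num_real.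
Qed.

Lemma global_solution (l1 l5 s : R) u0 U0 : 3 / 2 < s -> hart u0 U0 -> Xs s U0 ->
  exists U : R -> R -> R, [/\ U 0 = U0, forall t, 0 <= t -> Xs s (U t),
    forall T, 0 <= T -> exists2 C, 0 <= C & forall t r, 0 <= t <= T -> 0 <= r <= T ->
      ns s (U t) <= C /\
      ns s (fun x => U r x - U t x - (r - t) * nl l1 l5 (U t) (U t) x) <= C * (r - t) ^+ 2 &
    is_solution l1 0 (- l1) (- (2 * l1)) l5 0 s u0 +oo (fun t => iht (U t))].
Proof.
move=> s32 hu0 XU0; have [U [UE XU hU]] := spectral_solution l1 l5 s32 XU0.
exists U; split => //; have s1 : s - 1 <= s by lra.
have [Ct _ hC] := nl_tame l1 l5 s32.
have XN t : 0 <= t -> Xs s (nl l1 l5 (U t) (U t)) by move=> t0; exact: (hC _ _ (XU t t0) (XU t t0)).1.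
have hu t : 0 <= t -> hart (iht (U t)) (U t) by move=> t0; exact: hart_iht_Xs (XU t t0).
have hn t : 0 <= t -> hart (iht (nl l1 l5 (U t) (U t))) (nl l1 l5 (U t) (U t)).
  by move=> t0; exact: hart_iht_Xs (XN t t0).
have lip t : 0 <= t -> exists K, forall r, 0 <= r -> `|r - t| < 1 ->
    ns s (fun x => U r x - U t x) <= K * `|r - t| /\
    ns s (fun x => nl l1 l5 (U r) (U r) x - nl l1 l5 (U t) (U t) x) <= K * `|r - t|.
  (* The constants depend on a time horizon; t + 1 leaves room for the times r with |r - t| < 1, to
     which the limit is localized. *)
  move=> t0; have t10 : 0 <= t + 1 by rewrite addr_ge0.
  have [C C0 hCC] := hU _ t10.
  have tT : 0 <= t <= t + 1 by rewrite t0 lerDl ler01.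
  apply: (@quadratic_lipschitz _ _ _ C) => // r rT; split; first exact: (hCC r t rT tT).1.
  exact: (hCC t r tT rT).2.
split.
- move=> t [t0 _]; split; first by apply/(sobolevP s (hu t t0)); exact: XU.
  have [K hK] := lip t t0.
  apply: ereal_cvg0 (within_lipschitz_cvg0 _ K t).
  apply: filterS (near_nbhs_within _ t) => r [[r0 _] rt].
  exists (ns s (fun x => U r x - U t x)).
    by apply: sobolev_norm_B; [exact: hu|exact: hu|exact: XU|exact: XU].
  by rewrite (ger0_norm (ns_ge0 _ _)); exact: (hK r r0 rt).1.
- rewrite UE.
  exact: iht_hart s32 XU0 hu0.
exists (fun t => iht (nl l1 l5 (U t) (U t))); split.
- move=> t [t0 _]; split.
    by apply/(sobolevP (s - 1) (hn t t0)); exact: (Xs_le s1 (XN t t0)).1.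
  have [K hK] := lip t t0.
  apply: ereal_cvg0 (within_lipschitz_cvg0 _ K t).
  apply: filterS (near_nbhs_within _ t) => r [[r0 _] rt].
  have XD := XsB (XN r r0) (XN t t0).
  exists (ns (s - 1) (fun x => nl l1 l5 (U r) (U r) x - nl l1 l5 (U t) (U t) x)).
    by apply: sobolev_norm_Xs (Xs_le s1 XD).1; apply: hartB; exact: hn.
  rewrite (ger0_norm (ns_ge0 _ _)); apply: le_trans (hK r r0 rt).2.
  exact: (Xs_le s1 XD).2.
- move=> t [t0 _].
  have t10 : 0 <= t + 1 by rewrite addr_ge0.
  have [C C0 hCC] := hU _ t10.
  have tT : 0 <= t <= t + 1 by rewrite t0 lerDl ler01.
  apply: ereal_cvg0 (within_dlipschitz_cvg0 _ C t).
  apply: filterS (near_dnbhs_within _ t) => r [[r0 _] rt rNt].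
  have rT : 0 <= r <= t + 1 by rewrite r0/= -lerBlDl; exact: le_trans (ler_norm _) (ltW rt).
  have [_ Er] := hCC t r tT rT.
  have Q := quadratic_derivative (XU t t0) (XU r r0) (XN t t0) rNt Er.
  have XD := XsB (XsZ (r - t)^-1 (XsB (XU r r0) (XU t t0))) (XN t t0).
  have hD := hartB (hartZ (r - t)^-1 (hartB (hu r r0) (hu t t0))) (hn t t0).
  have [XD1 ND1] := Xs_le s1 XD.
  exists (ns (s - 1) (fun x => (r - t)^-1 * (U r x - U t x) - nl l1 l5 (U t) (U t) x)).
    exact: sobolev_norm_Xs hD XD1.
  by rewrite (ger0_norm (ns_ge0 _ _)); exact: le_trans ND1 Q.
- move=> t /ltW t0 _ /=.
  have [_ LU _ LD] := Xs_regular s32 (XU t t0).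
  have E := equation_physical l1 l5 LU LD (measurable_iht LU) (ae_all (fun x => erefl)).
  apply: (@ae_imply _ _ _ E) => x Ex.
  by rewrite -[RHS](subrr (iht (nl l1 l5 (U t) (U t)) x)) -Ex !addrA.
Qed.

End global.

(** The mean value theorem for exp (- K t) y(t), whose derivative is nonpositive on the open
    interval. *)
Lemma gronwall {R : realType} (y y' : R -> R) (K t0 : R) : 0 < t0 ->
  (forall t, 0 < t < t0 -> is_derive t 1 y (y' t)) -> {within `[0, t0], continuous y} ->
  (forall t, 0 < t < t0 -> y' t <= K * y t) -> y 0 = 0 -> y t0 <= 0.
Proof.
move=> t00 dy cy yK y0.
have de t : is_derive (t : R) 1 (fun t => expR (- K * t)) (expR (- K * t) * - K).
  have dl : is_derive t (1 : R) (fun t : R => - K * t) (- K).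
    have d := is_deriveZ (- K) (is_derive_id t (1 : R)).
    by apply: (is_derive_eq d); rewrite /GRing.scale/= mulr1.
  exact: is_derive1_comp (is_derive_expR _) dl.
have dz t : t \in `]0, t0[ -> is_derive t 1 (fun t => expR (- K * t) * y t)
    (expR (- K * t) * (y' t - K * y t)).
  rewrite in_itv/= => tt; have d := is_deriveM (de t) (dy t tt).
  by apply: (is_derive_eq d); rewrite /GRing.scale/=; ring.
have cz : {within `[0, t0], continuous (fun t => expR (- K * t) * y t)}.
  move=> x; apply: cvgM; last exact: cy.
  by apply: (@continuous_subspaceT _ _ _ (fun t => expR (- K * t))) => z; exact: is_derive_cvg (de z).
have [c cI E] := MVT t00 dz cz.
move: cI; rewrite in_itv/= => cI; move: E; rewrite y0 mulr0 !subr0.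
have e0 := expR_gt0 (- K * t0); have ec := expR_gt0 (- K * c); have h := yK c cI.
move=> E; rewrite -(pmulr_rle0 _ e0) E mulr_le0_ge0 ?(ltW t00)//.
by rewrite pmulr_rle0// subr_le0.
Qed.

(** * Uniqueness *)

Section uniqueness.
Context {R : realType}.
Notation mu := (@lebesgue_measure R).
Implicit Types (f g v U V W Z : R -> R).

Lemma sqr_nsD (p : R) U V : Xs p U -> Xs p V ->
  ns p (fun x => U x + V x) ^+ 2 =
  ns p U ^+ 2 + 2 * I (fun x => (wt p x * U x) * (wt p x * V x)) + ns p V ^+ 2.
Proof.
move=> XU XV; have := sqr_nrmD XU XV; rewrite /ns => <-.
by congr (nrm _ ^+ 2); apply/funext => x; rewrite mulrDr.
Qed.

Lemma nl_diff_half (l1 l5 s : R) : 3 / 2 < s -> exists2 C, 0 <= C & forall rho V W, Xs s V -> Xs s W ->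
  ns s V <= rho -> ns s W <= rho ->
  ns (1 / 2) (fun x => nl l1 l5 V V x - nl l1 l5 W W x) <= C * rho * ns (1 / 2) (fun x => V x - W x).
Proof.
move=> s32; have s1 : 1 <= s by lra. have sh : 1 / 2 <= s by lra.
have [C C0 hC] := nl_half l1 l5 s32; have [Ct _ hCt] := nl_tame l1 l5 s32.
exists (2 * C) => [|rho V W XV XW Vr Wr]; first by rewrite mulr_ge0.
have XD := XsB XV XW.
have [X1V _] := Xs_le s1 XV; have [X1W _] := Xs_le s1 XW.
rewrite (nl_diff l1 l5 X1V X1W).
have Y1 := (Xs_le sh (hCt _ _ XD XV).1).1; have Y2 := (Xs_le sh (hCt _ _ XD XW).1).1.
apply: le_trans (nsD Y1 Y2) _; apply: le_trans (lerD (hC _ _ XD XV) (hC _ _ XD XW)) _.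
have d0 := ns_ge0 (1 / 2) (fun x => V x - W x).
have le1 := ler_wpM2l d0 Vr; have le2 := ler_wpM2l d0 Wr.
apply: le_trans (lerD (ler_wpM2l C0 le1) (ler_wpM2l C0 le2)) _.
by move: (ns _ _) => d; apply: eq_ler; ring.
Qed.

Lemma is_derive_dnbhs (f : R -> R) (t l : R) :
  (r - t)^-1 * (f r - f t) @[r --> t^'] --> l -> is_derive t 1 f l.
Proof.
move=> c.
pose q r := if r == t then l else (r - t)^-1 * (f r - f t).
have cq : {for t, continuous q}.
  apply/continuous_withinNx; rewrite {2}/q eqxx; move: c; apply: cvg_trans; apply: near_eq_cvg.
  by near=> r; rewrite /q ifF//; apply/negbTE; near: r; exact: nbhs_dnbhs_neq.
have cs : h *: 1 + t @[h --> (0 : R)] --> t.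
  have c0 : h *: 1 + t @[h --> (0 : R)] --> (0 : R) *: 1 + t.
    by apply: cvgD; [apply: cvgMl; exact: cvg_id|exact: cvg_cst].
  by rewrite scale0r add0r in c0.
have cc : q (h *: 1 + t) @[h --> (0 : R)^'] --> q t.
  by apply: cvg_within_filter; exact: cvg_comp cs cq.
rewrite {2}/q eqxx in cc.
have C : h^-1 *: (f (h *: 1 + t) - f t) @[h --> 0^'] --> l.
  move: cc; apply: cvg_trans; apply: near_eq_cvg; near=> h.
  have h0 : h != 0 by near: h; exact: nbhs_dnbhs_neq.
  rewrite /q /GRing.scale/= mulr1 addrK ifF//.
  by apply/negbTE; rewrite -subr_eq0 addrK.
by split; [apply/cvg_ex; exists l|exact: cvg_lim C].
Unshelve. all: by end_near.
Qed.

(** With e the error of the difference quotient, V = U + h (G + e). Expanding the square leaves the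
    pairing of U with e, and h times the squared norm of G + e. *)
Lemma sqr_ns_quotient (p h : R) U V G : Xs p U -> Xs p V -> Xs p G -> h != 0 ->
  `|h^-1 * (ns p V ^+ 2 - ns p U ^+ 2) - 2 * I (fun x => (wt p x * U x) * (wt p x * G x))| <=
  2 * (ns p U * ns p (fun x => h^-1 * (V x - U x) - G x)) +
   `|h| * (ns p G + ns p (fun x => h^-1 * (V x - U x) - G x)) ^+ 2.
Proof.
move=> XU XV XG h0.
have Xe : Xs p (fun x => h^-1 * (V x - U x) - G x) := XsB (XsZ h^-1 (XsB XV XU)) XG.
have [e eE] : exists e : R -> R, e = fun x => h^-1 * (V x - U x) - G x by eexists.
rewrite -eE; rewrite -eE in Xe.
have VE : V = fun x => U x + h * (G x + e x).
  by apply/funext => x; rewrite eE addrCA subrr addr0 mulrA mulfV// mul1r addrCA subrr addr0.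
have XGe := XsD XG Xe.
have E : ns p V ^+ 2 = ns p U ^+ 2 + 2 * (h * (I (fun x => (wt p x * U x) * (wt p x * G x)) +
   I (fun x => (wt p x * U x) * (wt p x * e x)))) + h ^+ 2 * ns p (fun x => G x + e x) ^+ 2.
  rewrite {1}VE sqr_nsD//; last exact: XsZ.
  rewrite (nsZ _ XGe) exprMn real_normK ?num_real//; congr (_ + 2 * _ + _).
  have L1' := L1M XU XG; have L2' := L1M XU Xe.
  rewrite -ID// -IZl; last exact: L1D.
  by congr Rintegral; apply/funext => x; ring.
rewrite E; have cs := cauchy_schwarz XU Xe; have nd := nsD XG Xe.
have n0 := ns_ge0 p (fun x => G x + e x).
rewrite -/(ns p U) -/(ns p e) in cs.
move: cs nd n0; clear E.
move: (I _) (I _) (ns p (fun x => G x + e x)) (ns p U) (ns p e) (ns p G) => a b n u ne g cs nd n0.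
rewrite (_ : _ - _ = 2 * b + h * n ^+ 2); last by field.
apply: le_trans (ler_normD _ _) _; apply: lerD.
  by rewrite normrM ger0_norm//; apply: ler_wpM2l.
rewrite normrM; apply: ler_wpM2l => //; rewrite ger0_norm ?sqr_ge0//.
by rewrite ler_sqr ?nnegrE//; exact: le_trans nd.
Qed.

Lemma is_derive_sqr_ns (p t : R) (D : R -> R -> R) (G : R -> R) : Xs p (D t) ->
  (\forall r \near t, Xs p (D r)) -> Xs p G ->
  ns p (fun x => (r - t)^-1 * (D r x - D t x) - G x) @[r --> t^'] --> 0 ->
  is_derive t 1 (fun r => ns p (D r) ^+ 2) (2 * I (fun x => (wt p x * D t x) * (wt p x * G x))).
Proof.
move=> Xt XD XG c; apply: is_derive_dnbhs.
set l := 2 * _.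
suff c0 : (r - t)^-1 * (ns p (D r) ^+ 2 - ns p (D t) ^+ 2) - l @[r --> t^'] --> 0.
  have cl : l @[_ --> t^'] --> l by exact: cvg_cst.
  have cc : ((r - t)^-1 * (ns p (D r) ^+ 2 - ns p (D t) ^+ 2) - l) + l @[r --> t^'] --> 0 + l.
    exact: cvgD c0 cl.
  rewrite add0r in cc; rewrite (_ : (fun r => _) =
    (fun r => ((r - t)^-1 * (ns p (D r) ^+ 2 - ns p (D t) ^+ 2) - l) + l)) //.
  by apply/funext => r; rewrite subrK.
have [e eE] : exists e : R -> R, e = fun r => ns p (fun x => (r - t)^-1 * (D r x - D t x) - G x).
  by eexists.
have ce : e r @[r --> t^'] --> 0 by rewrite eE.
have crt : `|r - t| @[r --> t^'] --> (0 : R).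
  have := within_dlipschitz_cvg0 setT 1 t; rewrite withinET; under eq_fun do rewrite mul1r; exact.
have up : 2 * (ns p (D t) * e r) + `|r - t| * (ns p G + e r) ^+ 2 @[r --> t^'] --> (0 : R).
  have u1 : 2 * (ns p (D t) * e r) @[r --> t^'] --> 2 * (ns p (D t) * 0).
    by apply: cvgM; [exact: cvg_cst|apply: cvgM => //; exact: cvg_cst].
  have u2 : (ns p G + e r) @[r --> t^'] --> ns p G + 0.
    by apply: cvgD => //; exact: cvg_cst.
  have := cvgD u1 (cvgM crt (cvgM u2 u2)); rewrite mulr0 mulr0 mul0r addr0; exact.
apply: norm_cvg0.
have zero : (0 : R) @[_ --> t^'] --> (0 : R) by exact: cvg_cst.
apply: (squeeze_cvgr _ zero up).
near=> r; rewrite normr_ge0/= eE; apply: sqr_ns_quotient => //.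
  by near: r; exact: nbhs_dnbhs.
by rewrite subr_eq0; near: r; exact: nbhs_dnbhs_neq.
Unshelve. all: by end_near.
Qed.

Lemma cvg_within_near (F : set_system R) {FF : Filter F} (D : set R) (f : R -> R) (l : R) :
  (\forall r \near F, D r) -> f @ within D F --> l -> f @ F --> l.
Proof.
move=> h; apply: cvg_trans => P /= hP.
by move: h hP; apply: filterS2 => r Dr; exact.
Qed.

Lemma near_time_interval (T : \bar R) (t : R) : 0 < t -> (t%:E < T)%E ->
  \forall r \near t, time_interval T r.
Proof.
move=> t0 tT; have h0 : \forall r \near t, 0 < r by exact: lt_nbhsr.
have hT : \forall r \near t, (r%:E < T)%E.
  case: T tT => [T| |] // tT; last by near=> r; rewrite ltry.
  rewrite lte_fin in tT; near=> r; rewrite lte_fin; near: r; exact: lt_nbhsl.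
by move: h0 hT; apply: filterS2 => r r0 rT; split => //; exact: ltW.
Unshelve. all: by end_near.
Qed.

Lemma sum_opp (a b c d e w : R) : b + c + d + e = - w -> a + b + c + d + e = 0 -> w = a.
Proof. lra. Qed.

(** Every solution satisfies the same spectral equation as the constructed one, but with a
    derivative in order s - 1 only and without a rate. Uniqueness has to work with this much. *)
Lemma solution_spectral (l1 l5 s : R) u0 (T : \bar R) (v : R -> R -> R) : 3 / 2 < s ->
  is_solution l1 0 (- l1) (- (2 * l1)) l5 0 s u0 T v ->
  exists V : R -> R -> R, [/\ forall t, time_interval T t -> hart (v t) (V t),
    forall t, time_interval T t -> Xs s (V t),
    forall t, time_interval T t ->
      ns s (fun x => V r x - V t x) @[r --> within (time_interval T) (nbhs t)] --> 0 &
    forall t, 0 < t -> (t%:E < T)%E ->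
      ns (s - 1) (fun x => (r - t)^-1 * (V r x - V t x) - nl l1 l5 (V t) (V t) x) @[r --> t^'] --> 0].
Proof.
move=> s32 [cv _ [vt [cvt dv eqv]]]; have s1 : s - 1 <= s by lra.
have exV t : exists V, time_interval T t -> hart (v t) V.
  case: (pselect (time_interval T t)) => [tT|n]; last by exists 0.
  have [[/Lfun2P Lv _] _] := cv t tT.
  by have [V hV] := hart_exists Lv; exists V.
have [V hV] := choice exV.
have XV t : time_interval T t -> Xs s (V t).
  by move=> tT; apply/(sobolevP s (hV t tT)); have [] := cv t tT.
have [Ct _ hCt] := nl_tame l1 l5 s32.
have XN t : time_interval T t -> Xs s (nl l1 l5 (V t) (V t)).
  by move=> tT; exact: (hCt _ _ (XV t tT) (XV t tT)).1.
exists V; split => //.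
  move=> t tT; have [_ c] := cv t tT; apply: cvg0_ereal c.
  apply: filterS (near_nbhs_within _ t) => r [rT _].
  by apply: sobolev_norm_B; [exact: hV|exact: hV|exact: XV|exact: XV].
move=> t t0 tltT; have tT : time_interval T t by split => //; exact: ltW.
have [L2V LV _ LD] := Xs_regular s32 (XV t tT).
have [Lv _ _] := hV t tT.
have hvE := iht_hart s32 (XV t tT) (hV t tT).
have E := equation_physical l1 l5 LV LD (L2_meas Lv) hvE.
(* The equation and its spectral form, both valid almost everywhere, identify the given time
   derivative with an inverse transform; the transform of [vt t] is therefore
   [nl l1 l5 (V t) (V t)]. *)
have vtE : {ae mu, forall x, iht (nl l1 l5 (V t) (V t)) x = vt t x}.
  by apply: (ae_imply2 E (eqv t t0 tltT)) => x; exact: sum_opp.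
have [[/Lfun2P Lvt _] _] := cvt t tT.
have hvt : hart (vt t) (nl l1 l5 (V t) (V t)).
  apply: hart_ae (L2_meas Lvt) (Xs_meas (XN t tT)) vtE _ (hart_iht_Xs s32 (XN t tT)).
  exact: ae_all.
have c := dv t tT.
(* At an interior time the one-sided restriction to the time interval is no restriction. *)
apply: (cvg_within_near (D := time_interval T)).
  by apply: nbhs_dnbhs; exact: near_time_interval.
apply: cvg0_ereal c.
apply: filterS (near_dnbhs_within _ t) => r [rT _ _].
apply: sobolev_norm_Xs.
  exact: hartB (hartZ (r - t)^-1 (hartB (hV r rT) (hV t tT))) hvt.
exact: (Xs_le s1 (XsB (XsZ (r - t)^-1 (XsB (XV r rT) (XV t tT))) (XN t tT))).1.
Qed.

Lemma within_sub_cvg (A B : set R) (f : R -> R) (t : R) : A `<=` B ->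
  f @ within B (nbhs t) --> (0 : R) -> f @ within A (nbhs t) --> (0 : R).
Proof.
move=> AB; apply: cvg_trans => P /= hP.
by apply: (@filterS _ (nbhs t) _ (fun r => B r -> P (f r)) _ _ hP) => r h Ar; apply: h; exact: AB.
Qed.

Lemma ns_continuous (s : R) (V : R -> R -> R) (A : set R) : (forall t, A t -> Xs s (V t)) ->
  (forall t, A t -> ns s (fun x => V r x - V t x) @[r --> within A (nbhs t)] --> 0) ->
  {within A, continuous (fun t => ns s (V t))}.
Proof.
move=> XV c; apply/subspace_continuousP => t At.
have z : ns s (V r) - ns s (V t) @[r --> within A (nbhs t)] --> 0.
  apply: norm_cvg0; have zero : (0 : R) @[_ --> within A (nbhs t)] --> (0 : R) by exact: cvg_cst.
  apply: (squeeze_cvgr _ zero (c t At)).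
  apply: filterS (near_nbhs_within _ t) => r [Ar _]; rewrite normr_ge0/=.
  by apply: ns_dist; exact: XV.
have cl : ns s (V t) @[_ --> within A (nbhs t)] --> ns s (V t) by exact: cvg_cst.
have cc : (ns s (V r) - ns s (V t)) + ns s (V t) @[r --> within A (nbhs t)] --> 0 + ns s (V t).
  exact: cvgD z cl.
have E : (fun r => (ns s (V r) - ns s (V t)) + ns s (V t)) = (fun r => ns s (V r)).
  by apply/funext => r; rewrite subrK.
by rewrite E add0r in cc.
Qed.

(** The squared H^(1/2) norm of the difference D has derivative 2 <D, N(V) - N(U)>, at most a
    multiple of itself while the H^s norms stay bounded. Since D vanishes at time 0, Gronwall's
    lemma applies. *)
Lemma solution_unique (l1 l5 s : R) u0 (T T' : \bar R) (u v : R -> R -> R) (t : R) : 3 / 2 < s ->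
  is_solution l1 0 (- l1) (- (2 * l1)) l5 0 s u0 T u ->
  is_solution l1 0 (- l1) (- (2 * l1)) l5 0 s u0 T' v ->
  time_interval T t -> time_interval T' t -> {ae mu, forall x, v t x = u t x}.
Proof.
move=> s32 solu solv tT tT'.
have [_ iu _] := solu; have [_ iv _] := solv.
have [t0|t0] := eqVneq t 0.
  by apply: (ae_imply2 iu iv) => x; rewrite t0 => -> ->.
have tgt0 : 0 < t by rewrite lt_neqAle eq_sym t0; case: tT.
have [U [hU XU cU dU]] := solution_spectral s32 solu.
have [V [hV XV cV dV]] := solution_spectral s32 solv.
have sub (S : \bar R) : (t%:E < S)%E -> `[0, t]%classic `<=` time_interval S.
  move=> tS r /=; rewrite in_itv/= => /andP[r0 rt]; split => //.
  by apply: le_lt_trans tS; rewrite lee_fin.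
have subT := sub T tT.2; have subT' := sub T' tT'.2.
have {}cU r : `[0, t]%classic r -> ns s (fun x => U q x - U r x) @[q --> within `[0, t] (nbhs r)] --> 0.
  by move=> rt; exact: within_sub_cvg subT (cU r (subT r rt)).
have {}cV r : `[0, t]%classic r -> ns s (fun x => V q x - V r x) @[q --> within `[0, t] (nbhs r)] --> 0.
  by move=> rt; exact: within_sub_cvg subT' (cV r (subT' r rt)).
have XU' r (rt : `[0, t]%classic r) := XU r (subT r rt).
have XV' r (rt : `[0, t]%classic r) := XV r (subT' r rt).
have [a aI ha] := EVT_max (ltW tgt0) (ns_continuous XU' cU).
have [b bI hb] := EVT_max (ltW tgt0) (ns_continuous XV' cV).
(* Continuity in H^s gives each norm a maximum on the compact [0, t]; the sum of the two maxima
   bounds both norms. *)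
have [rho rhoE] : exists rho, rho = ns s (U a) + ns s (V b) by eexists.
have Ur r : `[0, t]%classic r -> ns s (U r) <= rho.
  by move=> rt; apply: le_trans (ha r rt) _; rewrite rhoE lerDl ns_ge0.
have Vr r : `[0, t]%classic r -> ns s (V r) <= rho.
  by move=> rt; apply: le_trans (hb r rt) _; rewrite rhoE lerDr ns_ge0.
have [C C0 hC] := nl_diff_half l1 l5 s32.
have [Ct _ hCt] := nl_tame l1 l5 s32.
have sh : 1 / 2 <= s by lra. have sh1 : 1 / 2 <= s - 1 by lra.
have [D DE] : exists D : R -> R -> R, D = fun r x => V r x - U r x by eexists.
have XD r : `[0, t]%classic r -> Xs (1 / 2) (D r).
  by move=> rt; rewrite DE; exact: (Xs_le sh (XsB (XV' r rt) (XU' r rt))).1.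
have cD : {within `[0, t], continuous (fun r => ns (1 / 2) (D r))}.
  apply: ns_continuous XD _ => r rt.
  have cc : ns s (fun x => V q x - V r x) + ns s (fun x => U q x - U r x) @[q --> within `[0, t] (nbhs r)] --> (0 + 0 : R).
    exact: cvgD (cV r rt) (cU r rt).
  rewrite addr0 in cc.
  have zero : (0 : R) @[_ --> within `[0, t] (nbhs r)] --> (0 : R) by exact: cvg_cst.
  apply: (squeeze_cvgr _ zero cc).
  apply: filterS (near_nbhs_within _ r) => q [qt _]; rewrite ns_ge0/=.
  have X1 := XsB (XV' q qt) (XV' r rt); have X2 := XsB (XU' q qt) (XU' r rt).
  have -> : (fun x => D q x - D r x) = (fun x => (V q x - V r x) - (U q x - U r x)).
    by apply/funext => x; rewrite DE; ring.
  by apply: le_trans (Xs_le sh (XsB X1 X2)).2 _; exact: nsB.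
have int r : 0 < r < t -> `[0, t]%classic r.
  by move=> /andP[r0 rt]; rewrite /= in_itv/= !ltW.
have tt : `[0, t]%classic t by rewrite /= in_itv/= lexx ltW.
have dy r : 0 < r < t -> is_derive r 1 (fun q => ns (1 / 2) (D q) ^+ 2)
    (2 * I (fun x => (wt (1 / 2) x * D r x) * (wt (1 / 2) x * (nl l1 l5 (V r) (V r) x - nl l1 l5 (U r) (U r) x)))).
  move=> rt; have ri := int r rt; have /andP[r0 rlt] := rt.
  have YV := (hCt _ _ (XV' r ri) (XV' r ri)).1; have YU := (hCt _ _ (XU' r ri) (XU' r ri)).1.
  apply: is_derive_sqr_ns; [exact: XD|..|exact: (Xs_le sh (XsB YV YU)).1|].
    have n0 : \forall q \near r, 0 < q by exact: lt_nbhsr.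
    have n1 : \forall q \near r, q < t by exact: lt_nbhsl.
    by move: n0 n1; apply: filterS2 => q q0 qt; apply: XD; apply: int; rewrite q0.
  have rT : (r%:E < T)%E by apply: lt_trans tT.2; rewrite lte_fin.
  have rT' : (r%:E < T')%E by apply: lt_trans tT'.2; rewrite lte_fin.
  have cc : ns (s - 1) (fun x => (q - r)^-1 * (V q x - V r x) - nl l1 l5 (V r) (V r) x) +
    ns (s - 1) (fun x => (q - r)^-1 * (U q x - U r x) - nl l1 l5 (U r) (U r) x) @[q --> r^'] --> (0 + 0 : R).
    exact: cvgD (dV r r0 rT') (dU r r0 rT).
  rewrite addr0 in cc.
  have zero : (0 : R) @[_ --> r^'] --> (0 : R) by exact: cvg_cst.
  apply: (squeeze_cvgr _ zero cc).
  have nq : \forall q \near r^', 0 < q < t.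
    apply: nbhs_dnbhs; have n0 : \forall q \near r, 0 < q by exact: lt_nbhsr.
    have n1 : \forall q \near r, q < t by exact: lt_nbhsl.
    by move: n0 n1; apply: filterS2 => q q0 qt; rewrite q0.
  apply: filterS nq => q /int qi; rewrite ns_ge0/=.
  have X1 := XsB (XsZ (q - r)^-1 (XsB (XV' q qi) (XV' r ri))) YV.
  have X2 := XsB (XsZ (q - r)^-1 (XsB (XU' q qi) (XU' r ri))) YU.
  have ss : s - 1 <= s by lra.
  have [Z1 Z2] := ((Xs_le ss X1).1, (Xs_le ss X2).1).
  have -> : (fun x => (q - r)^-1 * (D q x - D r x) - (nl l1 l5 (V r) (V r) x - nl l1 l5 (U r) (U r) x)) =
    (fun x => ((q - r)^-1 * (V q x - V r x) - nl l1 l5 (V r) (V r) x) -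
              ((q - r)^-1 * (U q x - U r x) - nl l1 l5 (U r) (U r) x)).
    by apply/funext => x; rewrite DE; ring.
  by apply: le_trans (Xs_le sh1 (XsB Z1 Z2)).2 _; exact: nsB.
have y0 : ns (1 / 2) (D 0) ^+ 2 = 0.
  have z0 : `[0, t]%classic (0 : R) by rewrite /= in_itv/= lexx ltW.
  have [Lu0 LU0 _] := hU 0 (subT 0 z0); have [Lv0 LV0 _] := hV 0 (subT' 0 z0).
  have vu : {ae mu, forall x, v 0 x = u 0 x} by apply: (ae_imply2 iv iu) => x -> ->.
  have h := hart_ae (L2_meas Lu0) (L2_meas LV0) vu (ae_all (fun x => erefl)) (hV 0 (subT' 0 z0)).
  have VU := hart_unique h (hU 0 (subT 0 z0)).
  rewrite /ns (@nrm_ae0 _ (fun x => wt (1 / 2) x * D 0 x)) ?expr0n//.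
    exact: L2_meas (XD 0 z0).
  by apply: (@ae_imply _ (fun x => V 0 x = U 0 x) _ VU) => x; rewrite DE => ->; rewrite subrr mulr0.
have cy : {within `[0, t], continuous (fun r => ns (1 / 2) (D r) ^+ 2)}.
  by move=> x; exact: (cvgM (cD x) (cD x)).
have yt : ns (1 / 2) (D t) ^+ 2 <= 0.
  apply: (gronwall (K := 2 * (C * rho)) tgt0 dy cy) y0 => r rt; have ri := int r rt.
  have YV := (hCt _ _ (XV' r ri) (XV' r ri)).1; have YU := (hCt _ _ (XU' r ri) (XU' r ri)).1.
  have XG := (Xs_le sh (XsB YV YU)).1.
  have cs := cauchy_schwarz (XD r ri) XG.
  have G := hC rho _ _ (XV' r ri) (XU' r ri) (Vr r ri) (Ur r ri).
  rewrite -mulrA; apply: ler_wpM2l => //.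
  apply: le_trans (ler_norm _) _; apply: le_trans cs _.
  rewrite -/(ns (1 / 2) (D r)) expr2 mulrCA; apply: ler_wpM2l; first exact: ns_ge0.
  by rewrite DE.
have Dt0 : ns (1 / 2) (D t) = 0.
  apply/eqP; rewrite -sqrf_eq0; apply/eqP/le_anti; rewrite yt; exact: sqr_ge0.
have D0 := nrm_eq0 (XD t tt) Dt0.
(* The weight is positive, so the transforms agree almost everywhere, and injectivity of the
   transform carries this back to u and v. *)
have VU : {ae mu, forall x, V t x = U t x}.
  apply: (@ae_imply _ _ _ D0) => x /eqP; rewrite mulf_eq0 gt_eqF ?wt_gt0//= DE subr_eq0.
  by move=> /eqP.
have [Lu LU _] := hU t tT; have [Lv _ _] := hV t tT'.
have hvU := hart_ae (L2_meas Lv) (L2_meas LU) (ae_all (fun x => erefl)) VU (hV t tT').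
exact: hart_inj hvU (hU t tT).
Qed.

End uniqueness.

Theorem theorem7 (R : realType) (l1 l2 l3 l4 l5 l6 s : R) (u0 : R -> R)
  (h13 : l1 + l3 = 0) (h14 : 2 * l1 + l4 = 0) (h2 : l2 = 0) (h6 : l6 = 0)
  (hs : 3 / 2 < s) (hu0 : sobolev s u0) :
  exists (T : \bar R) (u : R -> R -> R),
    is_maximal_solution l1 l2 l3 l4 l5 l6 s u0 T u /\ T = +oo%E.
Proof.
have -> : l3 = - l1 by apply/eqP; rewrite -addr_eq0 addrC h13.
have -> : l4 = - (2 * l1) by apply/eqP; rewrite -addr_eq0 addrC h14.
rewrite h2 h6.
have [/Lfun2P L0 _] := hu0; have [U0 hU0] := hart_exists L0.
have XU0 := (sobolevP s hU0).1 hu0.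
have [U [_ _ _ sol]] := global_solution l1 l5 hs hU0 XU0.
exists +oo%E, (fun t => iht (U t)); split => //; split => //.
move=> T' v solv; split; first by rewrite leey.
move=> t tT'; have [t0 _] := tT'; apply: solution_unique hs sol solv _ tT'.
by split => //; rewrite ltry.
Qed.
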